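(* Let $h:\mathbb{C}\to\mathbb{R}$ be a smooth function, $E_h:=\{z\in\mathbb{C} : h(z)=0\}$, $G:=\mathbb{C}\setminus\{z\in\mathbb{C} : h(z)=0,\ dh(z)=0\}$, and $E_h^*:=\{z\in G : h(z)=0\}$ the regular part of $E_h$. Then every totally real disc contained in $E_h^*\times\mathbb{C}\subset\mathbb{C}^2$ is polynomially convex.
   Context: For a compact $K\subset\mathbb{C}^n$, $\widehat{K}:=\{z\in\mathbb{C}^n : |p(z)|\le \sup_K|p| \text{ for all holomorphic polynomials } p\}$, and $K$ is polynomially convex if $\widehat{K}=K$. A totally real disc is a compact subset of a $C^1$-smooth submanifold $N$ of $\mathbb{C}^2$ with $T_pN\cap iT_pN=\{0\}$ for all $p\in N$, which is diffeomorphic to the closed unit disc in the plane. *)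

(* Defs.v *)
From HB Require Import structures.
From mathcomp Require Import all_boot all_order all_algebra.
From mathcomp Require Import all_classical all_reals all_analysis.
From mathcomp Require Import complex.
Import numFieldNormedType.Exports.

Set Implicit Arguments.
Unset Strict Implicit.
Unset Printing Implicit Defensive.

Import Order.TTheory GRing.Theory Num.Theory.
Local Open Scope ring_scope.
Local Open Scope classical_set_scope.

(* Conventions: C is identified with R^2 = 'rV[R]_2 via x + iy <-> (x, y),
   and C^2 with R^4 = 'rV[R]_4 via (x1 + i y1, x2 + i y2) <-> (x1,y1,x2,y2). *)

Definition o4_0 : 'I_4 := @Ordinal 4 0 isT.
Definition o4_1 : 'I_4 := @Ordinal 4 1 isT.
Definition o4_2 : 'I_4 := @Ordinal 4 2 isT.
Definition o4_3 : 'I_4 := @Ordinal 4 3 isT.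
Definition o2_0 : 'I_2 := @Ordinal 2 0 isT.
Definition o2_1 : 'I_2 := @Ordinal 2 1 isT.
Definition o1_0 : 'I_1 := @Ordinal 1 0 isT.

Fixpoint iterD (R : realType) (V W : normedModType R) (vs : seq V) (f : V -> W)
  : V -> W :=
  match vs with
  | [::] => f
  | v :: vs' => fun x => 'D_v (iterD vs' f) x
  end.

Definition smooth (R : realType) (V W : normedModType R) (f : V -> W) : Prop :=
  forall vs : seq V,
    continuous (iterD vs f) /\ (forall v x, derivable (iterD vs f) x v).

Definition C1_on (R : realType) (m n : nat) (U : set 'rV[R]_m)
    (F : 'rV[R]_m -> 'rV[R]_n) : Prop :=
  forall x, U x ->
    differentiable F x /\ (forall v, {for x, continuous (fun y => 'd F y v)}).

Definition C1_submanifold (R : realType) (N : set 'rV[R]_4) : Prop :=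
  forall p, N p ->
  exists (d : nat) (U : set 'rV[R]_d) (phi : 'rV[R]_d -> 'rV[R]_4)
         (W : set 'rV[R]_4),
    [/\ open U, open W, W p & C1_on U phi] /\
    [/\ (forall x, U x -> forall v, 'd phi x v = 0 -> v = 0),
        (forall x y, U x -> U y -> phi x = phi y -> x = y),
        (phi @` U = N `&` W) &
        (forall O, open O -> O `<=` U ->
           exists O', open O' /\ (phi @` O = O' `&` (N `&` W)))].

Definition tangent_space (R : realType) (N : set 'rV[R]_4) (p : 'rV[R]_4)
  : set 'rV[R]_4 :=
  [set v | exists g : R -> 'rV[R]_4,
      [/\ g 0 = p, (\forall t \near 0, N (g t)), derivable g 0 1 & 'D_1 g 0 = v]].

(* multiplication by i on C^2 in real coordinates:
   (x1,y1,x2,y2) |-> (-y1,x1,-y2,x2) *)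
Definition Jc (R : realType) (v : 'rV[R]_4) : 'rV[R]_4 :=
  \row_(j < 4)
    (if (j : nat) == 0%N then - v o1_0 o4_1
     else if (j : nat) == 1%N then v o1_0 o4_0
     else if (j : nat) == 2%N then - v o1_0 o4_3
     else v o1_0 o4_2).

Definition totally_real (R : realType) (N : set 'rV[R]_4) : Prop :=
  forall p, N p -> forall v,
    tangent_space N p v ->
    (exists u, tangent_space N p u /\ v = Jc u) -> v = 0.

Definition closed_unit_disc (R : realType) : set 'rV[R]_2 :=
  [set x | x o1_0 o2_0 ^+ 2 + x o1_0 o2_1 ^+ 2 <= 1].

Definition C1_map_on (R : realType) (m n : nat) (A : set 'rV[R]_m)
    (f : 'rV[R]_m -> 'rV[R]_n) : Prop :=
  forall a, A a -> exists (U : set 'rV[R]_m) (F : 'rV[R]_m -> 'rV[R]_n),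
    [/\ open U, U a, C1_on U F & forall x, U x -> A x -> F x = f x].

Definition diffeomorphic (R : realType) (m n : nat) (A : set 'rV[R]_m)
    (B : set 'rV[R]_n) : Prop :=
  exists (f : 'rV[R]_m -> 'rV[R]_n) (g : 'rV[R]_n -> 'rV[R]_m),
    [/\ (forall x, A x -> B (f x)), (forall y, B y -> A (g y)),
        (forall x, A x -> g (f x) = x) & (forall y, B y -> f (g y) = y)] /\
    C1_map_on A f /\ C1_map_on B g.

Definition totally_real_disc (R : realType) (K : set 'rV[R]_4) : Prop :=
  compact K /\
  exists N : set 'rV[R]_4,
    [/\ C1_submanifold N, totally_real N, (K `<=` N) &
        diffeomorphic K (@closed_unit_disc R)].

Definition zc (R : realType) (q : 'rV[R]_4) : R[i] :=
  Complex (q o1_0 o4_0) (q o1_0 o4_1).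
Definition wc (R : realType) (q : 'rV[R]_4) : R[i] :=
  Complex (q o1_0 o4_2) (q o1_0 o4_3).

Definition hpoly_eval (R : realType) (n : nat) (a : nat -> nat -> R[i])
    (q : 'rV[R]_4) : R[i] :=
  \sum_(j < n) \sum_(k < n) a j k * zc q ^+ j * wc q ^+ k.

Definition poly_hull (R : realType) (K : set 'rV[R]_4) : set 'rV[R]_4 :=
  [set q | forall (n : nat) (a : nat -> nat -> R[i]) (M : R),
     (forall p, K p -> Normc.normc (hpoly_eval n a p) <= M) ->
     Normc.normc (hpoly_eval n a q) <= M].

Definition polynomially_convex (R : realType) (K : set 'rV[R]_4) : Prop :=
  poly_hull K = K.

Definition E_h (R : realType) (h : 'rV[R]_2 -> R) : set 'rV[R]_2 :=
  [set z | h z = 0].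

Definition G_h (R : realType) (h : 'rV[R]_2 -> R) : set 'rV[R]_2 :=
  ~` [set z | h z = 0 /\ (forall v, 'd h z v = 0)].

Definition E_h_star (R : realType) (h : 'rV[R]_2 -> R) : set 'rV[R]_2 :=
  [set z | G_h h z /\ h z = 0].

Definition pr_z (R : realType) (q : 'rV[R]_4) : 'rV[R]_2 :=
  \row_(j < 2) q o1_0 (widen_ord (isT : 2 <= 4)%N j).

Definition E_h_star_times_C (R : realType) (h : 'rV[R]_2 -> R) : set 'rV[R]_4 :=
  [set q | E_h_star h (pr_z q)].

(* Main.v *)
(* Parametrize K by (Z, W) on the closed disc D. By the homotopy principle
   [oka], a function without zeros along a segment of uniform limits of
   polynomials in (Z, W) keeps an inverse of that kind. It suffices to invert
   Z - zeta for every zeta off the curve Z(D), and W - w0 on each fibre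
   {Z = z0} that omits w0: products of such inverses give polynomials that are
   small on K and equal to 1 at a given point off K.

   Total reality says that the position along the curve has no local extremum
   in the interior of D. It is measured by a height th on D, monotone along the
   curve, whose values over one point of the curve differ by at least 1; so the
   disc is cut into sheets over the curve, even if the curve is closed. The
   compact sets {Z = z0, th = t} then do not separate the plane, every
   nonvanishing function on them has a square root, and counting signs of square
   roots around grid cells shows that W maps the fibres onto sets that do not
   separate the plane either. By Runge's argument some polynomial E is close to
   1 on the upper sheets over z0 and to 0 on the lower ones.

   Let T be the unit tangent of the curve. The function
   conj(T) (Z - z0) - i k (2 E - 1) can only vanish on one side of the upper sheets
   and on the other side of the lower ones. Its invertibility does not
   depend on the point of D at which the sheets are divided. At the top (bottom)
   of th these zeros can be pulled round the end of the sheets, so both sides of the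
   curve are equivalent; at the rightmost point of the curve one side is outside
   a half plane containing the curve. *)

Require Import Defs.
From HB Require Import structures.
From mathcomp Require Import all_boot all_order all_algebra.
From mathcomp Require Import all_classical all_reals all_analysis.
From mathcomp Require Import complex ring lra.

Set Implicit Arguments.
Unset Strict Implicit.
Unset Printing Implicit Defensive.

Import Order.TTheory GRing.Theory Num.Theory.
Import complex.

Local Open Scope ring_scope.

(** * Complex norm and square roots *)

(** The obstacle is a closed level curve. If [Z(D)] surrounds [zeta], the maximum principle forbids
    an inverse of [Z - zeta] from polynomials in [Z] alone, so [W] has to be used to open the curve.
    This is possible because [D] is simply connected: position along the curve, in general only an
    angle, becomes a real valued height on [D], and moving once around the curve leads to another
    sheet. Total reality supplies what the fibres need: at an interior point where the differential
    of [Z] vanishes, the tangent plane would be the complex line [{0} x C]. Square roots replace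
    logarithms and winding numbers throughout. A sign is enough to tell inside from outside, it
    needs no integer bookkeeping, and the principal root is given by a formula whose
    multiplicativity can be checked by signs of real and imaginary parts. The slope bound 1/10 of
    the charts is a convenient margin: it has to leave room for the tolerances [k / 5] and [p / 10]
    of the functions that mark the sheets. *)

Notation nm := Normc.normc.

(* lra is slow when the context contains many facts that it cannot use. It does not
   support clearing section hypotheses when the goal mentions section constants, hence
   the remaining plain calls. *)
Ltac linarith :=
  repeat match goal with H : ?T |- _ =>
    lazymatch type of T with Prop =>
      lazymatch T with
      | is_true (Order.le _ _) => fail
      | is_true (Order.lt _ _) => fail
      | is_true (andb _ _) => fail
      | @eq (complex _) _ _ => clear H
      | _ = _ => fail
      | _ /\ _ => fail
      | _ \/ _ => fail
      | _ => clear H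
      end
    end
  end; lra.

Section ComplexNorm.
Variable R : rcfType.
Implicit Types x y z : R[i].

Lemma cReM x y : Re (x * y) = Re x * Re y - Im x * Im y.
Proof. by case: x y => [a b] [c d]. Qed.
Lemma cImM x y : Im (x * y) = Re x * Im y + Im x * Re y.
Proof. by case: x y => [a b] [c d]. Qed.
Lemma cReD x y : Re (x + y) = Re x + Re y. Proof. by case: x y => [a b] [c d]. Qed.
Lemma cImD x y : Im (x + y) = Im x + Im y. Proof. by case: x y => [a b] [c d]. Qed.
Lemma cReN x : Re (- x) = - Re x. Proof. by case: x. Qed.
Lemma cImN x : Im (- x) = - Im x. Proof. by case: x. Qed.
Lemma cReB x y : Re (x - y) = Re x - Re y. Proof. by case: x y => [a b] [c d]. Qed.
Lemma cImB x y : Im (x - y) = Im x - Im y. Proof. by case: x y => [a b] [c d]. Qed.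
Lemma cReJ x : Re (conjc x) = Re x. Proof. by case: x. Qed.
Lemma cImJ x : Im (conjc x) = - Im x. Proof. by case: x. Qed.
Lemma complex_eq x y : Re x = Re y -> Im x = Im y -> x = y.
Proof. by case: x y => [a b] [c d] /= -> ->. Qed.

Definition ReImE := (cReM, cImM, cReB, cImB, cReD, cImD, cReN, cImN, cReJ, cImJ).

Lemma nm_ge0 x : 0 <= nm x.
Proof. by case: x => a b /=; rewrite sqrtr_ge0. Qed.
Lemma nm_sqr x : nm x ^+ 2 = Re x ^+ 2 + Im x ^+ 2.
Proof. by case: x => a b /=; rewrite sqr_sqrtr ?addr_ge0 ?sqr_ge0. Qed.
Lemma nm0 : nm (0 : R[i]) = 0. Proof. exact: Normc.normc0. Qed.
Lemma nm1 : nm (1 : R[i]) = 1. Proof. exact: Normc.normc1. Qed.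
Lemma nmM x y : nm (x * y) = nm x * nm y. Proof. exact: Normc.normcM. Qed.
Lemma nmV x : nm x^-1 = (nm x)^-1. Proof. exact: Normc.normcV. Qed.
Lemma nmf x y : nm (x / y) = nm x / nm y. Proof. by rewrite nmM nmV. Qed.
Lemma nmN x : nm (- x) = nm x. Proof. exact: normcN. Qed.
Lemma nmD x y : nm (x + y) <= nm x + nm y. Proof. exact: le_normcD. Qed.
Lemma nmB x y : nm (x - y) <= nm x + nm y.
Proof. by rewrite -[nm y]nmN; exact: nmD. Qed.
Lemma nmBC x y : nm (x - y) = nm (y - x). Proof. by rewrite -nmN opprB. Qed.
Lemma nmJ x : nm (conjc x) = nm x.
Proof. by case: x => a b /=; rewrite sqrrN. Qed.
Lemma nm_eq0 x : (nm x == 0) = (x == 0).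
Proof. by apply/eqP/eqP => [/Normc.eq0_normc//|->]; rewrite nm0. Qed.
Lemma nm_gt0 x : (0 < nm x) = (x != 0).
Proof. by rewrite lt_def nm_ge0 andbT nm_eq0. Qed.
Lemma nmX x n : nm (x ^+ n) = nm x ^+ n.
Proof. by elim: n => [|n IH]; rewrite ?expr0 ?nm1 // !exprS nmM IH. Qed.
Lemma nm_i : nm ('i%C : R[i]) = 1.
Proof. by rewrite /= expr0n expr1n add0r sqrtr1. Qed.

Lemma nm_real (a : R) : nm (a%:C)%C = `|a|.
Proof. by rewrite /= expr0n /= addr0 sqrtr_sqr. Qed.
Lemma nm_tri y x z : nm (x - z) <= nm (x - y) + nm (y - z).
Proof. by have := nmD (x - y) (y - z); rewrite addrA subrK. Qed.
Lemma nm_lowD x y : nm x - nm y <= nm (x + y).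
Proof. have := nmB (x + y) y; rewrite addrK => h; linarith. Qed.
Lemma nm_lowB x y : nm x - nm y <= nm (x - y).
Proof. by rewrite -[nm y]nmN; exact: nm_lowD. Qed.
Lemma Re_le_nm x : `|Re x| <= nm x.
Proof.
rewrite -(@ler_pXn2r _ 2) ?nnegrE ?nm_ge0 // nm_sqr real_normK ?num_real //.
by rewrite lerDl sqr_ge0.
Qed.
Lemma Im_le_nm x : `|Im x| <= nm x.
Proof.
rewrite -(@ler_pXn2r _ 2) ?nnegrE ?nm_ge0 // nm_sqr real_normK ?num_real //.
by rewrite lerDr sqr_ge0.
Qed.
Lemma nm_le_ReIm x : nm x <= `|Re x| + `|Im x|.
Proof.
rewrite -(@ler_pXn2r _ 2) ?nnegrE ?nm_ge0 ?addr_ge0 // nm_sqr.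
rewrite sqrrD !real_normK ?num_real // addrAC lerDl.
by rewrite mulrn_wge0 // mulr_ge0.
Qed.
Lemma Re_bound x : (- nm x <= Re x) /\ (Re x <= nm x).
Proof. by have := Re_le_nm x; rewrite ler_norml => /andP[]. Qed.
Lemma Im_bound x : (- nm x <= Im x) /\ (Im x <= nm x).
Proof. by have := Im_le_nm x; rewrite ler_norml => /andP[]. Qed.

Lemma conjcMl x : conjc x * x = ((nm x ^+ 2)%:C)%C.
Proof. by rewrite nm_sqr; case: x => a b; apply: complex_eq => /=; ring. Qed.

Lemma divc_conj x y : y != 0 -> x / y = x * conjc y * ((nm y ^+ 2)^-1)%:C%C.
Proof.
move=> y0; apply: (mulIf y0); rewrite divfK // mulrAC -[x * _ * y]mulrA conjcMl -mulrA.
rewrite -rmorphM mulfV ?rmorph1 ?mulr1 // expf_neq0 // nm_eq0 //.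
Qed.

(* Principal square root: the one with nonnegative real part, continuous off
   the negative real axis. On the axis (Re x = - nm x) the formula gives junk. *)
Definition psqrt x : R[i] :=
  (x + (nm x)%:C%C) / (Num.sqrt (2 * (nm x + Re x)))%:C%C.

(** [nm x + Re x] vanishes exactly on the closed negative real axis, so this is the slit plane;
    positivity also makes the denominator of [psqrt] nonzero. *)
Definition slit x := 0 < nm x + Re x.

Lemma slitP x : slit x <-> (0 < Re x \/ Im x != 0).
Proof.
rewrite /slit; have [h1 h2] := Re_bound x; have h3 := nm_sqr x.
split=> [h|].
  case: (ltP 0 (Re x)) => [|hx]; [by left|right].
  apply/eqP => y0; rewrite y0 expr0n addr0 in h3.
  have : nm x = - Re x.
    apply: (@pexpIrn _ 2%N) => //; rewrite ?nnegrE ?nm_ge0 ?oppr_ge0 //.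
    by rewrite sqrrN.
  by move=> e; rewrite e addNr ltxx in h.
case=> [hx|hy]; first by rewrite ltr_wpDl ?nm_ge0.
rewrite lt_neqAle eq_sym; apply/andP; split; last by linarith.
apply/eqP => e; have e' : nm x = - Re x by linarith.
move: h3; rewrite e' sqrrN => /eqP; rewrite eq_sym addrC -subr_eq0 addrK.
by rewrite sqrf_eq0 (negPf hy).
Qed.

Lemma slit_neq0 x : slit x -> x != 0.
Proof. by apply: contraTneq => ->; rewrite /slit nm0 add0r ltxx. Qed.

Lemma slit_Re x : 0 < Re x -> slit x. Proof. by move=> h; apply/slitP; left. Qed.

Lemma psqrt_sqr x : slit x -> psqrt x ^+ 2 = x.
Proof.
move=> sx; rewrite /psqrt expr_div_n -rmorphXn /= sqr_sqrtr; last first.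
  by rewrite mulr_ge0 // ltW.
have nz : (2 * (nm x + Re x))%:C%C != 0 :> R[i].
  by rewrite eq_complex /= eqxx andbT mulf_neq0 ?pnatr_eq0 // gt_eqF.
apply: (mulIf nz); rewrite divfK //.
have h3 := nm_sqr x; rewrite expr2; apply: complex_eq; rewrite !ReImE /=.
  by ring: h3.
by ring.
Qed.

Lemma psqrt_Re x : slit x -> 0 < Re (psqrt x).
Proof.
move=> sx; rewrite /psqrt -fmorphV cReM /= mulr0 subr0 cReD /=.
by rewrite mulr_gt0 // ?invr_gt0 ?sqrtr_gt0 ?mulr_gt0 //; rewrite addrC.
Qed.

Lemma psqrt_neq0 x : slit x -> psqrt x != 0.
Proof.
move=> /psqrt_Re h; apply/eqP => e; by rewrite e ltxx in h.
Qed.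

Lemma psqrt_uniq x y : slit x -> y ^+ 2 = x -> 0 < Re y -> y = psqrt x.
Proof.
move=> sx e hy; have /eqP : y ^+ 2 = psqrt x ^+ 2 by rewrite psqrt_sqr.
rewrite eqf_sqr => /orP[/eqP//|/eqP e2]; exfalso.
by move: hy; rewrite e2 cReN oppr_gt0; have := psqrt_Re sx; linarith.
Qed.

Lemma psqrt1 : psqrt (1 : R[i]) = 1.
Proof. by apply/esym/psqrt_uniq; rewrite ?expr1n // ?slit_Re //= ltr01. Qed.

(** [x] factors as [(psqrt (1 + x) - 1) * (psqrt (1 + x) + 1)], and the second factor has real part
    above 1. *)
Lemma psqrt_near1 x : nm x <= 1 / 2 -> nm (psqrt (1 + x) - 1) <= nm x.
Proof.
move=> hx; have s : slit (1 + x).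
  by apply: slit_Re; rewrite cReD /=; have := Re_bound x; linarith.
have h := psqrt_Re s; have e := psqrt_sqr s.
have n1 : 1 <= nm (psqrt (1 + x) + 1).
  by have := Re_bound (psqrt (1 + x) + 1); rewrite cReD /=; linarith.
have -> : nm x = nm (psqrt (1 + x) - 1) * nm (psqrt (1 + x) + 1).
  by rewrite -nmM -subr_sqr e expr1n addrC addKr.
by rewrite ler_peMr ?nm_ge0.
Qed.

(** The quotient of two principal roots always squares to [x / y]; the hypothesis puts it in the
    right half plane, which makes it the principal root. *)
Lemma psqrt_div x y : slit x -> slit y -> 0 < Re (psqrt x * conjc (psqrt y)) ->
  slit (x / y) /\ psqrt (x / y) = psqrt x / psqrt y.
Proof.
move=> sx sy h.
have y0 := psqrt_neq0 sy.
have eR := divc_conj (psqrt x) y0.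
have hR : 0 < Re (psqrt x / psqrt y).
  rewrite eR cReM /= mulr0 subr0 mulr_gt0 // invr_gt0 exprn_gt0 //.
  by rewrite nm_gt0.
have e2 : (psqrt x / psqrt y) ^+ 2 = x / y by rewrite expr_div_n !psqrt_sqr.
have s : slit (x / y).
  apply/slitP; rewrite -e2; move: hR; move: (psqrt x / psqrt y) => z hz.
  rewrite expr2 !ReImE.
  have [->|nz] := eqVneq (Im z) 0.
    by left; rewrite mulr0 subr0 mulr_gt0.
  by right; rewrite mulrC -mulr2n mulrn_eq0 /= mulf_neq0 // gt_eqF.
by split=> //; apply/esym/psqrt_uniq.
Qed.

Lemma psqrt_div_neg x y : slit x -> slit y -> slit (x / y) ->
   Re (psqrt x * conjc (psqrt y)) < 0 -> psqrt (x / y) = - (psqrt x / psqrt y).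
Proof.
move=> sx sy s h.
have y0 := psqrt_neq0 sy.
have eR := divc_conj (psqrt x) y0.
apply/esym/psqrt_uniq => //; first by rewrite sqrrN expr_div_n !psqrt_sqr.
rewrite cReN oppr_gt0 eR cReM /= mulr0 subr0 nmulr_rlt0 // invr_gt0 exprn_gt0 //.
by rewrite nm_gt0.
Qed.

Lemma psqrt_Im x : slit x -> Im x = 2 * Re (psqrt x) * Im (psqrt x).
Proof. by move=> sx; rewrite -{1}(psqrt_sqr sx) expr2 cImM; ring. Qed.

Lemma psqrt_ReE x : slit x -> Re x = Re (psqrt x) ^+ 2 - Im (psqrt x) ^+ 2.
Proof. by move=> sx; rewrite -{1}(psqrt_sqr sx) !expr2 cReM; ring. Qed.

Lemma sqrt_exists x : exists y, y ^+ 2 = x.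
Proof.
have [s|s] := boolP (slit x); first by exists (psqrt x); exact: psqrt_sqr.
have [s'|s'] := boolP (slit (- x)).
  exists ('i%C * psqrt (- x)); rewrite exprMn psqrt_sqr //.
  by rewrite expr2; apply: complex_eq; rewrite !ReImE /=; ring.
exists 0; rewrite expr0n /=; apply/esym/eqP; rewrite -nm_eq0.
move: s s'; rewrite /slit nmN cReN -!leNgt => h1 h2.
by rewrite eq_le nm_ge0 andbT; linarith.
Qed.

End ComplexNorm.

(** * Compactness and continuity in the parameter disc *)

Section Compactness.
Variable R : realType.
Implicit Types (S A : R[i] -> Prop) (f g : R[i] -> R[i]) (u v : R[i]) (d e : R).

(* Compactness as the principle local-to-uniform for monotone properties. *)
Definition ccompact S := forall Q : R[i] -> R -> Prop,
  (forall u d d', d' <= d -> Q u d -> Q u d') ->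
  (forall u0, S u0 -> exists2 d, 0 < d & forall u, S u -> nm (u - u0) < d -> Q u d) ->
  exists2 d, 0 < d & forall u, S u -> Q u d.

Definition ccont S f := forall u0, S u0 -> forall e, 0 < e ->
  exists2 d, 0 < d & forall u, S u -> nm (u - u0) < d -> nm (f u - f u0) < e.

(** Near a point of [S] outside [A] the property to be made uniform is vacuous. *)
Lemma ccompact_closed S A : ccompact S -> (forall u, A u -> S u) ->
  (forall u0, S u0 -> ~ A u0 ->
     exists2 d, 0 < d & forall u, A u -> d <= nm (u - u0)) ->
  ccompact A.
Proof.
move=> cS AS clA Q mQ lQ.
have [|u0 Su0|d d0 h] := cS (fun u d => A u -> Q u d).
- by move=> u d d' le h Au; apply: mQ le _; exact: h.
- have [Au0|nA] := pselect (A u0).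
    have [d d0 h] := lQ _ Au0; exists d => // u _ hu Au; exact: h.
  have [d d0 h] := clA _ Su0 nA; exists d => // u _ hu Au.
  by have := h _ Au; rewrite leNgt hu.
by exists d => // u Au; apply: h => //; exact: AS.
Qed.

Lemma ccont_sub S A f : (forall u, A u -> S u) -> ccont S f -> ccont A f.
Proof.
move=> AS cf u0 Au0 e e0; have [d d0 h] := cf _ (AS _ Au0) e e0.
by exists d => // u Au; apply: h; exact: AS.
Qed.

Lemma ccont_eq S f g : (forall u, S u -> f u = g u) -> ccont S f -> ccont S g.
Proof.
move=> E cf u0 Su0 e e0; have [d d0 h] := cf _ Su0 e e0.
by exists d => // u Su hu; rewrite -!E //; exact: h.
Qed.

Lemma ccont_cst S c : ccont S (fun=> c).
Proof. by move=> u0 _ e e0; exists 1 => // u _ _; rewrite subrr nm0. Qed.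

Lemma ccont_id S : ccont S id.
Proof. by move=> u0 _ e e0; exists e. Qed.

Lemma ccont_comp S f (F : R[i] -> R[i]) :
  (forall u0, S u0 -> forall e, 0 < e -> exists2 d, 0 < d &
     forall z, nm (z - f u0) < d -> nm (F z - F (f u0)) < e) ->
  ccont S f -> ccont S (fun u => F (f u)).
Proof.
move=> cF cf u0 Su0 e e0; have [d d0 h] := cF _ Su0 e e0.
have [d' d'0 h'] := cf _ Su0 d d0; exists d' => // u Su hu.
by apply: h; exact: h'.
Qed.

Lemma ccontD S f g : ccont S f -> ccont S g -> ccont S (fun u => f u + g u).
Proof.
move=> cf cg u0 Su0 e e0; have e2 : 0 < e / 2 by rewrite divr_gt0.
have [d d0 h] := cf _ Su0 _ e2; have [d' d'0 h'] := cg _ Su0 _ e2.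
exists (Num.min d d'); first by rewrite lt_min d0.
move=> u Su; rewrite lt_min => /andP[h1 h2].
rewrite opprD addrACA; apply: (le_lt_trans (nmD _ _)).
by have := h _ Su h1; have := h' _ Su h2; linarith.
Qed.

Lemma ccontN S f : ccont S f -> ccont S (fun u => - f u).
Proof.
move=> cf u0 Su0 e e0; have [d d0 h] := cf _ Su0 e e0; exists d => // u Su hu.
by rewrite -opprD nmN; exact: h.
Qed.

Lemma ccontB S f g : ccont S f -> ccont S g -> ccont S (fun u => f u - g u).
Proof. by move=> cf cg; apply: ccontD => //; exact: ccontN. Qed.

Lemma ccontM S f g : ccont S f -> ccont S g -> ccont S (fun u => f u * g u).
Proof.
move=> cf cg u0 Su0 e e0.
pose B := 1 + nm (f u0) + nm (g u0).
have B0 : 0 < B by rewrite /B; have := nm_ge0 (f u0); have := nm_ge0 (g u0); linarith.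
pose e' := Num.min 1 (e / (2 * B)).
have e'0 : 0 < e' by rewrite lt_min ltr01 divr_gt0 // mulr_gt0.
have [d d0 h] := cf _ Su0 _ e'0; have [d' d'0 h'] := cg _ Su0 _ e'0.
exists (Num.min d d'); first by rewrite lt_min d0.
move=> u Su; rewrite lt_min => /andP[h1 h2].
have -> : f u * g u - f u0 * g u0 =
   (f u - f u0) * (g u - g u0) + f u0 * (g u - g u0) + (f u - f u0) * g u0 by ring.
have l1 := h _ Su h1; have l2 := h' _ Su h2.
have le1 : e' <= 1 by rewrite ge_min lexx.
have le2 : e' * (2 * B) <= e.
  by rewrite -ler_pdivlMr ?mulr_gt0 // ge_min lexx orbT.
apply: (le_lt_trans (nmD _ _)); rewrite nmM.
apply: (@le_lt_trans _ _ (e' * B)); last first.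
  by apply: (lt_le_trans _ le2); rewrite ltr_pM2l //; linarith.
apply: (@le_trans _ _ (e' * 1 + nm (f u0) * e' + e' * nm (g u0))).
  apply: lerD; last by rewrite ler_wpM2r ?nm_ge0 // ltW.
  apply: (le_trans (nmD _ _)); rewrite !nmM; apply: lerD.
    by rewrite ler_pM ?nm_ge0 // ltW // (lt_le_trans l2).
  by rewrite ler_wpM2l ?nm_ge0 // ltW.
by rewrite /B; linarith.
Qed.

Lemma ccontV S f : (forall u, S u -> f u != 0) -> ccont S f ->
  ccont S (fun u => (f u)^-1).
Proof.
move=> nz; apply: ccont_comp => u0 /nz; move: (f u0) => z0 z00 e e0.
have n0 : 0 < nm z0 by rewrite nm_gt0.
exists (Num.min (nm z0 / 2) (e * nm z0 ^+ 2 / 2)).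
  by rewrite lt_min !divr_gt0 // mulr_gt0 // exprn_gt0.
move=> z; rewrite lt_min => /andP[h1 h2].
have h3 : nm z0 / 2 <= nm z.
  by have := nm_lowB z0 (z0 - z); rewrite subKr (nmBC z0); linarith.
have nz' : z != 0 by rewrite -nm_gt0; linarith.
have -> : z^-1 - z0^-1 = (z0 - z) / (z * z0) by field; rewrite z00.
rewrite nmf nmBC nmM ltr_pdivrMr; last by rewrite mulr_gt0 // nm_gt0.
by have := ler_wpM2l (ltW (mulr_gt0 e0 n0)) h3; rewrite expr2 in h2; linarith.
Qed.

Lemma ccont_re S f : ccont S f -> ccont S (fun u => (Re (f u))%:C%C).
Proof.
apply: (@ccont_comp S f (fun z => (complex.Re z)%:C%C)) => u0 _ e e0; exists e => // z hz.
by rewrite -rmorphB nm_real -cReB; apply: le_lt_trans hz; exact: Re_le_nm.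
Qed.

Lemma ccont_nm S f : ccont S f -> ccont S (fun u => (nm (f u))%:C%C).
Proof.
apply: (@ccont_comp S f (fun z => (nm z)%:C%C)) => u0 _ e e0; exists e => // z hz.
rewrite -rmorphB nm_real; apply: le_lt_trans hz.
by rewrite ler_norml; have := nm_lowB z (f u0); have := nm_lowB (f u0) z;
   rewrite (nmBC (f u0)); linarith.
Qed.

(** [ccompact] is applied to [d <= nm (f u)]: the uniform radius is itself the lower bound. *)
Lemma ccont_min S f : ccompact S -> ccont S f -> (forall u, S u -> f u != 0) ->
  exists2 m, 0 < m & forall u, S u -> m <= nm (f u).
Proof.
move=> cS cf nz; apply: (cS (fun u d => d <= nm (f u))).
  by move=> u d d'; exact: le_trans.
move=> u0 Su0; have n0 : 0 < nm (f u0) / 2 by rewrite divr_gt0 // nm_gt0 nz.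
have [d d0 h] := cf _ Su0 _ n0; exists (Num.min d (nm (f u0) / 2)).
  by rewrite lt_min d0.
move=> u Su; rewrite lt_min => /andP[hu _]; rewrite ge_min; apply/orP; right.
have := h _ Su hu; have := nm_lowB (f u0) (f u0 - f u).
by rewrite subKr (nmBC (f u0)); linarith.
Qed.

Lemma ccont_bound S f : ccompact S -> ccont S f ->
  exists2 B, 0 < B & forall u, S u -> nm (f u) <= B.
Proof.
move=> cS cf; have [||d d0 h] := cS (fun u d => 0 < d -> nm (f u) <= d^-1).
- move=> u d d' le h d'0; have d0 := lt_le_trans d'0 le.
  by apply: (le_trans (h d0)); rewrite lef_pV2.
- move=> u0 Su0; have [d d0 h] := cf _ Su0 1 ltr01.
  have n0 : 0 < 1 + nm (f u0) by have := nm_ge0 (f u0); linarith.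
  exists (Num.min d (1 + nm (f u0))^-1); first by rewrite lt_min d0 invr_gt0.
  move=> u Su; rewrite lt_min => /andP[hu _] m0.
  apply: (@le_trans _ _ (1 + nm (f u0))).
    have := h _ Su hu; have := nmD (f u - f u0) (f u0); rewrite subrK; linarith.
  rewrite -[leLHS]invrK lef_pV2 ?posrE ?invr_gt0 //.
  by rewrite ge_min lexx orbT.
by exists d^-1; rewrite ?invr_gt0 // => u Su; exact: h.
Qed.

Lemma ccont_unif S f : ccompact S -> ccont S f -> forall e, 0 < e ->
  exists2 d, 0 < d & forall u v, S u -> S v -> nm (u - v) < d -> nm (f u - f v) < e.
Proof.
move=> cS cf e e0; have e2 : 0 < e / 2 by rewrite divr_gt0.
have [||d d0 h] := cS (fun u d => forall v, S v -> nm (v - u) < d -> nm (f v - f u) < e).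
- by move=> u d d' le h v Sv hv; apply: h => //; exact: lt_le_trans le.
- move=> u0 Su0; have [d d0 h] := cf _ Su0 _ e2.
  exists (d / 2); rewrite ?divr_gt0 // => u Su hu v Sv hv.
  have hv0 : nm (v - u0) < d by have := nm_tri u v u0; linarith.
  have hu0 : nm (u - u0) < d by linarith.
  have := h _ Su hu0; have := h _ Sv hv0; have := nm_tri (f u0) (f v) (f u).
  by rewrite (nmBC (f u0)); linarith.
by exists d => // u v Su Sv hd; exact: h.
Qed.

(** Without a maximum every value could be exceeded; compactness makes the gain uniform, and
    iterating it contradicts boundedness. *)
Lemma ccont_max S (f : R[i] -> R) : ccompact S -> ccont S (fun u => (f u)%:C%C) ->
  (exists u, S u) -> exists2 u0, S u0 & forall u, S u -> f u <= f u0.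
Proof.
move=> cS cf [w Sw]; apply: contrapT => no.
have no' u : S u -> exists2 v, S v & f u < f v.
  move=> Su; apply: contrapT => hn; apply: no; exists u => // v Sv.
  by rewrite leNgt; apply/negP => h; apply: hn; exists v.
have [||d d0 h] := cS (fun u d => exists2 v, S v & f u + d <= f v).
- by move=> u d d' le [v Sv h]; exists v => //; apply: le_trans h; rewrite lerD2l.
- move=> u0 Su0; have [v Sv hv] := no' _ Su0.
  have e0 : 0 < (f v - f u0) / 2 by rewrite divr_gt0 // subr_gt0.
  have [d d0 hd] := cf _ Su0 _ e0.
  exists (Num.min d ((f v - f u0) / 2)); first by rewrite lt_min d0.
  move=> u Su; rewrite lt_min => /andP[hu _]; exists v => //.
  have := hd _ Su hu; rewrite -rmorphB nm_real ltr_norml => /andP[h1 h2].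
  have : Num.min d ((f v - f u0) / 2) <= (f v - f u0) / 2 by rewrite ge_min lexx orbT.
  by linarith.
have [B B0 hB] := ccont_bound cS cf.
have iter n : exists2 v, S v & f w + d *+ n <= f v.
  elim: n => [|n [v Sv IH]]; first by exists w; rewrite ?addr0.
  have [v' Sv' h'] := h _ Sv; exists v' => //; rewrite mulrSr; linarith.
pose n := Num.bound `|(B - f w) / d|.
have [v Sv hv] := iter n; have := hB _ Sv; rewrite nm_real => hb.
have : (B - f w) / d < n%:R.
  by apply: le_lt_trans (archi_boundP (normr_ge0 _)); rewrite ler_norm.
rewrite ltr_pdivrMr // mulr_natl => h2.
by have := le_trans (ler_norm _) hb; linarith.
Qed.

(** Connectedness of the unit interval, in the form used for continuation arguments: the set of [s]
    such that [P] holds on all of [[0, s]] has a supremum, which local constancy pushes to 1. *)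
Lemma segment_locally_const (P : R -> Prop) :
  (forall s, 0 <= s <= 1 -> exists2 d, 0 < d &
     forall s', 0 <= s' <= 1 -> `|s' - s| < d -> (P s <-> P s')) ->
  P 0 -> P 1.
Proof.
move=> loc P0.
pose E : set R := fun s => 0 <= s <= 1 /\ forall t, 0 <= t <= s -> P t.
have E0 : E 0.
  split; first by rewrite lexx ler01.
  by move=> t ht; have -> : t = 0 by apply/eqP; rewrite eq_le andbC.
have ubE : ubound E 1 by move=> s [/andP[_ ?]].
have supE : has_sup E by split; [exists 0|exists 1].
set m := sup E.
have m1 : m <= 1 by apply: ge_sup => //; exists 0.
have m0 : 0 <= m by apply: ub_le_sup => //; exists 1.
have hm : 0 <= m <= 1 by rewrite m0.
have [d d0 hd] := loc m hm.
have [s [hs Es] ltms] := sup_adherent d0 supE.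
rewrite -/m in ltms.
have sm : s <= m by apply: ub_le_sup => //; exists 1.
have Pm : P m.
  apply: (hd s _ _).2 => //; first by rewrite ltr_norml; linarith.
  by apply: Es; rewrite lexx; case/andP: hs => ->.
have below t : 0 <= t <= m -> P t.
  move=> /andP[t0 tm]; have [ts|st] := leP t s; first by apply: Es; rewrite t0.
  by apply/(hd t) => //; [rewrite t0 /=; linarith|rewrite ltr_norml; linarith].
have [->//|ml1] := eqVneq 1 m.
have {}ml1 : m < 1 by rewrite lt_neqAle eq_sym ml1.
exfalso.
pose x := Num.min 1 (m + d / 2).
have xm : m < x by rewrite lt_min ml1 /=; linarith.
have x1 : x <= 1 by rewrite ge_min lexx.
have xd : x <= m + d / 2 by rewrite ge_min lexx orbT.
suff : E x by move=> /(ub_le_sup (ex_intro _ 1 ubE)); rewrite -/m; linarith.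
split=> [|t /andP[t0 tx]]; first by linarith.
have [tm|mt] := leP t m; first by apply: below; rewrite t0.
by apply/(hd t); [linarith|rewrite ltr_norml; linarith|].
Qed.

Lemma convex_locally_const S (P : R[i] -> Prop) :
  (forall u v (s : R), S u -> S v -> 0 <= s <= 1 -> S (u + s%:C%C * (v - u))) ->
  (forall u, S u -> exists2 d, 0 < d & forall v, S v -> nm (v - u) < d -> (P u <-> P v)) ->
  forall u v, S u -> S v -> P u -> P v.
Proof.
move=> cvx loc u v Su Sv Pu.
pose Q s := P (u + s%:C%C * (v - u)).
suff : Q 0 -> Q 1 by rewrite /Q rmorph0 rmorph1 mul0r mul1r addr0 addrC subrK; exact.
apply: segment_locally_const => s hs.
have [d d0 hd] := loc _ (cvx _ _ _ Su Sv hs).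
have B0 : 0 < 1 + nm (v - u) by have := nm_ge0 (v - u); linarith.
exists (d / (1 + nm (v - u))); first by rewrite divr_gt0.
move=> s' hs' hd'; apply: hd; first exact: cvx.
have -> : u + s'%:C%C * (v - u) - (u + s%:C%C * (v - u)) = (s' - s)%:C%C * (v - u).
  by rewrite rmorphB; ring.
rewrite nmM nm_real; apply: (@le_lt_trans _ _ (`|s' - s| * (1 + nm (v - u)))).
  by rewrite ler_wpM2l //; linarith.
by rewrite -ltr_pdivlMr.
Qed.

End Compactness.

(** * Uniform limits of polynomials in (Z, W) and their inverses *)

Section MoreSqrt.
Variable R : realType.
Implicit Types x y z : R[i].

(** In [x - y], a difference of two squares, the factor [psqrt x + psqrt y] has modulus at least
    [Re (psqrt y)]. *)
Lemma psqrt_lip x y : slit x -> slit y ->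
  nm (psqrt x - psqrt y) * Re (psqrt y) <= nm (x - y).
Proof.
move=> sx sy; have hx := psqrt_Re sx; have hy := psqrt_Re sy.
rewrite -[in leRHS](psqrt_sqr sx) -[in leRHS](psqrt_sqr sy) subr_sqr nmM.
rewrite ler_wpM2l ?nm_ge0 //.
by have := Re_bound (psqrt x + psqrt y); rewrite cReD; linarith.
Qed.

(** By [psqrt_lip] the two roots differ by less than [Re (psqrt y)], so their quotient lies in the
    disc of radius 1 around 1 and [psqrt_div] applies. *)
Lemma psqrt_close x y : slit x -> slit y -> nm (x - y) < Re (psqrt y) ^+ 2 ->
  slit (x / y) /\ psqrt (x / y) = psqrt x / psqrt y.
Proof.
move=> sx sy h; apply: psqrt_div => //.
have hy := psqrt_Re sy; have := psqrt_lip sx sy.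
move: h hy; set a := psqrt x; set b := psqrt y => h hy l.
have l1 : nm (a - b) < Re b.
  by rewrite -(ltr_pM2r hy); apply: (le_lt_trans l); rewrite -expr2.
have -> : a * conjc b = conjc b * b + (a - b) * conjc b by ring.
rewrite conjcMl cReD /=; have [h1 _] := Re_bound ((a - b) * conjc b).
have hb : Re b <= nm b by have := Re_bound b; linarith.
rewrite nmM nmJ in h1.
have : nm (a - b) * nm b < nm b * nm b by rewrite ltr_pM2r; linarith.
by rewrite expr2; linarith.
Qed.

(** Star-shapedness around 1 is what lets [oka_psqrt] start from the constant 1. *)
Lemma slit_seg x (s : R) : slit x -> 0 <= s <= 1 -> slit (1 + s%:C%C * (x - 1)).
Proof.
move=> /slitP sx /andP[s0 s1]; apply/slitP; rewrite !ReImE /= !mul0r subr0 addr0 add0r.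
case: sx => [hx|hx]; first by left; nra.
have [->|nz] := eqVneq s 0; first by left; rewrite mul0r addr0 ltr01.
by right; rewrite subr0 mulf_neq0.
Qed.

Lemma pow2_small (e : R) : 0 < e -> exists n, (1 / 2) ^+ n <= e.
Proof.
move=> e0; exists (Num.bound e^-1); set n := Num.bound _.
have h : e^-1 < n%:R by apply: archi_boundP; rewrite invr_ge0 ltW.
have h2 : (n%:R : R) <= 2 ^+ n by rewrite -natrX ler_nat ltnW // ltn_expl.
rewrite expr_div_n expr1n div1r -[leRHS]invrK lef_pV2 ?posrE ?invr_gt0 ?exprn_gt0 //.
exact: le_trans (ltW h) h2.
Qed.

End MoreSqrt.

Section Approx.
Variables (R : realType) (Z W : R[i] -> R[i]).
Implicit Types (S : R[i] -> Prop) (f g F G x : R[i] -> R[i]) (p q : {poly {poly R[i]}}).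

Definition ev2 p (z w : R[i]) : R[i] := p.[w%:P].[z].

Lemma ev2D p q z w : ev2 (p + q) z w = ev2 p z w + ev2 q z w.
Proof. by rewrite /ev2 !hornerD. Qed.
Lemma ev2N p z w : ev2 (- p) z w = - ev2 p z w.
Proof. by rewrite /ev2 !hornerN. Qed.
Lemma ev2M p q z w : ev2 (p * q) z w = ev2 p z w * ev2 q z w.
Proof. by rewrite /ev2 !hornerM. Qed.
Lemma ev2C c z w : ev2 (c%:P%:P) z w = c.
Proof. by rewrite /ev2 !hornerC. Qed.
Lemma ev2Z z w : ev2 ('X%:P) z w = z.
Proof. by rewrite /ev2 hornerC hornerX. Qed.
Lemma ev2W z w : ev2 'X z w = w.
Proof. by rewrite /ev2 hornerX hornerC. Qed.
Lemma ev2B p q z w : ev2 (p - q) z w = ev2 p z w - ev2 q z w.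
Proof. by rewrite ev2D ev2N. Qed.

Definition Ap S f := forall e : R, 0 < e ->
  exists p, forall u, S u -> nm (f u - ev2 p (Z u) (W u)) <= e.

(** Invertibility in the algebra of uniform limits: the inverse has to be such a limit itself, which
    is more than absence of zeros on [S]. *)
Definition Inv S f := exists2 g, Ap S g & forall u, S u -> f u * g u = 1.

Lemma Ap_ev S p : Ap S (fun u => ev2 p (Z u) (W u)).
Proof. by move=> e e0; exists p => u _; rewrite subrr nm0 ltW. Qed.

Lemma Ap_eq S f g : (forall u, S u -> f u = g u) -> Ap S f -> Ap S g.
Proof.
move=> E hf e e0; have [p hp] := hf e e0; exists p => u Su.
by rewrite -E //; exact: hp.
Qed.

Lemma Ap_cst S c : Ap S (fun=> c).
Proof. by apply: (Ap_eq (f := fun u => ev2 c%:P%:P (Z u) (W u))) (@Ap_ev _ _) => u _; rewrite ev2C. Qed.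
Lemma Ap_Z S : Ap S Z.
Proof. by apply: (Ap_eq (f := fun u => ev2 'X%:P (Z u) (W u))) (@Ap_ev _ _) => u _; rewrite ev2Z. Qed.
Lemma Ap_W S : Ap S W.
Proof. by apply: (Ap_eq (f := fun u => ev2 'X (Z u) (W u))) (@Ap_ev _ _) => u _; rewrite ev2W. Qed.

Lemma Ap_lim S f : (forall e : R, 0 < e -> exists2 g, Ap S g &
    forall u, S u -> nm (f u - g u) <= e) -> Ap S f.
Proof.
move=> h e e0; have e2 : 0 < e / 2 by rewrite divr_gt0.
have [g /(_ _ e2)[p hp] hg] := h _ e2; exists p => u Su.
by have := hp _ Su; have := hg _ Su; have := nm_tri (g u) (f u) (ev2 p (Z u) (W u)); linarith.
Qed.

Lemma ApD S f g : Ap S f -> Ap S g -> Ap S (fun u => f u + g u).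
Proof.
move=> hf hg e e0; have e2 : 0 < e / 2 by rewrite divr_gt0.
have [p hp] := hf _ e2; have [q hq] := hg _ e2; exists (p + q) => u Su.
rewrite ev2D opprD addrACA; apply: (le_trans (nmD _ _)).
by have := hp _ Su; have := hq _ Su; linarith.
Qed.

Lemma ApN S f : Ap S f -> Ap S (fun u => - f u).
Proof.
move=> hf e e0; have [p hp] := hf _ e0; exists (- p) => u Su.
by rewrite ev2N -opprD nmN; exact: hp.
Qed.

Lemma ApB S f g : Ap S f -> Ap S g -> Ap S (fun u => f u - g u).
Proof. by move=> hf hg; apply: ApD => //; exact: ApN. Qed.

Section OnCompact.
Variable S : R[i] -> Prop.
Hypotheses (cS : ccompact S) (cZ : ccont S Z) (cW : ccont S W).

Lemma ccont_poly1 (p : {poly R[i]}) f : ccont S f -> ccont S (fun u => p.[f u]).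
Proof.
move=> cf; elim/poly_ind: p => [|p c IH].
  by apply: ccont_eq (@ccont_cst _ _ 0) => u _; rewrite horner0.
apply: ccont_eq (ccontD (ccontM IH cf) (@ccont_cst _ _ c)) => u _.
by rewrite hornerMXaddC.
Qed.

Lemma ccont_ev p : ccont S (fun u => ev2 p (Z u) (W u)).
Proof.
elim/poly_ind: p => [|p c IH].
  by apply: ccont_eq (@ccont_cst _ _ 0) => u _; rewrite /ev2 !horner0.
apply: ccont_eq (ccontD (ccontM IH cW) (ccont_poly1 c cZ)) => u _.
by rewrite /ev2 hornerMXaddC hornerD hornerM hornerC.
Qed.

Lemma Ap_cont f : Ap S f -> ccont S f.
Proof.
move=> hf u0 Su0 e e0; have e3 : 0 < e / 3 by rewrite divr_gt0.
have [p hp] := hf _ e3; have [d d0 hd] := ccont_ev p Su0 e3.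
exists d => // u Su hu; have h1 := hp _ Su; have h2 := hp _ Su0.
have h3 := hd _ Su hu.
have := nm_tri (ev2 p (Z u) (W u)) (f u) (f u0).
have := nm_tri (ev2 p (Z u0) (W u0)) (ev2 p (Z u) (W u)) (f u0).
by rewrite nmBC in h2; linarith.
Qed.

Lemma Ap_bound f : Ap S f -> exists2 B, 0 < B & forall u, S u -> nm (f u) <= B.
Proof. by move=> /Ap_cont; exact: ccont_bound. Qed.

Lemma ApM f g : Ap S f -> Ap S g -> Ap S (fun u => f u * g u).
Proof.
move=> hf hg; have [B B0 hB] := Ap_bound hf; have [B' B'0 hB'] := Ap_bound hg.
apply: Ap_lim => e e0.
pose e' := Num.min 1 (e / (B + B' + 1)).
have s0 : 0 < B + B' + 1 by linarith.
have e'0 : 0 < e' by rewrite lt_min ltr01 divr_gt0.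
have e'1 : e' <= 1 by rewrite ge_min lexx.
have e'2 : e' * (B + B' + 1) <= e by rewrite -ler_pdivlMr // ge_min lexx orbT.
have [p hp] := hf _ e'0; have [q hq] := hg _ e'0.
exists (fun u => ev2 (p * q) (Z u) (W u)); first exact: Ap_ev.
move=> u Su; rewrite ev2M; have := hp _ Su; have := hq _ Su.
have := hB _ Su; have := hB' _ Su.
move: (f u) (g u) (ev2 p _ _) (ev2 q _ _) => a b a' b' hb ha hb' ha'.
have -> : a * b - a' * b' = a * (b - b') + (a - a') * b - (a - a') * (b - b') by ring.
apply: (le_trans (nmB _ _)); have := nmD (a * (b - b')) ((a - a') * b).
rewrite !nmM.
have n1 := nm_ge0 (a - a'); have n2 := nm_ge0 (b - b').
have n3 := nm_ge0 a; have n4 := nm_ge0 b.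
have : nm a * nm (b - b') <= B * e' by rewrite ler_pM.
have : nm (a - a') * nm b <= e' * B' by rewrite ler_pM.
have : nm (a - a') * nm (b - b') <= e' * 1.
  by rewrite ler_pM //; exact: le_trans hb' e'1.
by linarith.
Qed.

Lemma Inv_eq f g : (forall u, S u -> f u = g u) -> Inv S f -> Inv S g.
Proof. by move=> E [h hh e]; exists h => // u Su; rewrite -E // e. Qed.

Lemma Inv_neq0 f : Inv S f -> forall u, S u -> f u != 0.
Proof.
move=> [g _ e] u Su; apply/eqP => f0; have := e _ Su.
by rewrite f0 mul0r => /eqP; rewrite eq_sym oner_eq0.
Qed.

Lemma Inv_Ap f : Inv S f -> Ap S (fun u => (f u)^-1).
Proof.
move=> hi; have [g hg e] := hi; apply: Ap_eq hg => u Su.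
apply: (mulfI (Inv_neq0 hi Su)); rewrite e // mulfV //; exact: Inv_neq0 hi _ _.
Qed.

Lemma Ap_Inv f : (forall u, S u -> f u != 0) -> Ap S (fun u => (f u)^-1) -> Inv S f.
Proof. by move=> nz h; exists (fun u => (f u)^-1) => // u Su; rewrite mulfV // nz. Qed.

Lemma InvM f g : Inv S f -> Inv S g -> Inv S (fun u => f u * g u).
Proof.
move=> [f' hf ef] [g' hg eg]; exists (fun u => f' u * g' u); first exact: ApM.
by move=> u Su; rewrite mulrACA ef // eg // mulr1.
Qed.

Lemma Inv_cst c : c != 0 -> Inv S (fun=> c).
Proof. by move=> c0; exists (fun=> c^-1); [exact: Ap_cst|move=> u _; rewrite mulfV]. Qed.

Lemma Ap_neumann x : Ap S x -> (forall u, S u -> nm (x u) <= 1 / 2) ->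
  Ap S (fun u => (1 + x u)^-1).
Proof.
move=> hx bx.
(* Partial sums of the geometric series, written as the iteration [t -> 1 - x * t]; the error halves
   at each step. *)
pose t := fix t n u := if n is n'.+1 then 1 - x u * t n' u else 1 : R[i].
have ht n : Ap S (t n).
  elim: n => [|n IH]; first exact: Ap_cst.
  by apply: ApB; [exact: Ap_cst|exact: ApM].
apply: Ap_lim => e e0; have [n hn] := pow2_small e0; exists (t n) => // u Su.
apply: le_trans hn; have b := bx _ Su.
have nz : 1 + x u != 0.
  rewrite -nm_gt0; have := nm_lowD 1 (x u); rewrite nm1; linarith.
elim: n => [|n IH] /=.
  have -> : (1 + x u)^-1 - 1 = - x u / (1 + x u) by field.
  rewrite expr0 nmf nmN ler_pdivrMr ?nm_gt0 //.
  by have := nm_lowD 1 (x u); rewrite nm1; linarith.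
have -> : (1 + x u)^-1 - (1 - x u * t n u) = - x u * ((1 + x u)^-1 - t n u) by field.
by rewrite nmM nmN exprS ler_pM ?nm_ge0.
Qed.

(** For [y = psqrt (1 + x) - 1] the equation [(1 + y) ^+ 2 = 1 + x] reads [y = (x - y ^+ 2) / 2].
    The right side is a contraction of the disc of radius 1/4, and its iterates from 0 are
    polynomials in [x]. *)
Lemma Ap_psqrt_near1 x : Ap S x -> (forall u, S u -> nm (x u) <= 1 / 4) ->
  Ap S (fun u => psqrt (1 + x u)).
Proof.
move=> hx bx.
pose t := fix t n u := if n is n'.+1 then (1 / 2) * (x u - t n' u * t n' u)
   else 0 : R[i].
have ht n : Ap S (t n).
  elim: n => [|n IH]; first exact: Ap_cst.
  by apply: ApM; [exact: Ap_cst|apply: ApB => //; exact: ApM].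
apply: Ap_lim => e e0; have [n hn] := pow2_small e0.
exists (fun u => 1 + t n u); first by apply: ApD => //; exact: Ap_cst.
move=> u Su; apply: le_trans hn; have b := bx _ Su.
have sl : slit (1 + x u).
  by apply: slit_Re; rewrite cReD /=; have := Re_bound (x u); linarith.
have hs := psqrt_sqr sl.
have b2 : nm (psqrt (1 + x u) - 1) <= nm (x u) by apply: psqrt_near1; linarith.
rewrite opprD addrA; move: b2; set y := psqrt _ - 1 => b2.
have ey : y = 1 / 2 * (x u - y * y).
  have e1 : 1 + y = psqrt (1 + x u) by rewrite /y; ring.
  have -> : x u = (1 + y) ^+ 2 - 1 by rewrite e1 hs; ring.
  by field.
have hb n' : nm (t n' u) <= 1 / 4.
  elim: n' => [|n' IH]; first by rewrite nm0; linarith.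
  rewrite [t _ _]/=; have n2 : nm (1 / 2 : R[i]) = 1 / 2.
    by rewrite nmf nm1 -[2]/(2%:R) -(rmorph_nat (real_complex R)) nm_real normr_nat.
  rewrite nmM n2; have := nmB (x u) (t n' u * t n' u); rewrite nmM.
  by have := ler_pM (nm_ge0 _) (nm_ge0 _) IH IH; linarith.
elim: n => [|n IH]; first by rewrite [t _ _]/= expr0 subr0; linarith.
rewrite [t _ _]/= {1}ey -mulrBr.
have -> : x u - y * y - (x u - t n u * t n u) = - (y - t n u) * (y + t n u) by ring.
have n2 : nm (1 / 2 : R[i]) = 1 / 2.
  by rewrite nmf nm1 -[2]/(2%:R) -(rmorph_nat (real_complex R)) nm_real normr_nat.
rewrite exprS nmM n2 ler_pM ?nm_ge0 //; try linarith.
rewrite nmM nmN -[leRHS]mulr1 ler_pM ?nm_ge0 //.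
by have := nmD y (t n u); have := hb n; linarith.
Qed.

(** [G / F] is within 1/2 of 1, so its inverse is a geometric series. *)
Lemma Inv_near F G : Ap S F -> Ap S G -> Inv S F ->
  (forall u, S u -> nm (G u - F u) <= nm (F u) / 2) -> Inv S G.
Proof.
move=> hF hG iF h; have nz := Inv_neq0 iF.
have hi := Inv_Ap iF.
have hx : Ap S (fun u => (G u - F u) * (F u)^-1) by apply: ApM => //; exact: ApB.
have bx u : S u -> nm ((G u - F u) * (F u)^-1) <= 1 / 2.
  move=> Su; rewrite nmf ler_pdivrMr ?nm_gt0 ?nz //; have := h _ Su; linarith.
have hn := Ap_neumann hx bx.
have E u : S u -> 1 + (G u - F u) * (F u)^-1 = G u / F u.
  by move=> Su; field; exact: nz.
have nzG u : S u -> G u != 0.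
  move=> Su; have n0 : 0 < nm (F u) by rewrite nm_gt0 nz.
  by rewrite -nm_gt0; have := h _ Su; have := nm_lowB (F u) (F u - G u);
     rewrite subKr (nmBC (F u)); linarith.
apply: Ap_Inv => //; apply: Ap_eq (ApM hi hn) => u Su.
by rewrite E // invf_div mulrA mulVf ?nz // mul1r.
Qed.

(* The continuity principle for invertibility: along a segment of functions
   without zeros on S the inverse stays bounded, so invertibility propagates. *)
Lemma oka F0 F1 : Ap S F0 -> Ap S F1 ->
  (forall u (s : R), S u -> 0 <= s <= 1 -> F0 u + s%:C%C * (F1 u - F0 u) != 0) ->
  Inv S F0 -> Inv S F1.
Proof.
move=> h0 h1 nz.
pose F s := fun u => F0 u + s%:C%C * (F1 u - F0 u).
have hF s : Ap S (F s).
  by apply: ApD => //; apply: ApM; [exact: Ap_cst|exact: ApB].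
suff : Inv S (F 0) -> Inv S (F 1).
  move=> h i0; apply: (@Inv_eq (F 1)) => [u _|].
    by rewrite /F rmorph1; ring.
  by apply: h; apply: Inv_eq i0 => u _; rewrite /F rmorph0 mul0r addr0.
apply: (@segment_locally_const R (fun s => Inv S (F s))) => s hs.
have [m m0 hm] := ccont_min cS (Ap_cont (hF s)) (fun u Su => nz u s Su hs).
have [B B0 hB] := Ap_bound (ApB h1 h0).
(* Within this radius the function changes by at most [m / 4], at most half the modulus of either
   function, so [Inv_near] applies in both directions. *)
exists (m / (4 * B)); first by rewrite divr_gt0 // mulr_gt0.
move=> s' hs' hd.
have dif u : S u -> nm (F s' u - F s u) <= m / 4.
  move=> Su; have -> : F s' u - F s u = (s' - s)%:C%C * (F1 u - F0 u).
    by rewrite /F rmorphB; ring.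
  rewrite nmM nm_real; apply: (@le_trans _ _ (m / (4 * B) * B)).
    by rewrite ler_pM ?nm_ge0 ?hB // ltW.
  by rewrite invfM mulrA mulfVK ?gt_eqF.
have low u : S u -> m / 2 <= nm (F s' u).
  move=> Su; have := dif _ Su; have := hm _ Su.
  by have := nm_lowB (F s u) (F s u - F s' u); rewrite subKr (nmBC (F s u)); linarith.
by split=> i; apply: (Inv_near (hF _) (hF _) i) => u Su;
  rewrite 1?nmBC; have := dif _ Su; have := hm _ Su; have := low _ Su; rewrite ?(nmBC (F s u)); linarith.
Qed.

Lemma ccont_psqrt F : (forall u, S u -> slit (F u)) -> ccont S F ->
  ccont S (fun u => psqrt (F u)).
Proof.
move=> sl cF u0 Su0 e e0; have r0 := psqrt_Re (sl _ Su0).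
have [d d0 hd] := cF _ Su0 _ (mulr_gt0 e0 r0); exists d => // u Su hu.
have := hd _ Su hu; have := psqrt_lip (sl _ Su) (sl _ Su0).
by move=> h1 h2; rewrite -(ltr_pM2r r0); exact: le_lt_trans h2.
Qed.

(** Continuation from the constant 1 along [1 + s * (F - 1)]: a small step in [s] multiplies the
    function by a factor close to 1, whose root is the limit of an iteration, and principal roots
    are multiplicative for such factors. *)
Lemma oka_psqrt F : Ap S F -> (forall u, S u -> slit (F u)) ->
  Ap S (fun u => psqrt (F u)).
Proof.
move=> hF sl.
pose G s := fun u => 1 + s%:C%C * (F u - 1).
have h1 : Ap S (fun=> 1) by exact: Ap_cst.
have hG s : Ap S (G s).
  by apply: ApD => //; apply: ApM; [exact: Ap_cst|exact: ApB].
have slG u s : S u -> 0 <= s <= 1 -> slit (G s u) by move=> Su; apply: slit_seg; exact: sl.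
have iG s : 0 <= s <= 1 -> Inv S (G s).
  move=> /andP[s0 s1]; apply: (oka h1 (hG s)) (Inv_cst (oner_neq0 _)) => u t Su /andP[t0 t1].
  rewrite /G addrAC subrr add0r mulrA -rmorphM; apply: slit_neq0; apply: slG => //.
  by rewrite mulr_ge0 //= mulr_ile1.
suff : Ap S (fun u => psqrt (G 0 u)) -> Ap S (fun u => psqrt (G 1 u)).
  move=> h; apply: (Ap_eq _ (h _)) => [u _|].
    by congr psqrt; rewrite /G rmorph1; ring.
  by apply: Ap_eq h1 => u _; rewrite /G rmorph0 mul0r addr0 psqrt1.
apply: (@segment_locally_const R (fun s => Ap S (fun u => psqrt (G s u)))) => s hs.
have cp := ccont_psqrt (fun u Su => slG u s Su hs) (Ap_cont (hG s)).
have [c c0 hc] : exists2 c, 0 < c & forall u, S u -> c <= Re (psqrt (G s u)).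
  have [u Su|c c0 hc] := ccont_min cS (ccont_re cp).
    by apply/eqP => /(congr1 (@complex.Re R)) /= e; have := psqrt_Re (slG u s Su hs); rewrite e ltxx.
  exists c => // u Su; have := hc _ Su; rewrite nm_real ger0_norm //.
  exact/ltW/psqrt_Re/slG.
have [B B0 hB] := Ap_bound (ApB hF h1).
have [m m0 hm] := ccont_min cS (Ap_cont (hG s)) (fun u Su => slit_neq0 (slG u s Su hs)).
(* The bound [c ^+ 2 / 2] is for [psqrt_close], the bound [m / 4] puts [G s' / G s] within 1/4 of 1
   for [Ap_psqrt_near1]. *)
pose e := Num.min (c ^+ 2 / 2) (m / 4).
have e0 : 0 < e by rewrite lt_min !divr_gt0 // exprn_gt0.
exists (e / B); first by rewrite divr_gt0.
move=> s' hs' hd.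
have dif u : S u -> nm (G s' u - G s u) <= e.
  move=> Su; have -> : G s' u - G s u = (s' - s)%:C%C * (F u - 1).
    by rewrite /G rmorphB; ring.
  rewrite nmM nm_real; apply: (@le_trans _ _ (e / B * B)).
    by rewrite ler_pM ?nm_ge0 ?hB // ltW.
  by rewrite mulfVK ?gt_eqF.
have e1 : e <= c ^+ 2 / 2 by rewrite ge_min lexx.
have e2 : e <= m / 4 by rewrite ge_min lexx orbT.
pose x u := (G s' u - G s u) * (G s u)^-1.
have hx : Ap S x by apply: ApM; [exact: ApB|exact/Inv_Ap/iG].
have bx u : S u -> nm (x u) <= 1 / 4.
  move=> Su; have nz : G s u != 0 by exact/slit_neq0/slG.
  rewrite nmf ler_pdivrMr ?nm_gt0 //; have := dif _ Su; have := hm _ Su; linarith.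
have Ex u : S u -> 1 + x u = G s' u / G s u.
  by move=> Su; rewrite /x; field; exact/slit_neq0/slG.
have P u : S u -> psqrt (1 + x u) = psqrt (G s' u) / psqrt (G s u).
  move=> Su; rewrite Ex //; apply: (psqrt_close _ _ _).2; try exact: slG.
  apply: (le_lt_trans (dif _ Su)); apply: (le_lt_trans e1).
  apply: (@lt_le_trans _ _ (c ^+ 2)); first by have := exprn_gt0 2 c0; linarith.
  by rewrite ler_pXn2r ?nnegrE ?(ltW c0) ?hc // ltW // psqrt_Re // slG.
have hq := Ap_psqrt_near1 hx bx.
have nz u t : S u -> 0 <= t <= 1 -> psqrt (G t u) != 0.
  by move=> Su ht; exact/psqrt_neq0/slG.
split=> h.
  apply: Ap_eq (ApM h hq) => u Su; rewrite P // mulrC divfK //; exact: nz.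
have hy : Ap S (fun u => psqrt (1 + x u) - 1) by exact: ApB.
have by_ u : S u -> nm (psqrt (1 + x u) - 1) <= 1 / 2.
  move=> Su; have b := bx _ Su; apply: (le_trans (psqrt_near1 _)); linarith.
apply: Ap_eq (ApM h (Ap_neumann hy by_)) => u Su.
by rewrite addrC subrK P // invf_div mulrCA mulfV ?mulr1 //; exact: nz.
Qed.

End OnCompact.
End Approx.

(** * Products of square roots around grid cells *)

Section EdgeProducts.
Variable F : fieldType.
Implicit Types (h v : nat -> nat -> F) (S : nat -> nat -> bool).

(** The counterclockwise product over the boundary of cell [(i, j)]: bottom and right edge forwards,
    top and left edge backwards. *)
Definition around h v i j := h i j * v i.+1 j / h i j.+1 / v i j.

Definition cells S N h v :=
  \prod_(i < N) \prod_(j < N) (if S i j then around h v i j else 1).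

(** Replace [k] by 1 wherever [s] is false. Since [k] is 1 where [s] changes, the factors are
    quotients of consecutive values of the modified sequence [A]. *)
Lemma telescope_cancel (s : nat -> bool) (k : nat -> F) N :
  (forall j, k j != 0) -> s 0%N = false -> s N = false ->
  (forall j, s j != s j.+1 -> k j.+1 = 1) ->
  \prod_(j < N) (if s j then k j / k j.+1 else 1) = 1.
Proof.
move=> k0 s0 sN bd; pose A j := if s j then k j else 1.
have A0 j : A j != 0 by rewrite /A; case: ifP => _ //; exact: oner_neq0.
have E j : (if s j then k j / k j.+1 else 1) = A j / A j.+1.
  have := bd j; rewrite /A; case: (s j); case: (s j.+1) => //= b.
  - by rewrite b.
  - by rewrite b // divr1.
  - by rewrite divr1.
have tel n : \prod_(j < n) (if s j then k j / k j.+1 else 1) = A 0%N / A n.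
  elim: n => [|n IH]; first by rewrite big_ord0 divff.
  by rewrite big_ord_recr /= IH E mulrA divfK.
by rewrite tel /A s0 sN divr1.
Qed.

(* Edges interior to the union of the cells cancel. *)
Lemma cells_boundary S N h v h' v' :
  (forall i j, [/\ h i j != 0, v i j != 0, h' i j != 0 & v' i j != 0]) ->
  (forall i, S i 0%N = false /\ S 0%N i = false) ->
  (forall i, S i N = false /\ S N i = false) ->
  (forall i j, S i j != S i j.+1 -> h i j.+1 = h' i j.+1) ->
  (forall i j, S i j != S i.+1 j -> v i.+1 j = v' i.+1 j) ->
  cells S N h v = cells S N h' v'.
Proof.
move=> nz S0 SN eh ev.
pose k i j := h i j / h' i j; pose l i j := v i j / v' i j.
have k0 i j : k i j != 0 by case: (nz i j) => *; rewrite mulf_neq0 ?invr_eq0.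
have l0 i j : l i j != 0 by case: (nz i j) => *; rewrite mulf_neq0 ?invr_eq0.
(* The quotient of the two products splits into horizontal edges, which telescope in [j], and
   vertical edges, which telescope in [i]. *)
suff E : cells S N h v = cells S N h' v' *
   ((\prod_(i < N) \prod_(j < N) (if S i j then k i j / k i j.+1 else 1)) /
    (\prod_(j < N) \prod_(i < N) (if S i j then l i j / l i.+1 j else 1))).
  rewrite E !big1 ?divr1 ?mulr1 // => [j _|i _].
    apply: (@telescope_cancel (fun i => S i j) (fun i => l i j)) => //.
    - by case: (S0 j).
    - by case: (SN j).
    - move=> i /ev e; rewrite /l e divff //; by case: (nz i.+1 j).
  apply: (@telescope_cancel (fun j => S i j) (fun j => k i j)) => //.
  - by case: (S0 i).
  - by case: (SN i).
  - move=> j /eh e; rewrite /k e divff //; by case: (nz i j.+1).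
rewrite [X in _ / X]exchange_big /= -prodfV -!big_split /= /cells.
apply: eq_bigr => i _; rewrite -prodfV -!big_split /=.
apply: eq_bigr => j _; case: (S i j); last by rewrite divr1 !mulr1.
rewrite /around /k /l; case: (nz i j) => ? ? ? ?; case: (nz i.+1 j) => ? ? ? ?.
case: (nz i j.+1) => ? ? ? ?; field; by do ! (apply/andP; split).
Qed.

Lemma cells_single S N h v i0 j0 (c : F) : (i0 < N)%N -> (j0 < N)%N ->
  (forall i j, around h v i j = if (i == i0) && (j == j0) then c else 1) ->
  cells S N h v = if S i0 j0 then c else 1.
Proof.
move=> hi hj E; rewrite /cells (bigD1 (Ordinal hi)) //=.
rewrite [X in _ * X]big1 ?mulr1 => [|i ni]; last first.
  apply: big1 => j _; rewrite E; case: ifP => // _.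
  by rewrite (_ : (i == i0 :> nat) = false) //; apply: negbTE; exact: ni.
rewrite (bigD1 (Ordinal hj)) //= big1 ?mulr1 => [|j nj]; first by rewrite E !eqxx.
rewrite E; case: ifP => // _.
by rewrite (_ : (j == j0 :> nat) = false) ?andbF //; apply: negbTE; exact: nj.
Qed.

End EdgeProducts.

(** * Principal roots on the edges of a square grid *)

Section Grid.
Variable R : realType.
Implicit Types (w a b x y : R[i]).

(** In both cases the principal roots differ in argument by less than a right angle: they lie in one
    open quadrant, or both within 45 degrees of the positive axis. *)
Lemma psqrt_div_same x y : Im x != 0 -> Im y != 0 ->
  0 < Im x * Im y \/ (0 < Re x /\ 0 < Re y) ->
  slit (x / y) /\ psqrt (x / y) = psqrt x / psqrt y.
Proof.
move=> hx hy h.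
have sx : slit x by apply/slitP; right.
have sy : slit y by apply/slitP; right.
apply: psqrt_div => //; rewrite cReM cReJ cImJ mulrN opprK.
have px := psqrt_Re sx; have py := psqrt_Re sy.
have ix := psqrt_Im sx; have iy := psqrt_Im sy.
have rx := psqrt_ReE sx; have ry := psqrt_ReE sy.
move: px py ix iy rx ry h.
move: (Re (psqrt x)) (Im (psqrt x)) (Re (psqrt y)) (Im (psqrt y)) => p q r s.
move=> p0 r0 -> -> -> -> [h|[h1 h2]].
  have h' : 0 < (4 * p * r) * (q * s) by apply: lt_le_trans h _; linarith.
  have qs : 0 < q * s by move: h'; rewrite pmulr_rgt0 // !mulr_gt0 ?ltr0n.
  by have := mulr_gt0 p0 r0; linarith.
have a1 : `|q| < p.
  by rewrite -(@ltr_pXn2r _ 2) ?nnegrE ?(ltW p0) // real_normK ?num_real //; linarith.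
have a2 : `|s| < r.
  by rewrite -(@ltr_pXn2r _ 2) ?nnegrE ?(ltW r0) // real_normK ?num_real //; linarith.
have : `|q * s| < p * r by rewrite normrM ltr_pM.
by rewrite ltr_norml; linarith.
Qed.

(** [x] and [y] lie on opposite sides of the cut, so their roots differ in argument by more than a
    right angle and the principal root of the quotient has the other sign. *)
Lemma psqrt_div_opp x y : Im x * Im y < 0 -> Re x < 0 -> Re y < 0 ->
  slit (x / y) /\ psqrt (x / y) = - (psqrt x / psqrt y).
Proof.
move=> h hx hy.
have nx : Im x != 0 by apply: contraTneq h => ->; rewrite mul0r ltxx.
have ny : Im y != 0 by apply: contraTneq h => ->; rewrite mulr0 ltxx.
have sx : slit x by apply/slitP; right.
have sy : slit y by apply/slitP; right.
have sl : slit (x / y).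
  have -> : x / y = (- x) / (- y) by rewrite invrN mulrNN.
  apply: (psqrt_div_same _ _ _).1; rewrite ?cImN ?oppr_eq0 //.
  by right; rewrite !cReN !oppr_gt0.
split=> //; apply: psqrt_div_neg => //; rewrite cReM cReJ cImJ mulrN opprK.
have px := psqrt_Re sx; have py := psqrt_Re sy.
have ix := psqrt_Im sx; have iy := psqrt_Im sy.
have rx := psqrt_ReE sx; have ry := psqrt_ReE sy.
move: px py ix iy rx ry h hx hy.
move: (Re (psqrt x)) (Im (psqrt x)) (Re (psqrt y)) (Im (psqrt y)) => p q r s.
move=> p0 r0 -> -> -> -> h hx hy.
have h' : (4 * p * r) * (q * s) < 0 by apply: le_lt_trans h; linarith.
have h2 : q * s < 0 by move: h'; rewrite pmulr_rlt0 // !mulr_gt0 ?ltr0n.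
have a1 : p < `|q|.
  by rewrite -(@ltr_pXn2r _ 2) ?nnegrE ?(ltW p0) // real_normK ?num_real //; linarith.
have a2 : r < `|s|.
  by rewrite -(@ltr_pXn2r _ 2) ?nnegrE ?(ltW r0) // real_normK ?num_real //; linarith.
have : p * r < `|q * s| by rewrite normrM ltr_pM // ltW.
by rewrite (ltr0_norm h2); linarith.
Qed.

Variables (ox oy d : R).
Hypothesis d0 : 0 < d.

Definition pt (i j : nat) : R[i] := Complex (ox + i%:R * d) (oy + j%:R * d).

Definition hedge w i j := (pt i.+1 j - w) / (pt i j - w).
Definition vedge w i j := (pt i j.+1 - w) / (pt i j - w).

Definition offgrid w := forall i, Re w != ox + i%:R * d /\ Im w != oy + i%:R * d.

Definition incell w i j :=
  (ox + i%:R * d <= Re w <= ox + i.+1%:R * d) &&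
  (oy + j%:R * d <= Im w <= oy + j.+1%:R * d).

Lemma grid_lt (i j : nat) : (i < j)%N -> i.+1%:R * d <= j%:R * d.
Proof. by move=> h; rewrite ler_pM2r // ler_nat. Qed.

Lemma pt_cell i j : [/\ incell (pt i j) i j, incell (pt i.+1 j) i j,
  incell (pt i j.+1) i j & incell (pt i.+1 j.+1) i j].
Proof.
have h (n : nat) : n%:R * d <= n.+1%:R * d by rewrite ler_pM2r // ler_nat.
by split; rewrite /incell /= !lexx !lerD2l !h.
Qed.

Lemma cell_diam w w' i j : incell w i j -> incell w' i j -> nm (w - w') <= 2 * d.
Proof.
move=> /andP[/andP[a1 a2] /andP[a3 a4]] /andP[/andP[b1 b2] /andP[b3 b4]].
have e (n : nat) : n.+1%:R * d = n%:R * d + d by rewrite -natr1 mulrDl mul1r.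
rewrite !e in a2 a4 b2 b4.
apply: (le_trans (nm_le_ReIm _)); rewrite cReB cImB.
have : `|Re w - Re w'| <= d by rewrite ler_norml; linarith.
have : `|Im w - Im w'| <= d by rewrite ler_norml; linarith.
by linarith.
Qed.

Lemma cell_convex w w' i j (s : R) : incell w i j -> incell w' i j -> 0 <= s <= 1 ->
  incell (w + s%:C%C * (w' - w)) i j.
Proof.
move=> /andP[/andP[a1 a2] /andP[a3 a4]] /andP[/andP[b1 b2] /andP[b3 b4]] /andP[s0 s1].
rewrite /incell !ReImE /= !mul0r subr0 addr0; apply/andP; split; apply/andP; split; nra.
Qed.

Lemma grid_index (x o : R) : o <= x -> exists i : nat,
   o + i%:R * d <= x /\ x < o + i.+1%:R * d.
Proof.
move=> h; have hx : 0 <= (x - o) / d by rewrite divr_ge0 ?subr_ge0 // ltW.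
have /andP[h1 h2] := truncn_itv hx; exists (Num.trunc ((x - o) / d)).
by move: h1 h2; rewrite ler_pdivlMr // ltr_pdivrMr //; linarith.
Qed.

(* Going once around a cell multiplies the continued square root of z - w by -1
   exactly when w lies in the cell. *)
Lemma around_psqrt w i j : offgrid w ->
  around (fun i j => psqrt (hedge w i j)) (fun i j => psqrt (vedge w i j)) i j =
  if [&& ox + i%:R * d < Re w, Re w < ox + i.+1%:R * d,
         oy + j%:R * d < Im w & Im w < oy + j.+1%:R * d] then -1 else 1.
Proof.
move=> off.
have re0 k l : Re (pt k l - w) != 0.
  by rewrite cReB /= subr_eq0 eq_sym; case: (off k).
have im0 k l : Im (pt k l - w) != 0.
  by rewrite cImB /= subr_eq0 eq_sym; case: (off l).
have P0 k l : psqrt (pt k l - w) != 0 by apply/psqrt_neq0/slitP; right.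
have H k l : psqrt (hedge w k l) = psqrt (pt k.+1 l - w) / psqrt (pt k l - w).
  apply: (psqrt_div_same _ _ _).2 => //; left.
  by rewrite (_ : Im (pt k.+1 l - w) = Im (pt k l - w)) ?cImB // -cImB -expr2 lt_def sqr_ge0 andbT expf_neq0.
(* Along a vertical edge [pt - w] crosses the cut of [psqrt] exactly when the edge is to the left of
   [w] and spans its height; [eps] records the sign. *)
pose eps k := if (ox + k%:R * d < Re w) && (oy + j%:R * d < Im w < oy + j.+1%:R * d)
   then -1 else 1 : R[i].
have V k : psqrt (vedge w k j) = eps k * (psqrt (pt k j.+1 - w) / psqrt (pt k j - w)).
  have := im0 k j; have := im0 k j.+1; have := re0 k j.
  rewrite /eps; have [rk|rk|e] := ltgtP (ox + k%:R * d) (Re w); last first.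
  - by rewrite cReB /= e subrr eqxx.
  - move=> _ i1 i2; rewrite mul1r; apply: (psqrt_div_same _ _ _).2 => //; right.
    by rewrite !cReB /= !subr_gt0.
  move=> _ /=; rewrite !cImB /= !subr_eq0 => i1 i2.
  have lt1 : oy + j%:R * d < oy + j.+1%:R * d by rewrite ltrD2l ltr_pM2r // ltr_nat.
  case: ifP => [/andP[h1 h2]|h].
    rewrite mulN1r; apply: (psqrt_div_opp _ _ _).2; rewrite ?cReB ?cImB /=; try linarith.
    by rewrite pmulr_rlt0 ?subr_gt0 // subr_lt0.
  rewrite mul1r; apply: (psqrt_div_same _ _ _).2 => //; left.
  rewrite !cImB /=; have [h1|h1] := ltP (oy + j%:R * d) (Im w).
    have h2 : oy + j.+1%:R * d < Im w.
      by rewrite lt_neqAle i1 leNgt; apply/negP => h2; rewrite h1 h2 in h.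
    by rewrite nmulr_rgt0 ?subr_lt0.
  have h1' : Im w < oy + j%:R * d by rewrite lt_neqAle eq_sym i2.
  by rewrite mulr_gt0 // subr_gt0 //; linarith.
rewrite /around !H !V.
have e0 k : eps k != 0 by rewrite /eps; case: ifP; rewrite ?oppr_eq0 oner_eq0.
have -> : psqrt (pt i.+1 j - w) / psqrt (pt i j - w) *
  (eps i.+1 * (psqrt (pt i.+1 j.+1 - w) / psqrt (pt i.+1 j - w))) /
  (psqrt (pt i.+1 j.+1 - w) / psqrt (pt i j.+1 - w)) /
  (eps i * (psqrt (pt i j.+1 - w) / psqrt (pt i j - w))) = eps i.+1 / eps i.
  by field; rewrite !P0 e0.
have lt1 : ox + i%:R * d < ox + i.+1%:R * d by rewrite ltrD2l ltr_pM2r // ltr_nat.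
rewrite /eps; case: (oy + j%:R * d < Im w); case: (Im w < _); rewrite ?andbF ?divr1 //= !andbT.
have [h1|h1] := ltP (ox + i%:R * d) (Re w); have [h2|h2] := ltP (ox + i.+1%:R * d) (Re w) => /=.
- by rewrite divff ?oppr_eq0 ?oner_eq0 // ltNge (ltW h2).
- rewrite lt_neqAle h2; have [-> _] := off i.+1; by rewrite invrN1 mul1r.
- by exfalso; linarith.
- by rewrite divr1.
Qed.

Lemma offgrid_slit w i j : offgrid w -> slit (hedge w i j) /\ slit (vedge w i j).
Proof.
move=> off.
have re0 k l : Re (pt k l - w) != 0.
  by rewrite cReB /= subr_eq0 eq_sym; case: (off k).
have im0 k l : Im (pt k l - w) != 0.
  by rewrite cImB /= subr_eq0 eq_sym; case: (off l).
split.
  apply: (psqrt_div_same _ _ _).1 => //; left.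
  by rewrite (_ : Im (pt i.+1 j - w) = Im (pt i j - w)) ?cImB // -cImB -expr2 lt_def sqr_ge0 andbT expf_neq0.
have [h|h] := ltP 0 (Im (pt i j.+1 - w) * Im (pt i j - w)).
  by apply: (psqrt_div_same _ _ _).1 => //; left.
have h' : Im (pt i j.+1 - w) * Im (pt i j - w) < 0.
  by rewrite lt_neqAle h mulf_neq0.
have eR : Re (pt i j.+1 - w) = Re (pt i j - w) by rewrite !cReB.
have [r|r] := ltP 0 (Re (pt i j - w)).
  by apply: (psqrt_div_same _ _ _).1 => //; right; rewrite eR.
have r' : Re (pt i j - w) < 0 by rewrite lt_neqAle r re0.
have r2 : Re (pt i j.+1 - w) < 0 by rewrite eR.
exact: (psqrt_div_opp _ _ _).1.
Qed.

(** Among all cells only the one that contains [w] contributes a sign. *)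
Lemma cells_psqrt w S N i0 j0 : (i0 < N)%N -> (j0 < N)%N ->
  ox + i0%:R * d < Re w < ox + i0.+1%:R * d ->
  oy + j0%:R * d < Im w < oy + j0.+1%:R * d ->
  offgrid w /\
  cells S N (fun i j => psqrt (hedge w i j)) (fun i j => psqrt (vedge w i j)) =
  if S i0 j0 then -1 else 1.
Proof.
move=> hi hj /andP[x1 x2] /andP[y1 y2].
have inj (o t : R) (k l : nat) : o + k%:R * d < t -> t < o + k.+1%:R * d ->
    o + l%:R * d < t -> t < o + l.+1%:R * d -> l = k.
  move=> a1 a2 b1 b2; case: (ltngtP l k) => // h; exfalso; have := grid_lt h; linarith.
have off : offgrid w.
  move=> k; split; apply/eqP => e.
    have [h|h] := leqP k i0.
      have : k%:R * d <= i0%:R * d by rewrite ler_pM2r // ler_nat.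
      by linarith.
    by have := grid_lt h; linarith.
  have [h|h] := leqP k j0.
    have : k%:R * d <= j0%:R * d by rewrite ler_pM2r // ler_nat.
    by linarith.
  by have := grid_lt h; linarith.
split=> //; apply: cells_single => // i j; rewrite around_psqrt //.
case: ifP => [/and4P[a1 a2 a3 a4]|h].
  by rewrite (inj _ _ _ _ x1 x2 a1 a2) (inj _ _ _ _ y1 y2 a3 a4) !eqxx.
case: ifP => // /andP[/eqP ei /eqP ej]; move: h.
by rewrite ei ej x1 x2 y1 y2.
Qed.

End Grid.

(** If the quotient is a real number [t <= 0], then [w] is the point of the segment with parameter
    [(1 - t)^-1]. *)
Lemma slit_segment (R : realType) (a b w : R[i]) :
  (forall s : R, 0 <= s <= 1 -> a + s%:C%C * (b - a) != w) -> slit ((b - w) / (a - w)).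
Proof.
move=> h; have a0 : a - w != 0.
  have := h 0; rewrite lexx ler01 rmorph0 mul0r addr0 subr_eq0; exact.
apply/slitP; apply: contrapT => no.
have [h1 h2] : Re ((b - w) / (a - w)) <= 0 /\ Im ((b - w) / (a - w)) = 0.
  split; first by rewrite leNgt; apply/negP => ?; apply: no; left.
  by apply/eqP; apply: contrapT => /negP ?; apply: no; right.
move: h1; set t := Re _ => h1.
have e : b - w = t%:C%C * (a - w).
  by rewrite -[LHS](divfK a0); congr (_ * _); apply: complex_eq.
have t1 : 0 < 1 - t by linarith.
have := h (1 - t)^-1; rewrite invr_ge0 (ltW t1) invf_le1 //.
have -> : 1 <= 1 - t by linarith.
move=> /(_ isT)/eqP; apply.
have nz : (1 - t)%:C%C != 0 :> R[i] by rewrite eq_complex /= eqxx andbT gt_eqF.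
rewrite fmorphV -[a](subrK w) -[b](subrK w) e.
apply: (mulfI nz); rewrite mulrDr mulrA mulfV // mul1r rmorphB rmorph1; ring.
Qed.

(** * Runge-type approximation in the second coordinate *)

Section PlaneTopology.
Variables (R : realType) (Z W : R[i] -> R[i]) (A : R[i] -> Prop).
Hypotheses (cA : ccompact A) (cZ : ccont A Z) (cW : ccont A W).

Let Ap := Ap Z W A.
Let Inv := Inv Z W A.

Definition misses (b : R[i]) := forall u, A u -> W u != b.

(** Moving the pole along a segment that avoids [W(A)] is a segment of functions without zeros. *)
Lemma Inv_segment (a b : R[i]) :
  (forall u (s : R), A u -> 0 <= s <= 1 -> W u != a + s%:C%C * (b - a)) ->
  Inv (fun u => W u - a) -> Inv (fun u => W u - b).
Proof.
have aw c : Ap (fun u => W u - c) by apply: ApB; [exact: Ap_W|exact: Ap_cst].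
move=> h; apply: (oka cA cZ cW (aw a) (aw b)) => u s Au hs.
have -> : W u - a + s%:C%C * (W u - b - (W u - a)) = W u - (a + s%:C%C * (b - a)) by ring.
by rewrite subr_eq0; exact: h.
Qed.

(** For large [b] the function [W - b] is a small perturbation of the constant [- b]. *)
Lemma Inv_far : exists2 B, 0 < B & forall b, B <= nm b -> Inv (fun u => W u - b).
Proof.
have [B B0 hB] := Ap_bound cA cZ cW (@Ap_W _ Z W A).
exists (2 * B); first by rewrite mulr_gt0.
move=> b hb; have b0 : b != 0 by rewrite -nm_gt0; linarith.
apply: (@Inv_near _ _ _ _ cA cZ cW (fun=> - b)).
- exact: Ap_cst.
- by apply: ApB; [exact: Ap_W|exact: Ap_cst].
- by apply: Inv_cst; rewrite oppr_eq0.
- by move=> u Au; rewrite opprK subrK nmN; have := hB _ Au; linarith.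
Qed.

Lemma misses_dist b : misses b -> exists2 m, 0 < m & forall u, A u -> m <= nm (W u - b).
Proof.
move=> h; apply: (ccont_min cA); first by apply: ccontB => //; exact: ccont_cst.
by move=> u Au; rewrite subr_eq0; exact: h.
Qed.

(* If w0 lay in a bounded component of the complement of W(A), the boundary of a
   union of small cells around w0 would stay near W(A); the product of square
   roots along it is -1 by counting cells and 1 by the square root s on A. *)
Lemma Inv_of_sqrt (w0 : R[i]) (s : R[i] -> R[i]) :
  misses w0 -> (forall u, A u -> s u ^+ 2 = W u - w0) ->
  (forall e : R, 0 < e -> exists2 d, 0 < d &
     forall u v, A u -> A v -> nm (W u - W v) < d -> nm (s u - s v) < e) ->
  Inv (fun u => W u - w0).
Proof.
move=> m0 ss us; apply: contrapT => nI.
have [m mp hm] := misses_dist m0.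
have sm u : A u -> Num.sqrt m <= nm (s u).
  move=> Au; rewrite -(@ler_pXn2r _ 2) ?nnegrE ?nm_ge0 ?sqrtr_ge0 //.
  by rewrite sqr_sqrtr ?(ltW mp) // -nmX ss //; exact: hm.
set m1 := Num.sqrt m in sm; have m1p : 0 < m1 by rewrite sqrtr_gt0.
have [|d1 d1p hd1] := us (m1 / 10); first by rewrite divr_gt0.
have [B Bp hB] := Inv_far.
(* [m / 40] makes the mesh small compared with the distance from [w0] to [W(A)]; [d1 / 10] keeps [s]
   within [m1 / 10] between points of [A] whose images are close to adjacent corners. *)
pose d := Num.min (m / 40) (d1 / 10).
have dp : 0 < d by rewrite lt_min !divr_gt0.
have dm : d <= m / 40 by rewrite ge_min lexx.
have dd1 : d <= d1 / 10 by rewrite ge_min lexx orbT.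
(* These points fill the components of the complement on which inversion fails. The set is bounded
   by [Inv_far], and by [Inv_segment] it can only end near [W(A)]. *)
pose bad b := misses b /\ ~ Inv (fun u => W u - b).
pose M := Num.bound ((B + nm w0 + 2 * d) / d).
have hM : B + nm w0 + 2 * d < M%:R * d.
  by rewrite -ltr_pdivrMr //; apply: archi_boundP; rewrite divr_ge0 ?(ltW dp) //;
     have := nm_ge0 w0; linarith.
(* The half step puts [w0] at the centre of cell [(M, M)], off all grid lines. *)
pose ox := Re w0 - M%:R * d - d / 2; pose oy := Im w0 - M%:R * d - d / 2.
pose N := (M + M).+1.
pose S i j := [&& (i < N)%N, (j < N)%N & `[< forall b, incell ox oy d b i j -> bad b >]].
have ne (n : nat) : n.+1%:R * d = n%:R * d + d by rewrite -natr1 mulrDl mul1r.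
have good_far b : B <= nm b -> ~ bad b by move=> h [_]; apply; exact: hB.
have farRe b : M%:R * d - d / 2 <= `|Re b - Re w0| -> ~ bad b.
  move=> h; apply: good_far; have := nm_lowB (b - w0) (- w0); rewrite opprK subrK nmN.
  by have := Re_le_nm (b - w0); rewrite cReB; linarith.
have farIm b : M%:R * d - d / 2 <= `|Im b - Im w0| -> ~ bad b.
  move=> h; apply: good_far; have := nm_lowB (b - w0) (- w0); rewrite opprK subrK nmN.
  by have := Im_le_nm (b - w0); rewrite cImB; linarith.
have eN : N%:R * d = M%:R * d + M%:R * d + d by rewrite ne natrD mulrDl.
have cor i j : S i j -> bad (pt ox oy d i j) /\ bad (pt ox oy d i.+1 j.+1).
  move=> /and3P[_ _ /asboolP h]; have [? _ _ ?] := pt_cell ox oy dp i j.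
  by split; exact: h.
have S0 i : S i 0%N = false /\ S 0%N i = false.
  split; apply/negP => /cor[h _].
    apply: (farIm _ _ h); rewrite /= /oy mul0r addr0 ler_normr; linarith.
  apply: (farRe _ _ h); rewrite /= /ox mul0r addr0 ler_normr; linarith.
have SN i : S i N = false /\ S N i = false by rewrite /S !ltnn ?andbF.
have SN' i j : S i j -> (i.+1 < N)%N /\ (j.+1 < N)%N.
  move=> h; have [_ h2] := cor _ _ h; case/and3P: h => hi hj _.
  split; rewrite ltn_neqAle ?hi ?hj andbT; apply/eqP => e.
    apply: (farRe _ _ h2); rewrite /= /ox e eN ler_normr; linarith.
  apply: (farIm _ _ h2); rewrite /= /oy e eN ler_normr; linarith.
have w0off1 : ox + M%:R * d < Re w0 < ox + M.+1%:R * d by rewrite ne /ox; linarith.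
have w0off2 : oy + M%:R * d < Im w0 < oy + M.+1%:R * d by rewrite ne /oy; linarith.
have MN : (M < N)%N by rewrite ltnS leq_addr.
have [off cp] := cells_psqrt dp S MN MN w0off1 w0off2.
have SMM : S M M.
  apply/and3P; split=> //; apply/asboolP => b hb.
  have hw : incell ox oy d w0 M M by rewrite /incell; linarith.
  have db := cell_diam hb hw.
  have dist u (t : R) : A u -> 0 <= t <= 1 -> W u != w0 + t%:C%C * (b - w0).
    move=> Au /andP[t0 t1]; apply/eqP => e; have := hm _ Au; rewrite e addrC addKr nmM nm_real.
    rewrite ger0_norm // => h; have := ler_piMl (nm_ge0 (b - w0)) t1; linarith.
  split=> [u Au|iv]; first by have := dist u 1 Au; rewrite ler01 lexx rmorph1 mul1r addrC subrK; exact.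
  apply: nI; apply: Inv_segment iv => u t Au /andP[t0 t1].
  have -> : b + t%:C%C * (w0 - b) = w0 + (1 - t)%:C%C * (b - w0) by rewrite rmorphB rmorph1; ring.
  by apply: dist => //; linarith.
pose near v := exists2 u, A u & nm (W u - v) <= 2 * d.
(* A common edge of a cell in [S] and a cell outside [S] is within [2 * d] of [W(A)]: otherwise a
   pole could be moved inside the outer cell from its point that is not bad to the edge. *)
have bdry i j i' j' a b : S i j -> ~~ S i' j' -> (i' < N)%N -> (j' < N)%N ->
    incell ox oy d a i j -> incell ox oy d a i' j' ->
    incell ox oy d b i j -> incell ox oy d b i' j' -> near a /\ near b.
  move=> /and3P[_ _ /asboolP hS] nS hi' hj' ca ca' cb cb'.
  have [b' cb0 nb'] : exists2 b', incell ox oy d b' i' j' & ~ bad b'.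
    apply: contrapT => no; move/negP: nS; apply; apply/and3P; split=> //.
    by apply/asboolP => x hx; apply: contrapT => nx; apply: no; exists x.
  suff H x : incell ox oy d x i j -> incell ox oy d x i' j' -> near x by split; exact: H.
  move=> cx cx'; have [mx nIx] := hS _ cx; apply: contrapT => nn; apply: nb'.
  have ms u (t : R) : A u -> 0 <= t <= 1 -> W u != x + t%:C%C * (b' - x).
    move=> Au ht; apply/eqP => e; apply: nn; exists u => //; rewrite e.
    exact: cell_diam (cell_convex cx' cb0 ht) cx'.
  split=> [u Au|iv]; first by have := ms u 1 Au; rewrite ler01 lexx rmorph1 mul1r addrC subrK; exact.
  apply: nIx; apply: Inv_segment iv => u t Au /andP[t0 t1].
  have -> : b' + t%:C%C * (x - b') = x + (1 - t)%:C%C * (b' - x) by rewrite rmorphB rmorph1; ring.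
  by apply: ms => //; linarith.
pose q v := xget 0 [set u | A u /\ nm (W u - v) <= 2 * d].
have qP v : near v -> A (q v) /\ nm (W (q v) - v) <= 2 * d.
  by move=> [u Au hu]; rewrite /q; case: xgetP => [x -> //|/(_ u)[]].
pose c v := psqrt (1 + (v - W (q v)) / (W (q v) - w0)).
(* A square root of [v - w0] at points near [W(A)]: the value of [s] at a nearby point of [A],
   corrected by the root [c] of a number close to 1. Elsewhere 1 stands for an arbitrary nonzero
   value. *)
pose phi v := if `[< near v >] then s (q v) * c v else 1.
have cP v : near v -> [/\ nm (c v - 1) <= 1 / 10, c v != 0 &
     (s (q v) * c v) ^+ 2 = v - w0].
  move=> nv; have [Aq hq] := qP _ nv; have hmq := hm _ Aq.
  have q0 : W (q v) - w0 != 0 by rewrite -nm_gt0; linarith.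
  have xb : nm ((v - W (q v)) / (W (q v) - w0)) <= 1 / 10.
    by rewrite nmf ler_pdivrMr ?nm_gt0 // nmBC; linarith.
  have h1 : nm (c v - 1) <= 1 / 10 by apply: le_trans (psqrt_near1 _) _ => //; linarith.
  have sl : slit (1 + (v - W (q v)) / (W (q v) - w0)).
    by apply: slit_Re; rewrite cReD /=; have := Re_bound ((v - W (q v)) / (W (q v) - w0)); linarith.
  split=> //; first exact: psqrt_neq0.
  by rewrite exprMn psqrt_sqr // ss //; field.
have s0 v : near v -> s (q v) != 0.
  by move=> nv; rewrite -nm_gt0; have := sm _ (qP _ nv).1; linarith.
have phi0 v : phi v != 0.
  rewrite /phi; case: asboolP => [nv|_]; last exact: oner_neq0.
  by rewrite mulf_neq0 ?s0 //; case: (cP _ nv).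
(* Between adjacent corners [phi] changes by less than its modulus, so the quotient is the principal
   root, although the choice [q] need not be continuous. *)
have key a b : near a -> near b -> nm (a - b) <= d -> slit ((b - w0) / (a - w0)) ->
    psqrt ((b - w0) / (a - w0)) = phi b / phi a.
  move=> na nb hab sl; rewrite /phi !asboolT //.
  have [c1 _ e1] := cP _ na; have [c2 _ e2] := cP _ nb.
  have [Aa ha] := qP _ na; have [Ab hb] := qP _ nb.
  have hs : nm (s (q b) - s (q a)) < m1 / 10.
    apply: hd1 => //; have := nm_tri b (W (q b)) (W (q a)); have := nm_tri a b (W (q a)).
    by rewrite (nmBC b a) (nmBC a (W _)); linarith.
  have la := sm _ Aa.
  apply/esym/psqrt_uniq => //; first by rewrite expr_div_n e1 e2.
  set x := s (q b) * c b; set y := s (q a) * c a.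
  have y0 : 0 < nm y by rewrite nm_gt0 mulf_neq0 ?s0 //; case: (cP _ na).
  have xy : nm (x - y) < nm y.
    have -> : x - y = (s (q b) - s (q a)) * (c b - 1) + (s (q b) - s (q a))
        + s (q a) * ((c b - 1) - (c a - 1)) by rewrite /x /y; ring.
    have ly : nm (s (q a)) * (9 / 10) <= nm y.
      rewrite /y nmM ler_wpM2l ?nm_ge0 //.
      by have := nm_lowB 1 (1 - c a); rewrite subKr nm1 (nmBC 1); linarith.
    apply: (le_lt_trans (nmD _ _)).
    have := nmD ((s (q b) - s (q a)) * (c b - 1)) (s (q b) - s (q a)).
    have := nmB (c b - 1) (c a - 1).
    rewrite (nmM (s (q b) - s (q a)) (c b - 1)).
    rewrite (nmM (s (q a)) (c b - 1 - (c a - 1))) => h1 h2.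
    have h3 : nm (s (q a)) * nm (c b - 1 - (c a - 1)) <= nm (s (q a)) * (1 / 5).
      by rewrite ler_wpM2l ?nm_ge0 //; linarith.
    have h4 : nm (s (q b) - s (q a)) * nm (c b - 1) <= (m1 / 10) * (1 / 10).
      by rewrite ler_pM ?nm_ge0 // ltW.
    by linarith.
  have -> : x / y = 1 + (x - y) / y by field; rewrite -nm_gt0.
  have : nm ((x - y) / y) < 1 by rewrite nmf ltr_pdivrMr ?mul1r.
  by rewrite cReD /=; have := Re_bound ((x - y) / y); linarith.
have ptd k l : nm (pt ox oy d k l - pt ox oy d k.+1 l) <= d /\
               nm (pt ox oy d k l - pt ox oy d k l.+1) <= d.
  by split; apply: (le_trans (nm_le_ReIm _)); rewrite !cReB !cImB /= !ne;
     rewrite ?subrr normr0 ?addr0 ?add0r ler_norml; linarith.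
have nz i j : [/\ psqrt (hedge ox oy d w0 i j) != 0, psqrt (vedge ox oy d w0 i j) != 0,
    phi (pt ox oy d i.+1 j) / phi (pt ox oy d i j) != 0 &
    phi (pt ox oy d i j.+1) / phi (pt ox oy d i j) != 0].
  have [h1 h2] := offgrid_slit i j off.
  by split; rewrite ?psqrt_neq0 // mulf_neq0 ?invr_eq0.
have := cells_boundary nz S0 SN; rewrite cp SMM.
(* All factors are quotients of values of [phi] at corners, so every cell contributes 1. *)
have -> : cells S N (fun i j => phi (pt ox oy d i.+1 j) / phi (pt ox oy d i j))
   (fun i j => phi (pt ox oy d i j.+1) / phi (pt ox oy d i j)) = 1.
  apply: big1 => i _; apply: big1 => j _; case: ifP => // _; rewrite /around.
  rewrite [LHS](_ : _ = 1) //; move: (phi0 (pt ox oy d i j)) (phi0 (pt ox oy d i.+1 j))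
    (phi0 (pt ox oy d i j.+1)) (phi0 (pt ox oy d i.+1 j.+1)).
  move: (phi _) (phi _) (phi _) (phi _) => p1 p2 p3 p4 n1 n2 n3 n4.
  by field; rewrite n1 n2 n3 n4.
move=> H; have : (-1 : R[i]) = 1; last first.
  by move/eqP; rewrite eq_sym -addr_eq0 -(natrD _ 1 1) pnatr_eq0.
apply: H => i j hS.
  have [? ? t1 t2] := pt_cell ox oy dp i j.
  have [t3 t4 ? ?] := pt_cell ox oy dp i j.+1.
  have [n1 n2] : near (pt ox oy d i j.+1) /\ near (pt ox oy d i.+1 j.+1).
    have [h|h] := boolP (S i j).
      have h' : ~~ S i j.+1 by move: hS; rewrite h; case: (S i j.+1).
      by have [l1 l2] := SN' _ _ h; apply: (bdry _ _ _ _ _ _ h h') => //; exact: ltnW.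
    have h' : S i j.+1 by move: hS; rewrite (negbTE h); case: (S i j.+1).
    have [l1 l2] := SN' _ _ h'; apply: (bdry _ _ _ _ _ _ h' h) => //; first exact: ltnW.
    exact: ltn_trans (ltnW _) l2.
  by apply: key => //; [case: (ptd i j.+1)|case: (offgrid_slit i j.+1 off)].
have [? t1 ? t2] := pt_cell ox oy dp i j.
have [t3 ? t4 ?] := pt_cell ox oy dp i.+1 j.
have [n1 n2] : near (pt ox oy d i.+1 j) /\ near (pt ox oy d i.+1 j.+1).
  have [h|h] := boolP (S i j).
    have h' : ~~ S i.+1 j by move: hS; rewrite h; case: (S i.+1 j).
    by have [l1 l2] := SN' _ _ h; apply: (bdry _ _ _ _ _ _ h h') => //; exact: ltnW.
  have h' : S i.+1 j by move: hS; rewrite (negbTE h); case: (S i.+1 j).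
  have [l1 l2] := SN' _ _ h'; apply: (bdry _ _ _ _ _ _ h' h) => //; last exact: ltnW.
  exact: ltn_trans (ltnW _) l1.
by apply: key => //; [case: (ptd i.+1 j)|case: (offgrid_slit i.+1 j off)].
Qed.

(** The boundary of the union of cells that meet [W(Q)] avoids [W(A)], and the product [sg] of
    square roots along it is -1 inside and 1 outside, so [(1 - sg) / 2] is the idempotent. Each
    factor is the principal root of a Moebius function of [W] with values in the slit plane, hence a
    limit of polynomials by [oka_psqrt]. *)
Lemma separating_idempotent (Q : R[i] -> Prop) (eta : R) :
  (forall b, misses b -> Inv (fun u => W u - b)) -> 0 < eta ->
  (forall u v, A u -> A v -> Q u -> ~ Q v -> eta <= nm (W u - W v)) ->
  exists2 E, Ap E & forall u, A u -> (Q u -> E u = 1) /\ (~ Q u -> E u = 0).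
Proof.
move=> iW eta0 sep.
have [B Bp hB] := ccont_bound cA cW.
(* Two points of one cell are at most [2 * d < eta] apart, so no cell meets the images of both
   parts. *)
pose d := eta / 4; have dp : 0 < d by rewrite divr_gt0.
pose o := - B - 2 * d.
pose N := Num.bound ((2 * B + 4 * d) / d).
have hN : 2 * B + 4 * d < N%:R * d.
  by rewrite -ltr_pdivrMr //; apply: archi_boundP; rewrite divr_ge0 ?(ltW dp) //; linarith.
have ne (n : nat) : n.+1%:R * d = n%:R * d + d by rewrite -natr1 mulrDl mul1r.
pose S i j := [&& (i < N)%N, (j < N)%N &
   `[< exists u, [/\ A u, Q u & incell o o d (W u) i j] >]].
have WB u : A u -> [/\ - B <= Re (W u), Re (W u) <= B, - B <= Im (W u) & Im (W u) <= B].
  move=> Au; have := hB _ Au; have [? ?] := Re_bound (W u); have [? ?] := Im_bound (W u).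
  by move=> ?; split; linarith.
have S0 i : S i 0%N = false /\ S 0%N i = false.
  split; apply/negP => /and3P[_ _ /asboolP[u [Au _ /andP[/andP[_ h1] /andP[_ h2]]]]];
  have [? ? ? ?] := WB _ Au; rewrite ?ne mul0r in h1 h2; rewrite /o in h1 h2; linarith.
have SN i : S i N = false /\ S N i = false by rewrite /S !ltnn ?andbF.
have bdS i j i' j' u : A u -> S i j -> ~~ S i' j' -> (i' < N)%N -> (j' < N)%N ->
    incell o o d (W u) i j -> incell o o d (W u) i' j' -> False.
  move=> Au /and3P[_ _ /asboolP[v [Av Qv cv]]] nS hi hj cu cu'.
  have [Qu|nQ] := pselect (Q u).
    move/negP: nS; apply; apply/and3P; split=> //; apply/asboolP; by exists u.
  by have := cell_diam cv cu; have := sep _ _ Av Au Qv nQ; rewrite /d; linarith.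
have inN u i j : A u -> incell o o d (W u) i j -> (i < N)%N /\ (j < N)%N.
  move=> Au /andP[/andP[h1 _] /andP[h2 _]]; have [? ? ? ?] := WB _ Au.
  have hi : i%:R * d < N%:R * d by rewrite /o in h1; linarith.
  have hj : j%:R * d < N%:R * d by rewrite /o in h2; linarith.
  by rewrite !ltr_pM2r // !ltr_nat in hi hj.
(* The horizontal edge [(i, j)] lies between the cells [(i, j.-1)] and [(i, j)]; [hb] and [vb] mark
   the edges at which membership in [S] changes. *)
pose hb i j := (0 < j)%N && (S i j.-1 != S i j).
pose vb i j := (0 < i)%N && (S i.-1 j != S i j).
have hmiss i j u (t : R) : hb i j -> A u -> 0 <= t <= 1 ->
    pt o o d i j + t%:C%C * (pt o o d i.+1 j - pt o o d i j) != W u.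
  case: j => [//|j] /andP[_ /= hS] Au ht; apply/eqP => e.
  have [_ _ t1 t2] := pt_cell o o dp i j; have [t3 t4 _ _] := pt_cell o o dp i j.+1.
  have c1 := cell_convex t1 t2 ht; have c2 := cell_convex t3 t4 ht.
  rewrite e in c1 c2; have [iN jN] := inN _ _ _ Au c2.
  have [h|h] := boolP (S i j).
    by apply: (bdS _ _ _ _ _ Au h _ iN jN c1 c2); move: hS; rewrite h; case: (S i j.+1).
  have h' : S i j.+1 by move: hS; rewrite (negbTE h); case: (S i j.+1).
  exact: (bdS _ _ _ _ _ Au h' h iN (ltnW jN) c2 c1).
have vmiss i j u (t : R) : vb i j -> A u -> 0 <= t <= 1 ->
    pt o o d i j + t%:C%C * (pt o o d i j.+1 - pt o o d i j) != W u.
  case: i => [//|i] /andP[_ /= hS] Au ht; apply/eqP => e.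
  have [_ t1 _ t2] := pt_cell o o dp i j; have [t3 _ t4 _] := pt_cell o o dp i.+1 j.
  have c1 := cell_convex t1 t2 ht; have c2 := cell_convex t3 t4 ht.
  rewrite e in c1 c2; have [iN jN] := inN _ _ _ Au c2.
  have [h|h] := boolP (S i j).
    by apply: (bdS _ _ _ _ _ Au h _ iN jN c1 c2); move: hS; rewrite h; case: (S i.+1 j).
  have h' : S i.+1 j by move: hS; rewrite (negbTE h); case: (S i.+1 j).
  exact: (bdS _ _ _ _ _ Au h' h (ltnW iN) jN c2 c1).
(* Interior edges get the factor 1: [W] may meet them, and by [cells_boundary] they do not affect
   the product. *)
pose hs w i j := if hb i j then psqrt (hedge o o d w i j) else 1.
pose vs w i j := if vb i j then psqrt (vedge o o d w i j) else 1.
pose sg w := cells S N (hs w) (vs w).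
have hsl i j u : hb i j -> A u -> slit (hedge o o d (W u) i j).
  by move=> h Au; apply: slit_segment => t ht; exact: hmiss.
have vsl i j u : vb i j -> A u -> slit (vedge o o d (W u) i j).
  by move=> h Au; apply: slit_segment => t ht; exact: vmiss.
have ratio a b : misses a -> Ap (fun u => (b - W u) / (a - W u)).
  move=> ma; have h := ApN (Inv_Ap (iW _ ma)).
  apply: Ap_eq (ApM cA cZ cW (ApB (Ap_cst _ _ _ b) (Ap_W Z W A)) h) => u Au.
  by rewrite -[a - W u]opprB invrN.
have mend (e : R[i]) f : (forall u (t : R), A u -> 0 <= t <= 1 -> e + t%:C%C * (f - e) != W u) ->
    misses e /\ misses f.
  move=> h; split=> u Au; rewrite eq_sym; [have := h u 0 Au|have := h u 1 Au].
    by rewrite lexx ler01 rmorph0 mul0r addr0; exact.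
  by rewrite lexx ler01 rmorph1 mul1r addrC subrK; exact.
have Aedge (e : R[i]) f : (forall u (t : R), A u -> 0 <= t <= 1 -> e + t%:C%C * (f - e) != W u) ->
    let g u := psqrt ((f - W u) / (e - W u)) in
    [/\ Ap g, Ap (fun u => (g u)^-1) & forall u, A u -> g u != 0].
  move=> h g; have [m1 m2] := mend _ _ h.
  have sl u : A u -> slit ((f - W u) / (e - W u)).
    by move=> Au; apply: slit_segment => t ht; exact: h.
  have hg : Ap g by apply: (oka_psqrt cA cZ cW) => //; exact: ratio.
  have g0 u : A u -> g u != 0 by move=> Au; exact/psqrt_neq0/sl.
  split=> //; apply: Ap_eq (ApM cA cZ cW hg (ratio _ e m2)) => u Au.
  apply: (mulfI (g0 _ Au)); rewrite mulfV ?g0 // mulrA -expr2 psqrt_sqr ?sl //.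
  have n1 : e - W u != 0 by rewrite subr_eq0 eq_sym m1.
  have n2 : f - W u != 0 by rewrite subr_eq0 eq_sym m2.
  by rewrite mulrA divfK // mulfV.
have Ah i j : [/\ Ap (fun u => hs (W u) i j), Ap (fun u => (hs (W u) i j)^-1) &
    forall u, A u -> hs (W u) i j != 0].
  rewrite /hs; have [h|h] := boolP (hb i j).
    exact: (Aedge (pt o o d i j) (pt o o d i.+1 j) (fun u t => @hmiss i j u t h)).
  by split=> [||u _]; rewrite ?oner_neq0 //; [exact: Ap_cst|exact: Ap_cst].
have Av i j : [/\ Ap (fun u => vs (W u) i j), Ap (fun u => (vs (W u) i j)^-1) &
    forall u, A u -> vs (W u) i j != 0].
  rewrite /vs; have [h|h] := boolP (vb i j).
    exact: (Aedge (pt o o d i j) (pt o o d i j.+1) (fun u t => @vmiss i j u t h)).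
  by split=> [||u _]; rewrite ?oner_neq0 //; [exact: Ap_cst|exact: Ap_cst].
have ApP n (f : nat -> R[i] -> R[i]) : (forall i, Ap (f i)) ->
    Ap (fun u => \prod_(i < n) f i u).
  move=> hf; elim: n => [|n IH].
    by apply: Ap_eq (Ap_cst _ _ _ 1) => u _; rewrite big_ord0.
  by apply: Ap_eq (ApM cA cZ cW IH (hf n)) => u _; rewrite big_ord_recr.
have Asg : Ap (fun u => sg (W u)).
  apply: (ApP N (fun i u => \prod_(j < N)
     (if S i j then around (hs (W u)) (vs (W u)) i j else 1))) => i.
  apply: (ApP N (fun j u => if S i j then around (hs (W u)) (vs (W u)) i j else 1)) => j.
  case: (S i j); last exact: Ap_cst.
  have [a1 _ _] := Ah i j; have [_ a2 _] := Ah i j.+1.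
  have [a3 _ _] := Av i.+1 j; have [_ a4 _] := Av i j.
  by apply: (ApM cA cZ cW _ a4); apply: (ApM cA cZ cW _ a2); exact: (ApM cA cZ cW a1 a3).
suff val u : A u -> (Q u -> sg (W u) = -1) /\ (~ Q u -> sg (W u) = 1).
  exists (fun u => (1 - sg (W u)) * (1 / 2)).
    by apply: (ApM cA cZ cW); [apply: ApB => //|]; exact: Ap_cst.
  move=> u Au; have [v1 v2] := val _ Au; split=> [/v1|/v2] ->; first by field.
  by rewrite subrr mul0r.
move=> Au.
pose T w := [/\ forall i j, hb i j -> slit (hedge o o d w i j),
     forall i j, vb i j -> slit (vedge o o d w i j) &
     forall i j, hs w i j != 0 /\ vs w i j != 0].
have csg : ccont T sg.
  have cP n (f : nat -> R[i] -> R[i]) : (forall i, ccont T (f i)) ->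
      ccont T (fun u => \prod_(i < n) f i u).
    move=> hf; elim: n => [|n IH].
      by apply: ccont_eq (@ccont_cst _ _ 1) => w _; rewrite big_ord0.
    by apply: ccont_eq (ccontM IH (hf n)) => w _; rewrite big_ord_recr.
  have cr a b : (forall w, T w -> slit ((a - w) / (b - w))) ->
      ccont T (fun w => psqrt ((a - w) / (b - w))).
    move=> h; apply: ccont_psqrt => //; apply: ccontM.
      by apply: ccontB; [exact: ccont_cst|exact: ccont_id].
    apply: ccontV => [w /h /slit_neq0|].
      by apply: contraNneq => ->; rewrite invr0 mulr0.
    by apply: ccontB; [exact: ccont_cst|exact: ccont_id].
  have ch i j : ccont T (fun w => hs w i j).
    rewrite /hs; have [h|h] := boolP (hb i j); last exact: ccont_cst.
    by apply: cr => w [/(_ _ _ h)].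
  have cv i j : ccont T (fun w => vs w i j).
    rewrite /vs; have [h|h] := boolP (vb i j); last exact: ccont_cst.
    by apply: cr => w [_ /(_ _ _ h)].
  apply: (cP N (fun i w => \prod_(j < N)
     (if S i j then around (hs w) (vs w) i j else 1))) => i.
  apply: (cP N (fun j w => if S i j then around (hs w) (vs w) i j else 1)) => j.
  case: (S i j); last exact: ccont_cst.
  apply: ccontM; last by apply: ccontV => // w [_ _ /(_ i j)[]].
  apply: ccontM; last by apply: ccontV => // w [_ _ /(_ i j.+1)[]].
  exact: ccontM.
have Tw : T (W u).
  split=> [i j h|i j h|i j]; [exact: hsl|exact: vsl|].
  by case: (Ah i j) => _ _ /(_ _ Au); case: (Av i j) => _ _ /(_ _ Au).
have [b1 b2 b3 b4] := WB _ Au.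
have oR : o <= Re (W u) by rewrite /o; linarith.
have oI : o <= Im (W u) by rewrite /o; linarith.
have [i [x1 x2]] := grid_index dp oR; have [j [y1 y2]] := grid_index dp oI.
have cu : incell o o d (W u) i j by rewrite /incell x1 y1 !ltW.
have [iN jN] := inN _ _ _ Au cu.
(* [W u] may lie on a grid line, where [cells_psqrt] gives nothing; a small diagonal shift leads
   into the open cell, and [sg] is continuous on [T]. *)
have near e : 0 < e -> exists2 w, nm (w - W u) < e &
    T w /\ sg w = if S i j then -1 else 1.
  move=> e0.
  pose t := Num.min (e / 4) (Num.min ((o + i.+1%:R * d - Re (W u)) / 2)
      ((o + j.+1%:R * d - Im (W u)) / 2)).
  have t0 : 0 < t by rewrite !lt_min !divr_gt0 ?subr_gt0.
  have t1 : t <= e / 4 by rewrite ge_min lexx.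
  have t2 : t <= (o + i.+1%:R * d - Re (W u)) / 2 by rewrite !ge_min lexx orbT.
  have t3 : t <= (o + j.+1%:R * d - Im (W u)) / 2 by rewrite !ge_min lexx !orbT.
  exists (W u + Complex t t).
    rewrite addrC addKr; apply: (le_lt_trans (nm_le_ReIm _)) => /=.
    by rewrite (ger0_norm (ltW t0)); linarith.
  set w := W u + _.
  have hx : o + i%:R * d < Re w < o + i.+1%:R * d by rewrite /w cReD /=; linarith.
  have hy : o + j%:R * d < Im w < o + j.+1%:R * d by rewrite /w cImD /=; linarith.
  have [off cp] := cells_psqrt dp S iN jN hx hy.
  have n0 k l : psqrt (hedge o o d w k l) != 0 /\ psqrt (vedge o o d w k l) != 0.
    by have [h1 h2] := offgrid_slit k l off; split; exact: psqrt_neq0.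
  have n1 k l : hs w k l != 0 /\ vs w k l != 0.
    by rewrite /hs /vs; split; case: ifP; rewrite ?oner_neq0; case: (n0 k l).
  split; first by split=> // k l _; case: (offgrid_slit k l off).
  rewrite -cp /sg; apply: cells_boundary => // [k l|k l h|k l h].
  - by case: (n0 k l) => ? ?; case: (n1 k l).
  - by rewrite /hs /hb /= h.
  - by rewrite /vs /vb /= h.
have eq : sg (W u) = if S i j then -1 else 1.
  apply/eqP; rewrite -subr_eq0 -nm_eq0 eq_le nm_ge0 andbT leNgt; apply/negP => pos.
  have [e e0 he] := csg _ Tw _ pos; have [w hw [Tw' ew]] := near _ e0.
  by have := he _ Tw' hw; rewrite ew nmBC ltxx.
rewrite eq; split=> h.
  have -> // : S i j; apply/and3P; split=> //; apply/asboolP; by exists u.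
case: ifP => // /and3P[_ _ /asboolP[v [Av' Qv cv]]]; exfalso.
by have := cell_diam cv cu; have := sep _ _ Av' Au Qv h; rewrite /d; linarith.
Qed.

End PlaneTopology.

(** * Square roots of nonvanishing functions *)

Section SquareRoots.
Variable R : realType.
Implicit Types (A L : R[i] -> Prop) (g s : R[i] -> R[i]).

Definition HasSqrt A g := exists2 s, ccont A s & forall u, A u -> s u ^+ 2 = g u.

Lemma HasSqrt_sub A A' g : (forall u, A' u -> A u) -> HasSqrt A g -> HasSqrt A' g.
Proof.
by move=> h [s cs e]; exists s => [|u /h]; [exact: ccont_sub cs|exact: e].
Qed.

Lemma ccont_side A (p : R[i] -> R) (c : R) u0 : ccont A (fun u => (p u)%:C%C) ->
  A u0 -> p u0 != c -> exists2 d, 0 < d &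
    forall u, A u -> nm (u - u0) < d -> (p u <= c) = (p u0 <= c) /\ p u != c.
Proof.
move=> cp Au0; rewrite -subr_eq0 -normr_gt0 => h; have [d d0 hd] := cp _ Au0 _ h.
exists d => // u Au hu; have := hd _ Au hu; rewrite -rmorphB nm_real.
have [h1|h1] := leP (p u0) c; rewrite ltr_norml => h2.
  rewrite ler0_norm ?subr_le0 // in h h2.
  by split; [linarith|apply/eqP => e; linarith].
rewrite gtr0_norm ?subr_gt0 // in h h2.
by split; [apply/negbTE; rewrite -ltNge; linarith|apply/eqP => e; linarith].
Qed.

Lemma ccont_glue A (p : R[i] -> R) (c : R) s1 s2 :
  ccont A (fun u => (p u)%:C%C) ->
  ccont (fun u => A u /\ p u <= c) s1 -> ccont (fun u => A u /\ c <= p u) s2 ->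
  (forall u, A u -> p u = c -> s1 u = s2 u) ->
  ccont A (fun u => if p u <= c then s1 u else s2 u).
Proof.
move=> cp c1 c2 ag u0 Au0 e e0.
have [e1|ne] := eqVneq (p u0) c; last first.
  have [d d0 hd] := ccont_side cp Au0 ne; move: hd.
  have [h|h] := leP (p u0) c => hd.
    have [d' d'0 hd'] := c1 _ (conj Au0 h) _ e0.
    exists (Num.min d d'); rewrite ?lt_min ?d0 // => u Au; rewrite lt_min => /andP[h1 h2].
    by have [pu _] := hd _ Au h1; rewrite pu; apply: hd'.
  have [d' d'0 hd'] := c2 _ (conj Au0 (ltW h)) _ e0.
  exists (Num.min d d'); rewrite ?lt_min ?d0 // => u Au; rewrite lt_min => /andP[h1 h2].
  have [pu _] := hd _ Au h1; rewrite pu; apply: hd' => //; split=> //.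
  by rewrite leNgt; apply/negP => /ltW; rewrite pu.
have le1 : p u0 <= c by rewrite e1.
have ge1 : c <= p u0 by rewrite e1.
have [d d0 hd] := c1 _ (conj Au0 le1) _ e0.
have [d' d'0 hd'] := c2 _ (conj Au0 ge1) _ e0.
exists (Num.min d d'); rewrite ?lt_min ?d0 // => u Au; rewrite lt_min => /andP[h1 h2].
rewrite le1; case: (leP (p u) c) => pu; first exact: hd.
by rewrite (ag _ Au0 e1); apply: hd' => //; split=> //; exact: ltW.
Qed.

(** On the imaginary axis the roots cut along opposite rays agree up to a factor that depends on the
    side of 0. This is what turns a root of [u - r] into a change of sign at [r]. *)
Lemma psqrt_imag (x : R[i]) : Re x = 0 -> Im x != 0 ->
  psqrt x = (if 0 < Im x then 'i%C else - 'i%C) * psqrt (- x).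
Proof.
move=> rx ix; have sx : slit x by apply/slitP; right.
have sN : slit (- x) by apply/slitP; right; rewrite cImN oppr_eq0.
apply/esym/psqrt_uniq => //.
  rewrite exprMn psqrt_sqr // (_ : _ ^+ 2 = -1) ?mulN1r ?opprK //.
  by case: ifP => _; rewrite ?sqrrN expr2; apply: complex_eq => /=; ring.
have h := psqrt_Re sN; have := psqrt_Im sN; rewrite cImN.
have eR (y : R[i]) : Re ('i%C * y) = - Im y /\ Re (- 'i%C * y) = Im y.
  by rewrite !cReM /=; split; ring.
move=> e; case: ifPn => i0; have [e1 e2] := eR (psqrt (- x)).
  rewrite e1 oppr_gt0.
  have : 2 * Re (psqrt (- x)) * Im (psqrt (- x)) < 0 by rewrite -e oppr_lt0.
  by rewrite pmulr_rlt0 // mulr_gt0.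
have h' : 0 < - Im x by rewrite oppr_gt0 lt_neqAle ix leNgt.
by rewrite e2; move: h'; rewrite e pmulr_rgt0 // mulr_gt0.
Qed.

(* Two square roots of g on the closed half planes agree up to a locally constant
   sign on the dividing line; sign changes are removed one gap point r at a time,
   comparing a square root of u - r with its branches on the two sides. *)
Lemma glue_halves A g (al : R[i]) (c : R) : ccompact A -> nm al = 1 ->
  ccont A g -> (forall u, A u -> g u != 0) ->
  HasSqrt (fun u => A u /\ Re (al * u) <= c) g ->
  HasSqrt (fun u => A u /\ c <= Re (al * u)) g ->
  (forall r x y, A x -> A y -> Re (al * x) = c -> Re (al * y) = c -> Re (al * r) = c ->
     Im (al * x) <= Im (al * r) <= Im (al * y) -> ~ A r -> HasSqrt A (fun u => u - r)) ->
  HasSqrt A g.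
Proof.
move=> cA nal cg g0 [s1 cs1 e1] [s2 cs2 e2] gap.
have al0 : al != 0 by rewrite -nm_gt0 nal.
pose p u := Re (al * u); pose q u := Im (al * u).
pose A1 u := A u /\ p u <= c; pose A2 u := A u /\ c <= p u.
pose I u := A u /\ p u = c.
have cal : ccont A (fun u => al * u) by apply: ccontM; [exact: ccont_cst|exact: ccont_id].
have I1 u : I u -> A1 u by move=> [? h]; split=> //; rewrite h.
have I2 u : I u -> A2 u by move=> [? h]; split=> //; rewrite h.
have cI : ccompact I.
  apply: (ccompact_closed cA) => [u []//|u0 Au0 nI].
  have ne : p u0 != c by apply/eqP => e; apply: nI.
  have [d d0 hd] := ccont_side (ccont_re cal) Au0 ne.
  exists d => // u [Au pu]; rewrite leNgt; apply/negP => /(hd _ Au)[_].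
  by rewrite -/(p u) pu eqxx.
have s10 u : I u -> s1 u != 0.
  by move=> /[dup] /I1 h [Au _]; have := g0 _ Au; rewrite -e1 // sqrf_eq0.
have s20 u : I u -> s2 u != 0.
  by move=> /[dup] /I2 h [Au _]; have := g0 _ Au; rewrite -e2 // sqrf_eq0.
have dist u v : I u -> I v -> nm (u - v) = `|q u - q v|.
  move=> [_ pu] [_ pv]; rewrite -[LHS]mul1r -nal -nmM mulrBr.
  rewrite (_ : al * u - al * v = 'i%C * (q u - q v)%:C%C) ?nmM ?nm_real.
    by rewrite /= expr0n expr1n add0r sqrtr1 mul1r.
  apply: complex_eq; last by rewrite cImB -/(q u) -/(q v) cImM /=; ring.
  by rewrite cReB -/(p u) -/(p v) pu pv cReM /=; ring.
have pm (x y : R[i]) : x ^+ 2 = y ^+ 2 -> x <> y -> x = - y.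
  by move=> /eqP; rewrite eqf_sqr => /orP[/eqP|/eqP].
(* [s1 / s2] takes the values 1 and -1 on the dividing line, so by uniform continuity it is constant
   between points at distance below [2 * eta]. *)
have [eta eta0 heta] : exists2 eta, 0 < eta & forall u v, I u -> I v ->
    `|q u - q v| < 2 * eta -> (s1 u = s2 u -> s1 v = s2 v).
  have cf : ccont I (fun u => s1 u / s2 u).
    apply: ccontM; first exact: ccont_sub cs1.
    by apply: ccontV => //; exact: ccont_sub cs2.
  have [d d0 hd] := ccont_unif cI cf ltr01.
  exists (d / 2) => [|u v Iu Iv]; first by rewrite divr_gt0.
  rewrite mulrC divfK ?pnatr_eq0 // -dist // => /(hd _ _ Iu Iv) + eu.
  rewrite eu divff ?s20 // => h; apply: contrapT => nv.
  have ev : s1 v = - s2 v by apply: pm => //; rewrite e1 ?e2 //; [exact: I2|exact: I1].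
  move: h; rewrite ev mulNr divff ?s20 // opprK -(natrD _ 1 1).
  by rewrite -(rmorph_nat (real_complex R)) nm_real normr_nat; linarith.
(* Progress up to height [Y] on the dividing line: the roots agree up to there, and above [Y - eta]
   the relative sign is constant between points less than [2 * eta] apart. *)
pose St (Y : R) := exists s1' s2', [/\ ccont A1 s1' /\ (forall u, A1 u -> s1' u ^+ 2 = g u),
   ccont A2 s2' /\ (forall u, A2 u -> s2' u ^+ 2 = g u),
   (forall u, I u -> q u <= Y -> s1' u = s2' u) &
   (forall u v, I u -> I v -> Y - eta < q u -> Y - eta < q v ->
      `|q u - q v| < 2 * eta -> (s1' u = s2' u -> s1' v = s2' v))].
have step Y : St Y -> St (Y + eta).
  move=> [t1 [t2 [[ct1 et1] [ct2 et2] ag un]]].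
  have t20 u : I u -> t2 u != 0.
    by move=> /[dup] /I2 h [Au _]; have := g0 _ Au; rewrite -et2 // sqrf_eq0.
  have [al1|] := pselect (forall u, I u -> q u <= Y + eta -> t1 u = t2 u).
    exists t1, t2; split=> // u v Iu Iv h1 h2; apply: un => //; linarith.
  move=> /existsNP[u1 /not_implyP[Iu1 /not_implyP[h1 n1]]].
  have qu1 : Y < q u1 by rewrite ltNge; apply/negP => h; apply: n1; exact: ag.
  have B u : I u -> Y - eta < q u -> q u <= Y + eta -> t1 u <> t2 u.
    move=> Iu h2 h3 eu; apply: n1; apply: (un u u1) => //; first by linarith.
    by rewrite ltr_norml; linarith.
  have gapB u : I u -> Y - eta < q u -> Y < q u.
    move=> Iu h; rewrite ltNge; apply/negP => h'; apply: (B u) => //; last exact: ag.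
    linarith.
  have opp u : I u -> t1 u <> t2 u -> t1 u = - t2 u.
    by move=> Iu n; apply: pm => //; rewrite et1 ?et2 //; [exact: I2|exact: I1].
  (* If the line has no point of [A] up to height [Y], negating [t1] everywhere is enough. *)
  have [[x [Ix hx]]|nox] := pselect (exists x, I x /\ q x <= Y); last first.
    exists (fun u => - t1 u), t2; split=> //.
    - by split=> [|u ?]; rewrite ?sqrrN ?et1 //; exact: ccontN.
    - move=> u Iu hu; have : q u > Y by rewrite ltNge; apply/negP => h; apply: nox; exists u.
      by move=> hY; rewrite opp ?opprK //; apply: B => //; linarith.
    - move=> u v Iu Iv; rewrite addrK => hu hv hd /eqP; rewrite eqr_oppLR => /eqP eu.
      rewrite opp ?opprK // => ev; have : t1 u = t2 u by apply: (un v u) => //; rewrite ?(distrC (q v)) //; linarith.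
      rewrite eu => /eqP; rewrite -subr_eq0 -opprD oppr_eq0 -mulr2n mulrn_eq0 /=.
      by rewrite (negbTE (t20 _ Iu)).
  (* The point of the line at height [Y]. In [A] it would have both the relative sign of the points
     up to [Y] and, being close to [u1], the opposite one. *)
  pose r := al^-1 * Complex c Y.
  have alr : al * r = Complex c Y by rewrite /r mulrA mulfV // mul1r.
  have nAr : ~ A r.
    move=> Ar; have Ir : I r by split=> //; rewrite /p alr.
    have : Y < q r by apply: gapB => //; rewrite /q alr /=; linarith.
    by rewrite /q alr ltxx.
  have [|||t ct et] := gap r x u1 Ix.1 Iu1.1 Ix.2 Iu1.2.
  - by rewrite alr.
  - by rewrite alr /= hx ltW.
  - by [].
  have [sa esa] := sqrt_exists al.
  have sa0 : sa != 0 by apply: contraNneq al0 => e; rewrite -esa e expr0n.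
  have im u : I u -> q u <> Y by move=> Iu e; have := gapB _ Iu; rewrite e; linarith.
  have cur : ccont A (fun u => al * (u - r)).
    by apply: ccontM; [exact: ccont_cst|apply: ccontB; [exact: ccont_id|exact: ccont_cst]].
  have reE u : Re (al * (u - r)) = p u - c by rewrite mulrBr alr cReB.
  have imE u : Im (al * (u - r)) = q u - Y by rewrite mulrBr alr cImB.
  have sl1 u : A1 u -> slit (- (al * (u - r))).
    move=> [Au]; rewrite le_eqVlt => /orP[/eqP pu|pu]; apply/slitP.
      by right; rewrite cImN oppr_eq0 imE subr_eq0; apply/eqP/im.
    by left; rewrite cReN reE; linarith.
  have sl2 u : A2 u -> slit (al * (u - r)).
    move=> [Au]; rewrite le_eqVlt => /orP[/eqP pu|pu]; apply/slitP.
      by right; rewrite imE subr_eq0; apply/eqP/im.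
    by left; rewrite reE; linarith.
  (* [sa * t] over a half plane branch of the root of [al * (u - r)] is a sign up to a constant. By
     [psqrt_imag], passing from [t1], [t2] to [f1], [f2] flips the relative sign above [Y] and keeps
     it below. *)
  pose f1 u := - t1 u * sa * t u / ('i%C * psqrt (- (al * (u - r)))).
  pose f2 u := t2 u * sa * t u / psqrt (al * (u - r)).
  have A1A u : A1 u -> A u by case.
  have A2A u : A2 u -> A u by case.
  have i0 : 'i%C != 0 :> R[i] by rewrite eq_complex /= oner_eq0 andbF.
  have i2 (y : R[i]) : ('i%C * y) ^+ 2 = - y ^+ 2.
    by apply: complex_eq; rewrite !expr2 !ReImE /=; ring.
  have f1E u : A1 u -> f1 u ^+ 2 = g u.
    move=> h; have n1' := slit_neq0 (sl1 _ h).
    rewrite /f1 expr_div_n i2 psqrt_sqr ?sl1 // opprK !exprMn sqrrN et1 // esa (et _ h.1).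
    by rewrite oppr_eq0 in n1'; rewrite -mulrA mulfK.
  have f2E u : A2 u -> f2 u ^+ 2 = g u.
    move=> h; have n1' := slit_neq0 (sl2 _ h).
    by rewrite /f2 expr_div_n psqrt_sqr ?sl2 // !exprMn et2 // esa (et _ h.1) -mulrA mulfK.
  have rel u : I u -> f1 u = f2 u <-> t1 u = (if q u <= Y then t2 u else - t2 u).
    move=> Iu; have P0 := psqrt_neq0 (sl1 _ (I1 _ Iu)).
    have t0 : t u != 0.
      have n : u - r != 0 by rewrite subr_eq0; apply: contra_not_neq nAr => <-; case: Iu.
      by apply: contraNneq n => e; rewrite -(et _ Iu.1) e expr0n.
    have k0 : sa * t u / ('i%C * psqrt (- (al * (u - r)))) != 0.
      by apply: mulf_neq0; [exact: mulf_neq0|rewrite invr_eq0 mulf_neq0].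
    have eP : psqrt (al * (u - r)) = (if q u <= Y then - 'i%C else 'i%C) * psqrt (- (al * (u - r))).
      rewrite psqrt_imag ?reE ?imE; [|by rewrite Iu.2 subrr|by rewrite subr_eq0; apply/eqP/im].
      by rewrite subr_gt0 ltNge; case: (leP (q u) Y).
    have -> : f1 u = - t1 u * (sa * t u / ('i%C * psqrt (- (al * (u - r))))) by rewrite /f1 !mulrA.
    have -> : f2 u = - (if q u <= Y then t2 u else - t2 u) *
         (sa * t u / ('i%C * psqrt (- (al * (u - r))))).
      rewrite /f2 eP; case: ifP => _; last by rewrite opprK !mulrA.
      by rewrite -(mulN1r 'i%C) -[_ * _ * psqrt _]mulrA invfM invrN1; ring.
    split=> [/(mulIf k0)/oppr_inj //|->//].
  exists f1, f2; split=> //.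
  - split=> //; apply: ccontM.
      apply: ccontM; last exact: ccont_sub ct.
      by apply: ccontM; [exact: ccontN|exact: ccont_cst].
    apply: ccontV => [u h|]; first by rewrite mulf_neq0 // psqrt_neq0 // sl1.
    apply: ccontM; first exact: ccont_cst.
    by apply: ccont_psqrt => //; apply: ccontN; exact: ccont_sub cur.
  - split=> //; apply: ccontM.
      apply: ccontM; last exact: ccont_sub ct.
      by apply: ccontM => //; exact: ccont_cst.
    apply: ccontV => [u h|]; first by rewrite psqrt_neq0 // sl2.
    by apply: ccont_psqrt => //; exact: ccont_sub cur.
  - move=> u Iu hu; apply/rel => //; case: (leP (q u) Y) => h; first exact: ag.
    by apply: opp => //; apply: B => //; linarith.
  - move=> u v Iu Iv; rewrite addrK => hu hv hd /(rel _ Iu); rewrite leNgt hu /= => eu.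
    apply/rel => //; rewrite leNgt hv /=; apply: opp => // ev.
    have : t1 u = t2 u by apply: (un v u) => //; rewrite ?(distrC (q v)) //; linarith.
    rewrite eu => /eqP; rewrite -subr_eq0 -opprD oppr_eq0 -mulr2n mulrn_eq0 /=.
    by rewrite (negbTE (t20 _ Iu)).
have [B B0 hB] := ccont_bound cA cal.
have qB u : A u -> - B <= q u /\ q u <= B.
  by move=> /hB h; have := Im_bound (al * u); rewrite /q; linarith.
have St0 : St (- B - 1).
  exists s1, s2; split=> // [u Iu h|u v Iu Iv _ _]; last exact: heta.
  by exfalso; have := qB _ Iu.1; linarith.
have Stn n : St (- B - 1 + n%:R * eta).
  elim: n => [|n /step]; first by rewrite mul0r addr0.
  by rewrite -natr1 mulrDl mul1r addrA.
pose n := Num.bound ((2 * B + 1) / eta).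
have hn : 2 * B + 1 < n%:R * eta.
  by rewrite -ltr_pdivrMr //; apply: archi_boundP; rewrite divr_ge0 ?(ltW eta0) //; linarith.
have [t1 [t2 [[ct1 et1] [ct2 et2] ag _]]] := Stn n.
exists (fun u => if p u <= c then t1 u else t2 u).
  apply: ccont_glue => //; first exact: ccont_re cal.
  by move=> u Au pu; apply: ag => //; have := qB _ Au; linarith.
move=> u Au; case: (leP (p u) c) => h; first exact: et1.
by apply: et2; split=> //; exact: ltW.
Qed.

End SquareRoots.

(** * Roots on compact sets that do not separate the plane *)

Section NonvanishingFunctions.
Variable R : realType.
Implicit Types (A L : R[i] -> Prop) (g s : R[i] -> R[i]).

Definition box L (x1 x2 y1 y2 : R) (u : R[i]) :=
  [/\ L u, x1 <= Re u <= x2 & y1 <= Im u <= y2].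

Lemma ccompact_box L x1 x2 y1 y2 : ccompact L -> ccompact (box L x1 x2 y1 y2).
Proof.
move=> cL; apply: (ccompact_closed cL) => [u []//|u0 Lu0 nb].
pose m := Num.max (Num.max (x1 - Re u0) (Re u0 - x2)) (Num.max (y1 - Im u0) (Im u0 - y2)).
exists m => [|u [Lu /andP[h1 h2] /andP[h3 h4]]].
  rewrite ltNge; apply/negP; rewrite !ge_max => /andP[/andP[a1 a2] /andP[a3 a4]].
  by apply: nb; split=> //; linarith.
have := Re_bound (u - u0); have := Im_bound (u - u0); rewrite cReB cImB => h5 h6.
by rewrite !ge_max; linarith.
Qed.

(** On a square of side [e] the values of [g] are within [m] of each other, so a principal root
    exists; squares are glued to rows and rows to a box around [L]. A gap point on a dividing line
    lies between two points of the box, hence in its rectangle, and so is a gap point of [L]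
    itself. *)
Lemma sqrt_of_gaps L g : ccompact L -> ccont L g -> (forall u, L u -> g u != 0) ->
  (forall r, ~ L r -> HasSqrt L (fun u => u - r)) -> HasSqrt L g.
Proof.
move=> cL cg g0 gap.
have [m m0 hm] := ccont_min cL cg g0.
have [d d0 hd] := ccont_unif cL cg m0.
have [B B0 hB] := ccont_bound cL (@ccont_id _ L).
pose e := d / 4; have e0 : 0 < e by rewrite divr_gt0.
have bL x1 x2 y1 y2 u : box L x1 x2 y1 y2 u -> L u by case.
have ne (n : nat) : n.+2%:R * e = n.+1%:R * e + e by rewrite -natr1 mulrDl mul1r.
have cell x y : HasSqrt (box L x (x + e) y (y + e)) g.
  have [[u0 [Lu0 h1 h2]]|no] := pselect (exists u, box L x (x + e) y (y + e) u); last first.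
    by exists g => [u b|u b]; exfalso; apply: no; exists u.
  have [sg esg] := sqrt_exists (g u0).
  have sl u : box L x (x + e) y (y + e) u -> slit (g u / g u0).
    move=> [Lu h3 h4]; apply: slit_Re.
    have n0 : 0 < nm (g u0) by rewrite nm_gt0 g0.
    have h : nm (g u - g u0) < m.
      apply: hd => //; apply: (le_lt_trans (nm_le_ReIm _)); rewrite cReB cImB.
      have : `|Re u - Re u0| <= e by rewrite ler_norml; linarith.
      have : `|Im u - Im u0| <= e by rewrite ler_norml; linarith.
      by rewrite /e; linarith.
    have -> : g u / g u0 = 1 + (g u - g u0) / g u0 by field; exact: g0.
    have : nm ((g u - g u0) / g u0) < 1.
      by rewrite nmf ltr_pdivrMr // mul1r; apply: lt_le_trans h _; exact: hm.
    by rewrite cReD /=; have := Re_bound ((g u - g u0) / g u0); linarith.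
  exists (fun u => sg * psqrt (g u / g u0)) => [|u b].
    apply: ccontM; first exact: ccont_cst.
    apply: ccont_psqrt => //; apply: ccontM; last exact: ccont_cst.
    exact: (ccont_sub (bL _ _ _ _) cg).
  by rewrite exprMn psqrt_sqr ?sl // esg mulrC divfK // g0.
have row x y n : HasSqrt (box L x (x + n.+1%:R * e) y (y + e)) g.
  elim: n => [|n IH]; first by rewrite mul1r; exact: cell.
  apply: (@glue_halves _ _ _ 1 (x + n.+1%:R * e)).
  - exact: ccompact_box.
  - exact: nm1.
  - exact: (ccont_sub (bL _ _ _ _) cg).
  - by move=> u /bL; exact: g0.
  - apply: HasSqrt_sub IH => u [[Lu h1 h2]]; rewrite mul1r => h3; split=> //.
    by case/andP: h1 => -> _ /=.
  - apply: HasSqrt_sub (cell (x + n.+1%:R * e) y) => u [[Lu h1 h2]]; rewrite mul1r => h3.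
    by split=> //; move: h1; rewrite ne addrA h3 => /andP[].
  move=> r a b [La ha1 ha2] [Lb hb1 hb2]; rewrite !mul1r => ea eb er hr nb.
  apply: HasSqrt_sub (gap r _) => [u /bL //|Lr]; apply: nb; split=> //.
    by rewrite er -ea.
  by linarith.
have col n k : HasSqrt (box L (- B) (- B + k.+1%:R * e) (- B) (- B + n.+1%:R * e)) g.
  elim: n => [|n IH]; first by rewrite mul1r; exact: row.
  have rE u : Re (- 'i%C * u) = Im u :> R by rewrite cReM /=; ring.
  have iE u : Im (- 'i%C * u) = - Re u :> R by rewrite cImM /=; ring.
  apply: (@glue_halves _ _ _ (- 'i%C) (- B + n.+1%:R * e)).
  - exact: ccompact_box.
  - by rewrite nmN /= expr0n expr1n add0r sqrtr1.
  - exact: (ccont_sub (bL _ _ _ _) cg).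
  - by move=> u /bL; exact: g0.
  - apply: HasSqrt_sub IH => u [[Lu h1 h2]]; rewrite rE => h3; split=> //.
    by case/andP: h2 => -> _ /=.
  - apply: HasSqrt_sub (row (- B) (- B + n.+1%:R * e) k) => u [[Lu h1 h2]]; rewrite rE => h3.
    by split=> //; move: h2; rewrite ne addrA h3 => /andP[].
  move=> r a b [La ha1 ha2] [Lb hb1 hb2]; rewrite !rE !iE => ea eb er hr nb.
  apply: HasSqrt_sub (gap r _) => [u /bL //|Lr]; apply: nb; split=> //.
    by linarith.
  by rewrite er -ea.
pose n := Num.bound (2 * B / e).
have hn : 2 * B < n%:R * e.
  by rewrite -ltr_pdivrMr //; apply: archi_boundP; rewrite divr_ge0 ?(ltW e0) //; linarith.
apply: HasSqrt_sub (col n n) => u Lu; have hu := hB _ Lu.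
have := Re_bound u; have := Im_bound u; rewrite -natr1 mulrDl mul1r => h1 h2.
by split=> //; linarith.
Qed.

(* Otherwise the set of bad points r is a bounded open set with boundary in L,
   on which f, constant on L, would have an interior extremum. *)
Lemma no_gaps_of_no_extremum L (f : R[i] -> R) (t : R) :
  let D u := nm u <= 1 in ccompact D ->
  (forall u, L u -> D u /\ f u = t) -> ccompact L ->
  ccont D (fun u => (f u)%:C%C) ->
  (forall u0 d, 0 < d -> (forall u, nm (u - u0) < d -> D u) ->
     ~ (forall u, nm (u - u0) < d -> f u <= f u0) /\
     ~ (forall u, nm (u - u0) < d -> f u0 <= f u)) ->
  forall r, ~ L r -> HasSqrt L (fun u => u - r).
Proof.
move=> D cD LD cL cf noext.
pose bad r := ~ L r /\ ~ HasSqrt L (fun u => u - r).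
have seg a b : (forall s : R, 0 <= s <= 1 -> ~ L (a + s%:C%C * (b - a))) ->
    HasSqrt L (fun u => u - a) -> HasSqrt L (fun u => u - b).
  move=> ms [s cs es].
  have sl u : L u -> slit ((b - u) / (a - u)).
    by move=> Lu; apply: slit_segment => t' ht; apply/eqP => e; apply: (ms t') => //; rewrite e.
  have na u : L u -> a - u != 0.
    move=> Lu; rewrite subr_eq0; apply/eqP => e; apply: (ms 0); rewrite ?lexx ?ler01 //.
    by rewrite rmorph0 mul0r addr0 e.
  exists (fun u => s u * psqrt ((b - u) / (a - u))) => [|u Lu].
    apply: ccontM => //; apply: ccont_psqrt => //; apply: ccontM.
      by apply: ccontB; [exact: ccont_cst|exact: ccont_id].
    by apply: ccontV => //; apply: ccontB; [exact: ccont_cst|exact: ccont_id].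
  rewrite exprMn es // psqrt_sqr ?sl //; field; exact: na.
(* For [r] outside the disc, [conjc r * (r - u)] has positive real part on the disc, and the
   principal root serves. *)
have badD r : bad r -> D r.
  move=> [_ ns]; rewrite /D leNgt; apply/negP => h; apply: ns.
  have r0 : conjc r != 0 by rewrite -nm_gt0 nmJ; linarith.
  have [k ek] := sqrt_exists (- (conjc r)^-1).
  have sl u : L u -> slit (conjc r * (r - u)).
    move=> /LD[hu _]; apply: slit_Re; rewrite mulrBr conjcMl cReB /=.
    have := Re_bound (conjc r * u); rewrite nmM nmJ.
    have : nm r * nm u <= nm r * 1 by rewrite ler_wpM2l ?nm_ge0.
    by rewrite expr2; nra.
  exists (fun u => k * psqrt (conjc r * (r - u))) => [|u Lu].
    apply: ccontM; first exact: ccont_cst.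
    apply: ccont_psqrt => //; apply: ccontM; first exact: ccont_cst.
    by apply: ccontB; [exact: ccont_cst|exact: ccont_id].
  by rewrite exprMn psqrt_sqr ?sl // ek; field.
move=> r nLr; apply: contrapT => nsr.
have badr : bad r by [].
pose Cl u := D u /\ forall e : R, 0 < e -> exists2 v, bad v & nm (v - u) < e.
have ClB v : bad v -> Cl v.
  by move=> bv; split=> [|e e0]; [exact: badD|exists v; rewrite ?subrr ?nm0].
have cCl : ccompact Cl.
  apply: (ccompact_closed cD) => [u []//|u0 Du0 nC].
  have [e [e0 he]] : exists e : R, 0 < e /\ forall v, bad v -> e <= nm (v - u0).
    apply: contrapT => no; apply: nC; split=> // e e0; apply: contrapT => nv.
    apply: no; exists e; split=> // v bv; rewrite leNgt; apply/negP => h.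
    by apply: nv; exists v.
  exists (e / 2) => [|u [Du /(_ (e / 2))[|v bv hv]]]; rewrite ?divr_gt0 //.
  by have := he _ bv; have := nm_tri u v u0; linarith.
have away u : ~ L u -> exists2 d, 0 < d & forall v, nm (v - u) < d -> ~ L v.
  move=> nL; have [||d d0 hd] := ccont_min cL (f := fun v => v - u).
  - by apply: ccontB; [exact: ccont_id|exact: ccont_cst].
  - by move=> v Lv; rewrite subr_eq0; apply/eqP => e; apply: nL; rewrite -e.
  by exists d => // v hv /hd; rewrite leNgt hv.
(* A limit of bad points outside [L] has a ball free of [L], in which [seg] moves the pole; so the
   boundary of the bad set lies in [L]. *)
have ball u : Cl u -> ~ L u -> exists2 d, 0 < d & forall v, nm (v - u) < d -> bad v.
  move=> [_ hC] /away[d d0 hd]; have [v0 [nL0 ns0] h0] := hC _ d0.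
  exists d => // v hv; split; first exact: hd.
  move=> hs; apply: ns0; apply: seg hs => s /andP[s0' s1]; apply: hd.
  have -> : v + s%:C%C * (v0 - v) - u = (1 - s)%:C%C * (v - u) + s%:C%C * (v0 - u).
    by rewrite rmorphB rmorph1; ring.
  apply: (le_lt_trans (nmD _ _)); rewrite !nmM !nm_real (ger0_norm s0') ger0_norm; last by linarith.
  have [->|ns] := eqVneq s 0; first by rewrite subr0 mul1r mul0r addr0.
  have sp : 0 < s by rewrite lt_neqAle eq_sym ns.
  have : s * nm (v0 - u) < s * d by rewrite ltr_pM2l.
  have : (1 - s) * nm (v - u) <= (1 - s) * d by rewrite ler_wpM2l ?(ltW hv) //; linarith.
  by linarith.
have ne : exists u, Cl u by exists r; exact: ClB.
have cfC : ccont Cl (fun u => (f u)%:C%C) by apply: ccont_sub cf => u [].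
have [u1 C1 m1] := ccont_max cCl cfC ne.
have [|u2 C2 m2] := ccont_max (f := fun u => - f u) cCl _ ne.
  by apply: ccont_eq (ccontN cfC) => u _; rewrite rmorphN.
have f1 : f u1 = t.
  have [/LD[]//|nL] := pselect (L u1); have [d d0 hd] := ball _ C1 nL.
  have [no _] := noext u1 d d0 (fun v hv => badD _ (hd _ hv)).
  by exfalso; apply: no => v hv; apply: m1; apply: ClB; exact: hd.
have f2 : f u2 = t.
  have [/LD[]//|nL] := pselect (L u2); have [d d0 hd] := ball _ C2 nL.
  have [_ no] := noext u2 d d0 (fun v hv => badD _ (hd _ hv)).
  by exfalso; apply: no => v hv; rewrite -lerN2; apply: m2; apply: ClB; exact: hd.
have fC v : Cl v -> f v = t.
  by move=> Cv; apply/eqP; rewrite eq_le -{1}f1 m1 //= -f2 -lerN2 m2.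
have [d d0 hd] := ball _ (ClB _ badr) nLr.
have [no _] := noext r d d0 (fun v hv => badD _ (hd _ hv)).
by apply: no => v hv; rewrite !fC //; [exact: ClB|exact/ClB/hd].
Qed.

End NonvanishingFunctions.

(** * A height function, monotone along the curve *)

Section Clamp.
Variable R : realType.

Definition clamp (x : R) := Num.max 0 (Num.min 1 x).

Lemma clampE x : clamp x = if x <= 0 then 0 else if 1 <= x then 1 else x.
Proof.
rewrite /clamp; have [h|h] := leP x 0.
  by rewrite (min_r (le_trans h ler01)) max_l.
have [h1|h1] := leP 1 x; first by rewrite max_r.
by rewrite max_r // ltW.
Qed.

Lemma clamp_lip x y : `|clamp x - clamp y| <= `|x - y|.
Proof.
by rewrite !clampE; case: (leP x 0) => hx; case: (leP y 0) => hy;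
  case: (leP 1 x) => hx1; case: (leP 1 y) => hy1; rewrite ?subrr ?normr0 //;
  have h1 := ler_norm (x - y); have h2 := ler_normr (y - x) (x - y);
  rewrite ler_norml; have h3 := ler_norm (y - x); rewrite distrC in h3; linarith.
Qed.

Lemma clamp_mono x y : x <= y -> clamp x <= clamp y.
Proof.
by rewrite !clampE => h; case: (leP x 0) => hx; case: (leP y 0) => hy;
  case: (leP 1 x) => hx1; case: (leP 1 y) => hy1 => //; linarith.
Qed.

Lemma int_small (x : R) : x \is a Num.int -> `|x| < 1 -> x = 0.
Proof.
move=> xi h; apply/eqP; apply: contraTT h => n0; rewrite -leNgt.
exact: norm_intr_ge1.
Qed.

Lemma int_eq (x y : R) : x \is a Num.int -> x = y -> y \is a Num.int.
Proof. by move=> h <-. Qed.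

End Clamp.

Section FiniteNet.
Variable R : realType.

Lemma finite_net (S : R[i] -> Prop) (f : R[i] -> R[i]) (rho : R) :
  ccompact S -> ccont S f -> 0 < rho ->
  exists s : seq R[i], (forall v, v \in s -> S v) /\
    forall u, S u -> exists2 v, v \in s & nm (f u - f v) < rho.
Proof.
move=> cS cf rho0; apply: contrapT => no.
pose far (s : seq R[i]) u := S u /\ forall v, v \in s -> rho <= nm (f u - f v).
have ex s : (forall v, v \in s -> S v) -> exists u, far s u.
  move=> hs; apply: contrapT => nf; apply: no; exists s; split=> // u Su.
  apply: contrapT => nv; apply: nf; exists u; split=> // v vs.
  by rewrite leNgt; apply/negP => h; apply: nv; exists v.
pose pick s := xget 0 [set u | far s u].
pose s := fix s n := if n is n'.+1 then pick (s n') :: s n' else [::].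
have sS n v : v \in s n -> S v.
  elim: n v => [//|n IH] v; rewrite inE => /orP[/eqP->|]; last exact: IH.
  by rewrite /pick; case: xgetP => [x -> []//|/(_ _)]; have [u fu] := ex _ IH => /(_ u).
have fp n : far (s n) (pick (s n)).
  by have [u fu] := ex _ (@sS n); rewrite /pick; case: xgetP => [x -> //|/(_ u)].
have sub m n : (m < n)%N -> pick (s m) \in s n.
  elim: n => [//|n IH]; rewrite ltnS leq_eqVlt inE => /orP[/eqP->|/IH->].
    by rewrite eqxx.
  by rewrite orbT.
have sep m n : nm (f (pick (s m)) - f (pick (s n))) < rho -> m = n.
  move=> h; case: (ltngtP m n) => // /sub hs.
    by have [_ /(_ _ hs)] := fp n; rewrite leNgt nmBC h.
  by have [_ /(_ _ hs)] := fp m; rewrite leNgt h.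
(* The sequence of points pairwise [rho] apart cannot accumulate. In the form required by
   [ccompact], [d^-1] bounds the indices of the terms whose image is close to [f u]. *)
have [||d d0 hd] := cS (fun u d => forall n, 0 < d -> d^-1 < n%:R ->
   rho / 4 <= nm (f (pick (s n)) - f u)).
- move=> u d d' le h n d'0 hn; have d0 := lt_le_trans d'0 le.
  by apply: h => //; apply: le_lt_trans hn; rewrite lef_pV2.
- move=> u0 Su0; have rho4 : 0 < rho / 4 by rewrite divr_gt0.
  have [d d0 hd] := cf _ Su0 _ rho4.
  have [[m hm]|nm_] := pselect (exists m, nm (f (pick (s m)) - f u0) < rho / 2).
    exists (Num.min d (m.+1%:R)^-1); first by rewrite lt_min d0 invr_gt0 ltr0n.
    move=> u Su; rewrite lt_min => /andP[hu _] n p0 hn; rewrite leNgt; apply/negP => h.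
    have e : m = n.
      apply: sep; have := nm_tri (f u0) (f (pick (s m))) (f (pick (s n))).
      have := nm_tri (f u) (f (pick (s n))) (f u0); have := hd _ Su hu.
      by rewrite (nmBC (f u0)); linarith.
    move: hn; rewrite -e ltNge => /negP; apply; apply: (@le_trans _ _ m.+1%:R).
      by rewrite ler_nat.
    by rewrite -[leLHS]invrK lef_pV2 ?posrE ?invr_gt0 ?ltr0n // ge_min lexx orbT.
  exists d => // u Su hu n _ _; rewrite leNgt; apply/negP => h; apply: nm_; exists n.
  have := nm_tri (f u) (f (pick (s n))) (f u0); have := hd _ Su hu; linarith.
pose n := Num.bound d^-1.
have hn : d^-1 < n%:R by apply: archi_boundP; rewrite invr_ge0 ltW.
have := hd (pick (s n)) (fp n).1 n d0 hn; rewrite subrr nm0; linarith.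
Qed.

End FiniteNet.

(** * Lifting the position along the curve from the circle to the real line *)

Section MonotoneLift.
Variables (R : realType) (Z T : R[i] -> R[i]) (r : R).
Let D (u : R[i]) := nm u <= 1.
Hypotheses (cD : ccompact D) (cZ : ccont D Z) (r0 : 0 < r).
Hypothesis T1 : forall u, D u -> nm (T u) = 1.
Hypothesis chart : forall u0 u v, D u0 -> D u -> D v ->
  nm (Z u - Z u0) < r -> nm (Z v - Z u0) < r ->
  `|Im (conjc (T u0) * (Z v - Z u))| <= (1 / 10) * `|Re (conjc (T u0) * (Z v - Z u))|.
Hypothesis Tclose : forall u0 u, D u0 -> D u -> nm (Z u - Z u0) < r ->
  nm (T u - T u0) <= 1 / 10.

Let xi v u := Re (conjc (T v) * (Z u - Z v)).
(** The chart coordinate at [v], rescaled to run from 0 to 1. It saturates before the edge of the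
    chart, so the jump to 0 there is by an integer: modulo integers [H v] is continuous on the curve
    and moves in one direction. *)
Let H v u : R := if nm (Z u - Z v) < r then clamp (1 / 2 + 2 / r * xi v u) else 0.
(** The increment of a real lift of [H v] modulo integers between nearby points: the jump at the
    edge of the chart counts as 0. *)
Let dH v u u' : R :=
  if (nm (Z u - Z v) < r) && (nm (Z u' - Z v) < r) then H v u' - H v u else 0.

Lemma xiB v u u' : xi v u' - xi v u = Re (conjc (T v) * (Z u' - Z u)).
Proof. by rewrite /xi -cReB -mulrBr opprB addrA subrK. Qed.

Lemma dH_lip v u u' : D v -> `|dH v u u'| <= 2 / r * nm (Z u' - Z u).
Proof.
move=> Dv; have p : 0 <= 2 / r by rewrite divr_ge0 // ltW.
rewrite /dH; case: ifP => [/andP[h1 h2]|_]; last first.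
  by rewrite normr0 mulr_ge0 ?nm_ge0.
rewrite /H h1 h2; apply: (le_trans (clamp_lip _ _)).
rewrite opprD addrACA subrr add0r -mulrBr normrM ger0_norm // ler_wpM2l //.
by rewrite xiB; apply: (le_trans (Re_le_nm _)); rewrite nmM nmJ T1 // mul1r.
Qed.

(** The curve is flat in the chart, so at distance [r / 2] the modulus of [xi] is at least
    [4 / 10 * r], while [clamp] is saturated from [r / 4] on. *)
Lemma H_saturated v u : D v -> D u -> nm (Z u - Z v) < r -> r / 2 <= nm (Z u - Z v) ->
  H v u \is a Num.int.
Proof.
move=> Dv Du h1 h2; rewrite /H h1.
have h3 := chart Dv Dv Du; rewrite subrr nm0 in h3; have {h3} h := h3 r0 h1.
have h4 := nm_le_ReIm (conjc (T v) * (Z u - Z v)); rewrite nmM nmJ T1 // mul1r in h4.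
have h5 : 4 / 10 * r <= `|xi v u| by rewrite /xi; linarith.
rewrite clampE; have e : 2 / r * (r / 4) = 1 / 2 by field; rewrite gt_eqF.
have p : 0 < 2 / r by rewrite divr_gt0.
have [x0|x0] := leP 0 (xi v u).
  have : 2 / r * (r / 4) <= 2 / r * xi v u.
    by rewrite ler_pM2l //; rewrite ger0_norm // in h5; linarith.
  rewrite e => h6; case: ifP => _; first exact: rpred0.
  by case: ifP => [_|/negbT]; [exact: rpred1|rewrite -ltNge; linarith].
have : 2 / r * xi v u <= 2 / r * (- (r / 4)).
  by rewrite ler_pM2l //; rewrite ltr0_norm // in h5; linarith.
rewrite mulrN e => h6; case: ifP => [_|/negbT]; first exact: rpred0.
by rewrite -ltNge; linarith.
Qed.

(** If only one of the two points is in the chart, it is within [r / 8] of the edge, where [H v] is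
    saturated. *)
Lemma dH_int v u u' : D v -> D u -> D u' -> nm (Z u' - Z u) < r / 8 ->
  H v u' - H v u - dH v u u' \is a Num.int.
Proof.
move=> Dv Du Du' h; rewrite /dH.
have [h1|h1] := ltP (nm (Z u - Z v)) r; have [h2|h2] := ltP (nm (Z u' - Z v)) r => /=.
- by rewrite subrr rpred0.
- rewrite subr0 {1}/H ltNge h2 /= sub0r rpredN; apply: H_saturated => //.
  by have := nm_tri (Z u) (Z u') (Z v); linarith.
- rewrite subr0 {2}/H ltNge h1 /= subr0; apply: H_saturated => //.
  by have := nm_tri (Z u') (Z u) (Z v); rewrite (nmBC (Z u) (Z u')); linarith.
- by rewrite subr0 /H !ltNge h1 h2 /= subrr rpred0.
Qed.

(** The sum of [H v] over a finite net is defined on the curve modulo integers, and it lifts to a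
    real function on [D] because [D] is star-shaped. Over one point of the curve the lifted values
    differ by integers. *)
Lemma monotone_lift : exists th : R[i] -> R,
  [/\ ccont D (fun u => (th u)%:C%C),
      (forall u v, D u -> D v -> Z u = Z v -> th u = th v \/ 1 <= `|th u - th v|) &
      exists2 rho, 0 < rho & forall u0 u, D u0 -> D u -> nm (Z u - Z u0) < rho ->
        `|th u - th u0| < 1 / 2 ->
        (0 < Re (conjc (T u0) * (Z u - Z u0)) -> th u0 < th u) /\
        (Re (conjc (T u0) * (Z u - Z u0)) < 0 -> th u < th u0)].
Proof.
have r8 : 0 < r / 8 by rewrite divr_gt0.
have [net [netD netP]] := finite_net cD cZ r8.
pose Ht u := \sum_(v <- net) H v u.
pose dd u u' := \sum_(v <- net) dH v u u'.
pose n : R := (size net)%:R + 1.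
have n1 : 1 <= n by rewrite /n lerDr ler0n.
have n0 : 0 < n by linarith.
have dd_lip u u' : `|dd u u'| <= n * (2 / r) * nm (Z u' - Z u).
  apply: (@le_trans _ _ (\sum_(v <- net) (2 / r * nm (Z u' - Z u)))).
    apply: (le_trans (ler_norm_sum _ _ _)).
    by rewrite big_seq [leRHS]big_seq; apply: ler_sum => v vn; apply: dH_lip; exact: netD.
  rewrite big_const_seq count_predT iter_addr_0 -[leLHS]mulr_natl -[leRHS]mulrA ler_wpM2r //.
    by rewrite mulr_ge0 ?nm_ge0 // divr_ge0 // ltW.
  by rewrite /n lerDl.
have dd_int u u' : D u -> D u' -> nm (Z u' - Z u) < r / 8 ->
    Ht u' - Ht u - dd u u' \is a Num.int.
  move=> Du Du' h; rewrite /Ht /dd -!sumrB big_seq; apply: rpred_sum => v vn.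
  by apply: dH_int => //; exact: netD.
(* Makes every increment [dd] smaller than 1/4; integrality then turns relations between four
   increments into equalities. *)
pose eta := Num.min (r / 8) (r / (16 * n)).
have eta0 : 0 < eta by rewrite lt_min r8 divr_gt0 // mulr_gt0.
have eta1 : eta <= r / 8 by rewrite ge_min lexx.
have eta2 : eta <= r / (16 * n) by rewrite ge_min lexx orbT.
have dd_small u u' : nm (Z u' - Z u) < eta -> `|dd u u'| < 1 / 4.
  move=> h; apply: (le_lt_trans (dd_lip _ _)).
  apply: (@le_lt_trans _ _ (n * (2 / r) * (r / (16 * n)))).
    apply: ler_wpM2l; last exact: le_trans (ltW h) eta2.
    by rewrite mulr_ge0 ?divr_ge0 ?(ltW n0) ?(ltW r0).
  by rewrite (_ : n * (2 / r) * (r / (16 * n)) = 1 / 8); [linarith|field; rewrite !gt_eqF].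
have [d1 d10 hd1] := ccont_unif cD cZ eta0.
pose N := (Num.bound d1^-1).+1.
have hN : (N%:R)^-1 < d1.
  rewrite -[ltRHS]invrK ltf_pV2 ?posrE ?invr_gt0 ?ltr0n //.
  apply: (lt_le_trans (archi_boundP _)); first by rewrite invr_ge0 ltW.
  by rewrite ler_nat.
have N0 : (N%:R : R) != 0 by rewrite pnatr_eq0.
pose pt (k : nat) (u : R[i]) : R[i] := (k%:R / N%:R)%:C%C * u.
have ptD k u : (k <= N)%N -> D u -> D (pt k u).
  move=> kN Du; rewrite /D /pt nmM nm_real ger0_norm ?divr_ge0 //.
  by rewrite mulr_ile1 ?nm_ge0 ?divr_ge0 // ler_pdivrMr ?ltr0n // mul1r ler_nat.
have ptstep k u : (k < N)%N -> D u -> nm (Z (pt k.+1 u) - Z (pt k u)) < eta.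
  move=> kN Du; apply: hd1; [exact: ptD|by apply: ptD => //; exact: ltnW|].
  rewrite /pt -mulrBl -rmorphB -mulrBl -natr1 addrAC subrr add0r nmM nm_real mul1r.
  by rewrite ger0_norm ?invr_ge0 //; apply: le_lt_trans hN; rewrite ler_piMr ?invr_ge0.
have ptpt k u u' : (k <= N)%N -> D u -> D u' -> nm (u' - u) < d1 ->
    nm (Z (pt k u') - Z (pt k u)) < eta.
  move=> kN Du Du' h; apply: hd1; [exact: ptD|exact: ptD|].
  rewrite /pt -mulrBr nmM nm_real ger0_norm ?divr_ge0 //; apply: le_lt_trans h.
  by rewrite ler_piMl ?nm_ge0 // ler_pdivrMr ?ltr0n // mul1r ler_nat.
(* The increments are added along the radius from 0 to [u]. *)
pose th u := Ht 0 + \sum_(k < N) dd (pt k u) (pt k.+1 u).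
have pt0 u : pt 0%N u = 0 by rewrite /pt mul0r rmorph0 mul0r.
have ptN u : pt N u = u by rewrite /pt mulfV // rmorph1 mul1r.
have th_int u : D u -> th u - Ht u \is a Num.int.
  move=> Du.
  have tel m : (m <= N)%N -> Ht 0 + \sum_(k < m) dd (pt k u) (pt k.+1 u) - Ht (pt m u)
      \is a Num.int.
    elim: m => [_|m IH mN]; first by rewrite big_ord0 addr0 pt0 subrr rpred0.
    rewrite big_ord_recr /=.
    rewrite (_ : _ - _ = (Ht 0 + \sum_(i < m) dd (pt i u) (pt i.+1 u) - Ht (pt m u))
      - (Ht (pt m.+1 u) - Ht (pt m u) - dd (pt m u) (pt m.+1 u))); last by ring.
    apply: rpredB; first by apply: IH; exact: ltnW.
    apply: dd_int; [by apply: ptD => //; exact: ltnW|exact: ptD|].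
    by apply: lt_le_trans eta1; exact: ptstep.
  by have := tel N (leqnn _); rewrite ptN.
have th_dd u u' : D u -> D u' -> nm (u' - u) < d1 -> th u' - th u = dd u u'.
  move=> Du Du' h.
  have tel m : (m <= N)%N -> \sum_(k < m) dd (pt k u') (pt k.+1 u') -
      \sum_(k < m) dd (pt k u) (pt k.+1 u) = dd (pt m u) (pt m u').
    elim: m => [_|m IH mN].
      rewrite !big_ord0 subrr !pt0 /dd big1 // => v _.
      by rewrite /dH subrr; case: ifP.
    rewrite !big_ord_recr /= opprD addrACA IH ?(ltnW mN) //.
    (* The increments around a small quadrilateral between the two radii add up to an integer of
       modulus less than 1. *)
    apply/eqP; rewrite -subr_eq0; apply/eqP; apply: int_small.
      have a1 := dd_int _ _ (ptD _ _ (ltnW mN) Du) (ptD _ _ (ltnW mN) Du')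
         (lt_le_trans (ptpt _ _ _ (ltnW mN) Du Du' h) eta1).
      have a2 := dd_int _ _ (ptD _ _ (ltnW mN) Du') (ptD _ _ mN Du')
         (lt_le_trans (ptstep _ _ mN Du') eta1).
      have a3 := dd_int _ _ (ptD _ _ (ltnW mN) Du) (ptD _ _ mN Du)
         (lt_le_trans (ptstep _ _ mN Du) eta1).
      have a4 := dd_int _ _ (ptD _ _ mN Du) (ptD _ _ mN Du')
         (lt_le_trans (ptpt _ _ _ mN Du Du' h) eta1).
      by apply: (int_eq (rpredB (rpredD a3 a4) (rpredD a1 a2))); ring.
    have b1 := dd_small _ _ (ptpt _ _ _ (ltnW mN) Du Du' h).
    have b2 := dd_small _ _ (ptstep _ _ mN Du').
    have b3 := dd_small _ _ (ptstep _ _ mN Du).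
    have b4 := dd_small _ _ (ptpt _ _ _ mN Du Du' h).
    by move: b1 b2 b3 b4; rewrite !ltr_norml; linarith.
  by rewrite /th opprD addrACA subrr add0r tel // !ptN.
exists th; split.
- move=> u0 Du0 e e0.
  have c0 : 0 < n * (2 / r) by rewrite mulr_gt0 // divr_gt0.
  have [d d0 hd] := cZ Du0 (divr_gt0 e0 c0).
  exists (Num.min d d1); first by rewrite lt_min d0.
  move=> u Du; rewrite lt_min => /andP[h1 h2]; rewrite -rmorphB nm_real th_dd //.
  apply: (le_lt_trans (dd_lip _ _)); rewrite mulrC -ltr_pdivlMr //; exact: hd.
- move=> u v Du Dv e.
  have eH : Ht u = Ht v by apply: eq_bigr => w _; rewrite /H /xi e.
  have i1 : th u - th v \is a Num.int.
    by apply: (int_eq (rpredB (th_int _ Du) (th_int _ Dv))); rewrite eH; ring.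
  have [h|h] := ltP (`|th u - th v|) 1; last by right.
  by left; apply/eqP; rewrite -subr_eq0; apply/eqP; exact: int_small.
exists eta => // u0 u Du0 Du h hth.
have e : th u - th u0 = dd u0 u.
  apply/eqP; rewrite -subr_eq0; apply/eqP; apply: int_small.
    apply: (int_eq (rpredD (rpredB (th_int _ Du) (th_int _ Du0))
      (dd_int _ _ Du0 Du (lt_le_trans h eta1)))).
    by ring.
  by have := dd_small _ _ h; move: hth; rewrite !ltr_norml; linarith.
set x := Re (conjc (T u0) * (Z u - Z u0)).
have hr : nm (Z u - Z u0) < r by linarith.
(* [T] turns by at most 1/10 within a chart, so in every chart around [Z u0] the coordinate moves
   with the sign of [x] and at least half as fast. *)
have hT v : D v -> nm (Z u0 - Z v) < r ->
    (0 < x -> 1 / 2 * x <= xi v u - xi v u0) /\ (x < 0 -> xi v u - xi v u0 <= 1 / 2 * x).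
  move=> Dv hv; rewrite xiB.
  have -> : conjc (T v) * (Z u - Z u0) = conjc (T u0) * (Z u - Z u0)
     - conjc (T u0 - T v) * (Z u - Z u0) by rewrite rmorphB; ring.
  rewrite cReB -/x; have := Re_bound (conjc (T u0 - T v) * (Z u - Z u0)).
  rewrite nmM nmJ; have := Tclose Dv Du0 hv.
  have := chart Du0 Du0 Du; rewrite subrr nm0 => /(_ r0 hr).
  have := nm_le_ReIm (conjc (T u0) * (Z u - Z u0)); rewrite nmM nmJ T1 // mul1r -/x.
  move=> k1 k2 k3.
  have : nm (T u0 - T v) * nm (Z u - Z u0) <= 1 / 10 * (11 / 10 * `|x|).
    by rewrite ler_pM ?nm_ge0 //; linarith.
  by move=> k4 k5; split=> hx; [rewrite gtr0_norm // in k4|rewrite ltr0_norm // in k4]; linarith.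
have p : 0 < 2 / r by rewrite divr_gt0.
(* The chart of a net point this close is not saturated at [u0] or [u], which makes the inequality
   strict; all other charts contribute with the right weak sign. *)
have [v0 v0n hv0] := netP _ Du0.
have Dv0 := netD _ v0n.
have b0 : nm (Z u0 - Z v0) < r by linarith.
have b1 : nm (Z u - Z v0) < r / 4 by have := nm_tri (Z u0) (Z u) (Z v0); linarith.
have b2 : nm (Z u - Z v0) < r by linarith.
have unsat w : nm (Z w - Z v0) < r / 4 -> H v0 w = 1 / 2 + 2 / r * xi v0 w.
  move=> hw; rewrite /H (_ : nm _ < r); last by linarith.
  have := Re_bound (conjc (T v0) * (Z w - Z v0)); rewrite nmM nmJ T1 // mul1r -/(xi v0 w) => k.
  have e4 : 2 / r * (r / 4) = 1 / 2 by field; rewrite gt_eqF.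
  have k1 : 2 / r * xi v0 w < 2 / r * (r / 4) by rewrite ltr_pM2l //; linarith.
  have k2 : 2 / r * (- (r / 4)) < 2 / r * xi v0 w by rewrite ltr_pM2l //; linarith.
  rewrite clampE mulrN e4 in k1 k2 *.
  by case: leP => ?; [linarith|case: leP => ? //; linarith].
have key : dH v0 u0 u = 2 / r * (xi v0 u - xi v0 u0).
  by rewrite /dH b0 b2 /= !unsat //; [ring|linarith].
have sgn v : v \in net -> (0 < x -> 0 <= dH v u0 u) /\ (x < 0 -> dH v u0 u <= 0).
  move=> /netD Dv; rewrite /dH; case: ifP => [/andP[h1 h2]|_]; last by rewrite lexx.
  have [s1 s2] := hT _ Dv h1; rewrite /H h1 h2; split=> hx.
    rewrite subr_ge0; apply: clamp_mono; rewrite lerD2l ler_pM2l //.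
    by have := s1 hx; linarith.
  rewrite subr_le0; apply: clamp_mono; rewrite lerD2l ler_pM2l //.
  by have := s2 hx; linarith.
have [s1 s2] := hT _ Dv0 b0.
have split_sum : dd u0 u = dH v0 u0 u + \sum_(v <- rem v0 net) dH v u0 u.
  by rewrite /dd (perm_big _ (perm_to_rem v0n)) big_cons.
split=> hx; [rewrite -subr_gt0|rewrite -subr_lt0]; rewrite e split_sum key.
  have : 0 <= \sum_(v <- rem v0 net) dH v u0 u.
    by rewrite big_seq; apply: sumr_ge0 => v /mem_rem vn; exact: (sgn _ vn).1.
  have : 0 < 2 / r * (xi v0 u - xi v0 u0) by rewrite mulr_gt0 //; have := s1 hx; linarith.
  by linarith.
have : \sum_(v <- rem v0 net) dH v u0 u <= 0.
  by rewrite big_seq; apply: sumr_le0 => v /mem_rem vn; exact: (sgn _ vn).2.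
have : 2 / r * (xi v0 u - xi v0 u0) < 0 by rewrite pmulr_rlt0 //; have := s2 hx; linarith.
by linarith.
Qed.

End MonotoneLift.

(** * Moving poles through the curve *)

Section Unzip.
Variables (R : realType) (Z W T : R[i] -> R[i]) (th : R[i] -> R) (r rho : R).
Let D (u : R[i]) := nm u <= 1.
Hypotheses (cD : ccompact D) (cZ : ccont D Z) (cW : ccont D W) (cT : ccont D T).
Hypotheses (r0 : 0 < r) (rho0 : 0 < rho).
Hypothesis T1 : forall u, D u -> nm (T u) = 1.
Hypothesis chart : forall u0 u v, D u0 -> D u -> D v ->
  nm (Z u - Z u0) < r -> nm (Z v - Z u0) < r ->
  `|Im (conjc (T u0) * (Z v - Z u))| <= (1 / 10) * `|Re (conjc (T u0) * (Z v - Z u))|.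
Hypothesis cth : ccont D (fun u => (th u)%:C%C).
Hypothesis th_fibre : forall u v, D u -> D v -> Z u = Z v ->
  th u = th v \/ 1 <= `|th u - th v|.
Hypothesis th_mono : forall u0 u, D u0 -> D u -> nm (Z u - Z u0) < rho ->
  `|th u - th u0| < 1 / 2 -> 0 < Re (conjc (T u0) * (Z u - Z u0)) -> th u0 < th u.
Hypothesis fibre_idem : forall u0, D u0 ->
  exists2 E, Ap Z W (fun u => D u /\ Z u = Z u0) E &
    forall u, D u -> Z u = Z u0 -> (th u0 <= th u -> E u = 1) /\ (th u < th u0 -> E u = 0).

Let fibre_Inv u0 w0 := Inv Z W (fun u => D u /\ Z u = Z u0) (fun u => W u - w0).
Let Ap := Ap Z W D.
Let Inv := Inv Z W D.

(** Near [Z u0] the sign of [Phi] tells the sheets above [c] from the others. Farther out the sheets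
    are not distinguished, and [Phi] only has to be dominated by [Z - Z u0]. *)
Definition sheet_sign (u0 : R[i]) (c : R) (Phi : R[i] -> R[i]) (k p : R) :=
  [/\ 0 < k, 0 < p <= r, k <= p / 12, Ap Phi &
    forall u, D u ->
      (nm (Z u - Z u0) < p -> (c < th u -> nm (Phi u - k%:C%C) <= k / 5) /\
                              (th u <= c -> nm (Phi u + k%:C%C) <= k / 5)) /\
      (p <= nm (Z u - Z u0) -> nm (Phi u) <= p / 10)].

(* Its zeros would lie near Z u0, about k to the left of the sheets with th > c and
   to the right of the other sheets. *)
Definition sheared (u0 : R[i]) (Phi : R[i] -> R[i]) u :=
  conjc (T u0) * (Z u - Z u0) - 'i%C * Phi u.

Definition unzips u0 c := exists Phi k p, sheet_sign u0 c Phi k p /\ Inv (sheared u0 Phi).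

Lemma disc0 : D 0. Proof. by rewrite /D nm0 ler01. Qed.

Lemma nm_xi u0 u : D u0 -> nm (conjc (T u0) * (Z u - Z u0)) = nm (Z u - Z u0).
Proof. by move=> Du0; rewrite nmM nmJ T1 // mul1r. Qed.

Lemma chart0 u0 u : D u0 -> D u -> nm (Z u - Z u0) < r ->
  `|Im (conjc (T u0) * (Z u - Z u0))| <= (1 / 10) * `|Re (conjc (T u0) * (Z u - Z u0))|.
Proof. by move=> Du0 Du; apply: chart; rewrite ?subrr ?nm0. Qed.

Lemma Ap_sheared u0 Phi : Ap Phi -> Ap (sheared u0 Phi).
Proof.
move=> h; apply: ApB; apply: (ApM cD cZ cW); try exact: Ap_cst; last exact: h.
by apply: ApB; [exact: Ap_Z|exact: Ap_cst].
Qed.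

Lemma ReIm_i (x : R[i]) : Re ('i%C * x) = - Im x /\ Im ('i%C * x) = Re x.
Proof. by rewrite cReM cImM /=; split; ring. Qed.

(** Near [Z u0] the curve has slope at most 1/10 and ['i * Phi] is almost ['i * k] or its opposite:
    where the real parts could cancel, the imaginary parts stay apart. Farther out [Phi] is at most
    a tenth of the first term. *)
Lemma sheet_sign_lower u0 c Phi k p u : D u0 -> D u -> sheet_sign u0 c Phi k p ->
  k / 2 <= nm (sheared u0 Phi u).
Proof.
move=> Du0 Du [k0 /andP[p0 pr] kp _ /(_ _ Du)[hn hf]].
rewrite /sheared; have [far|near] := leP p (nm (Z u - Z u0)).
  have := hf far; have := nm_lowB (conjc (T u0) * (Z u - Z u0)) ('i%C * Phi u).
  by rewrite nm_xi // nmM nm_i mul1r; lra.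
have := chart0 Du0 Du (lt_le_trans near pr).
move: (conjc (T u0) * (Z u - Z u0)) => xi hxi; have [h1 h2] := hn near.
have [hR hI] := ReIm_i (Phi u).
have := Re_bound (xi - 'i%C * Phi u); have := Im_bound (xi - 'i%C * Phi u).
rewrite cReB cImB hR hI => b1 b2; rewrite leNgt; apply/negP => lt.
have hx : `|Re xi| <= k.
  have [c1|c1] := ltP c (th u).
    have := Im_bound (Phi u - k%:C%C); rewrite cImB /=; have := h1 c1.
    by rewrite ler_norml; lra.
  have := Im_bound (Phi u + k%:C%C); rewrite cImD /=; have := h2 c1.
  by rewrite ler_norml; lra.
have hy : `|Im xi| <= k / 10 by lra.
move: hy; rewrite ler_norml => /andP[hy1 hy2].
have [c1|c1] := ltP c (th u).
  by have := Re_bound (Phi u - k%:C%C); rewrite cReB /=; have := h1 c1; lra.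
by have := Re_bound (Phi u + k%:C%C); rewrite cReD /=; have := h2 c1; lra.
Qed.

Lemma sheet_sign_neq0 u0 c Phi k p u : D u0 -> D u -> sheet_sign u0 c Phi k p -> sheared u0 Phi u != 0.
Proof.
move=> Du0 Du g; have := sheet_sign_lower Du0 Du g; case: g => k0 _ _ _ _ h.
by rewrite -nm_gt0; lra.
Qed.

Lemma nm_convex (a b x : R[i]) (e s : R) : 0 <= s <= 1 -> nm (a - x) <= e ->
  nm (b - x) <= e -> nm (a + s%:C%C * (b - a) - x) <= e.
Proof.
move=> /andP[s0 s1] ha hb.
have -> : a + s%:C%C * (b - a) - x = (1 - s)%:C%C * (a - x) + s%:C%C * (b - x).
  by rewrite rmorphB rmorph1; ring.
apply: (le_trans (nmD _ _)); rewrite !nmM !nm_real !ger0_norm //; last by lra.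
have : (1 - s) * nm (a - x) <= (1 - s) * e by rewrite ler_wpM2l //; lra.
have : s * nm (b - x) <= s * e by rewrite ler_wpM2l.
by lra.
Qed.

(** For fixed [k] and [p] the condition [sheet_sign] is convex in [Phi], so [oka] applies to the
    segment. *)
Lemma unzips_interp u0 c Phi Psi k p : D u0 -> sheet_sign u0 c Phi k p -> sheet_sign u0 c Psi k p ->
  Inv (sheared u0 Phi) -> Inv (sheared u0 Psi).
Proof.
move=> Du0 g1 g2; have [k0 p0 kp A1 h1] := g1; have [_ _ _ A2 h2] := g2.
apply: (oka cD cZ cW (Ap_sheared _ A1) (Ap_sheared _ A2)) => u s Du hs.
have -> : sheared u0 Phi u + s%:C%C * (sheared u0 Psi u - sheared u0 Phi u) =
   sheared u0 (fun u => Phi u + s%:C%C * (Psi u - Phi u)) u by rewrite /sheared; ring.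
apply: (sheet_sign_neq0 (k := k) (p := p) (c := c)) => //; split=> //.
  by apply: ApD => //; apply: (ApM cD cZ cW); [exact: Ap_cst|exact: ApB].
move=> v Dv; have [n1 f1] := h1 _ Dv; have [n2 f2] := h2 _ Dv; split.
  move=> near; have [n1a n1b] := n1 near; have [n2a n2b] := n2 near.
  split=> hc; first exact: nm_convex (n1a hc) (n2a hc).
  rewrite -[k%:C%C]opprK; apply: nm_convex => //; rewrite opprK; [exact: n1b|exact: n2b].
move=> far; rewrite -[X in nm X]subr0; apply: nm_convex => //; rewrite subr0.
  exact: f1.
exact: f2.
Qed.

(** Between the radii [p'] and [p] the scaled function is at most [6 / 5 * k'], and this has to be
    at most [p' / 10]; hence the constant 12. *)
Lemma sheet_sign_shrink u0 c Phi k p k' p' : sheet_sign u0 c Phi k p -> 0 < k' -> 0 < p' <= p ->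
  k' <= p' / 12 -> k' * p <= k * p' ->
  sheet_sign u0 c (fun u => (k' / k)%:C%C * Phi u) k' p'.
Proof.
move=> [k0 /andP[p0 pr] kp A1 h1] k'0 /andP[p'0 p'p] kp' hk.
have t0 : 0 <= k' / k by rewrite divr_ge0 // ltW.
have sc (x : R[i]) : nm x <= k / 5 -> nm ((k' / k)%:C%C * x) <= k' / 5.
  move=> hx; rewrite nmM nm_real ger0_norm //.
  apply: (le_trans (ler_wpM2l t0 hx)).
  by rewrite (_ : k' / k * (k / 5) = k' / 5) //; field; rewrite gt_eqF.
have ek : k'%:C%C = (k' / k)%:C%C * k%:C%C :> R[i] by rewrite -rmorphM divfK // gt_eqF.
split=> //; first by rewrite p'0 (le_trans p'p).
  by apply: (ApM cD cZ cW) => //; exact: Ap_cst.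
move=> u Du; have [n1 f1] := h1 _ Du; split=> [near|far].
  have [a b] := n1 (lt_le_trans near p'p); split=> hc.
    by rewrite ek -mulrBr; apply: sc; exact: a.
  by rewrite ek -mulrDr; apply: sc; exact: b.
rewrite nmM nm_real ger0_norm //.
have [far2|near] := leP p (nm (Z u - Z u0)).
  apply: (le_trans (ler_wpM2l t0 (f1 far2))).
  have : k' / k * p <= p' by rewrite mulrAC ler_pdivrMr // mulrC [leRHS]mulrC mulrC.
  by lra.
have hP : nm (Phi u) <= k * (6 / 5).
  have [a b] := n1 near; have [hc|hc] := ltP c (th u).
    by have := a hc; have := nmD (Phi u - k%:C%C) k%:C%C; rewrite subrK nm_real gtr0_norm //; lra.
  by have := b hc; have := nmB (Phi u + k%:C%C) k%:C%C; rewrite addrK nm_real gtr0_norm //; lra.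
apply: (le_trans (ler_wpM2l t0 hP)); rewrite mulrA divfK ?gt_eqF //; lra.
Qed.

Lemma sheet_sign_scale u0 c Phi k p (t : R) : sheet_sign u0 c Phi k p -> 0 < t <= 1 ->
  sheet_sign u0 c (fun u => t%:C%C * Phi u) (t * k) p.
Proof.
move=> g /andP[t0 t1]; have [k0 /andP[p0 pr] kp A1 h1] := g.
have tk : t * k <= k by rewrite ger_pMl.
have := @sheet_sign_shrink _ _ _ _ _ (t * k) p g; rewrite mulfK ?gt_eqF //; apply.
- by rewrite mulr_gt0.
- by rewrite p0 lexx.
- by lra.
- by rewrite ler_wpM2r // ltW.
Qed.

Lemma unzips_scale u0 c Phi k p (t : R) : D u0 -> sheet_sign u0 c Phi k p -> 0 < t <= 1 ->
  Inv (sheared u0 Phi) <-> Inv (sheared u0 (fun u => t%:C%C * Phi u)).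
Proof.
move=> Du0 g /andP[t0 t1]; have [k0 _ _ A1 h1] := g.
have At (t' : R) : Ap (sheared u0 (fun u => t'%:C%C * Phi u)).
  by apply: Ap_sheared; apply: (ApM cD cZ cW) => //; exact: Ap_cst.
have nz (t' : R) u : D u -> 0 < t' <= 1 -> sheared u0 (fun u => t'%:C%C * Phi u) u != 0.
  by move=> Du ht'; apply: sheet_sign_neq0 Du0 Du (sheet_sign_scale g ht').
split.
  apply: (oka cD cZ cW (Ap_sheared _ A1) (At t)) => u s Du /andP[s0 s1].
  have -> : sheared u0 Phi u + s%:C%C * (sheared u0 (fun u => t%:C%C * Phi u) u - sheared u0 Phi u) =
     sheared u0 (fun u => (1 + s * (t - 1))%:C%C * Phi u) u.
    by rewrite /sheared rmorphD rmorphM rmorphB !rmorph1; ring.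
  apply: nz => //; have : s * (t - 1) <= 0 by rewrite mulr_ge0_le0 //; lra.
  have : 1 * (t - 1) <= s * (t - 1) by rewrite ler_wnM2r //; lra.
  by lra.
apply: (oka cD cZ cW (At t) (Ap_sheared _ A1)) => u s Du /andP[s0 s1].
have -> : sheared u0 (fun u => t%:C%C * Phi u) u + s%:C%C *
   (sheared u0 Phi u - sheared u0 (fun u => t%:C%C * Phi u) u) =
   sheared u0 (fun u => (t + s * (1 - t))%:C%C * Phi u) u.
  by rewrite /sheared rmorphD rmorphM rmorphB !rmorph1; ring.
apply: nz => //; have : 0 <= s * (1 - t) by rewrite mulr_ge0 //; lra.
have : s * (1 - t) <= 1 * (1 - t) by rewrite ler_wpM2r //; lra.
by lra.
Qed.

(** Both functions are scaled to a common [j] on a common radius [q] and then joined by a segment,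
    so [unzips] does not depend on its witnesses. *)
Lemma unzips_all u0 c Phi k p Psi k' p' : D u0 -> sheet_sign u0 c Phi k p -> sheet_sign u0 c Psi k' p' ->
  Inv (sheared u0 Phi) -> Inv (sheared u0 Psi).
Proof.
move=> Du0 g g'; have [k0 /andP[p0 pr] kp _ _] := g.
have [k'0 /andP[p'0 p'r] kp' _ _] := g'.
pose q := Num.min p p'.
have q0 : 0 < q by rewrite lt_min p0.
have qp : q <= p by rewrite ge_min lexx.
have qp' : q <= p' by rewrite ge_min lexx orbT.
pose j := Num.min (q / 12) (Num.min (k * q / p) (k' * q / p')).
have j0 : 0 < j by rewrite !lt_min !divr_gt0 ?mulr_gt0.
have j1 : j <= q / 12 by rewrite ge_min lexx.
have j2 : j * p <= k * q by rewrite -ler_pdivlMr // !ge_min lexx orbT.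
have j3 : j * p' <= k' * q by rewrite -ler_pdivlMr // !ge_min lexx !orbT.
have tk : 0 < j / k <= 1.
  rewrite divr_gt0 //= ler_pdivrMr // mul1r -(ler_pM2r p0); apply: (le_trans j2).
  by rewrite ler_pM2l.
have tk' : 0 < j / k' <= 1.
  rewrite divr_gt0 //= ler_pdivrMr // mul1r -(ler_pM2r p'0); apply: (le_trans j3).
  by rewrite ler_pM2l.
move=> /(unzips_scale Du0 g tk) i; apply/(unzips_scale Du0 g' tk').
have hq : 0 < q <= p by rewrite q0.
have hq' : 0 < q <= p' by rewrite q0.
exact: unzips_interp Du0 (sheet_sign_shrink g j0 hq j1 j2) (sheet_sign_shrink g' j0 hq' j1 j3) i.
Qed.

(** After halving [Phi] both sheared functions have modulus at least [k / 4], twice the bound on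
    their difference, so [Inv_near] moves the base point while [Phi] stays the same. *)
Lemma unzips_move u0 c Phi k p u1 c1 : D u0 -> D u1 -> sheet_sign u0 c Phi k p ->
  nm (Z u1 - Z u0) < p / 2 ->
  (forall u, D u -> nm (Z u - Z u0) < p -> (c < th u) = (c1 < th u)) ->
  (forall u, D u -> nm (T u1 - T u0) * nm (Z u - Z u1) + nm (Z u1 - Z u0) <= k / 8) ->
  unzips u0 c <-> unzips u1 c1.
Proof.
move=> Du0 Du1 g hp sep sm.
have half : 0 < 1 / 2 :> R by lra.
have h12 : 0 < (1 / 2 : R) <= 1 by rewrite half; lra.
have g0 := sheet_sign_scale g h12; have [k0 /andP[p0 pr] kp A1 h1] := g.
pose Psi u := (1 / 2)%:C%C * Phi u.
have gN : sheet_sign u1 c1 Psi (1 / 2 * k) (p / 2).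
  have [k0' _ _ A0 h0] := g0; split=> //; [lra|lra|].
  move=> u Du; have [n1 f1] := h0 _ Du; split=> [near|far].
    have nu : nm (Z u - Z u0) < p by have := nm_tri (Z u1) (Z u) (Z u0); lra.
    have [a b] := n1 nu; split=> hc; first by apply: a; rewrite sep.
    by apply: b; rewrite leNgt sep // -leNgt.
  have [far2|nu] := leP p (nm (Z u - Z u0)).
    have [_ f2] := h1 _ Du; have := f2 far2; rewrite /Psi nmM nm_real ger0_norm; last by lra.
    lra.
  have [a b] := n1 nu; have [hc|hc] := ltP c (th u).
    have := a hc; have := nmD (Psi u - (1 / 2 * k)%:C%C) (1 / 2 * k)%:C%C.
    by rewrite subrK nm_real gtr0_norm // /Psi; lra.
  have := b hc; have := nmB (Psi u + (1 / 2 * k)%:C%C) (1 / 2 * k)%:C%C.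
  by rewrite addrK nm_real gtr0_norm // /Psi; lra.
have dif u : D u -> nm (sheared u1 Psi u - sheared u0 Psi u) <= k / 8.
  move=> Du; have -> : sheared u1 Psi u - sheared u0 Psi u =
      conjc (T u1 - T u0) * (Z u - Z u1) - conjc (T u0) * (Z u1 - Z u0).
    by rewrite /sheared rmorphB; ring.
  by apply: (le_trans (nmB _ _)); rewrite !nmM !nmJ T1 // mul1r; exact: sm.
have AF v : Ap (sheared v Psi) by apply: Ap_sheared; case: gN.
have eqv : Inv (sheared u0 Psi) <-> Inv (sheared u1 Psi).
  split=> i; apply: (Inv_near cD cZ cW (AF _) (AF _) i) => u Du; have := dif _ Du.
    by have := sheet_sign_lower Du0 Du g0; rewrite -/Psi; lra.
  by have := sheet_sign_lower Du1 Du gN; rewrite (nmBC (sheared u0 Psi u)); lra.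
split=> [[Phi' [k' [p' [g' i']]]]|[Phi' [k' [p' [g' i']]]]].
  by exists Psi, (1 / 2 * k), (p / 2); split=> //; apply/eqv; exact: unzips_all g' g0 i'.
exists Psi, (1 / 2 * k), p; split=> //; apply/eqv; exact: unzips_all g' gN i'.
Qed.

(** [D] is convex, so a locally constant property is constant. The height [c] may vary as long as
    nearby base points divide the nearby sheets alike. *)
Lemma unzips_const (c : R[i] -> R) :
  (forall u0, D u0 -> exists Phi k p, sheet_sign u0 (c u0) Phi k p) ->
  (forall u0, D u0 -> exists2 d, 0 < d & forall u1, D u1 -> nm (u1 - u0) < d ->
     forall u, D u -> nm (Z u - Z u0) < d -> (c u0 < th u) = (c u1 < th u)) ->
  forall u v, D u -> D v -> unzips u (c u) -> unzips v (c v).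
Proof.
move=> ex sep; apply: (convex_locally_const (S := D)).
  move=> u v s Du Dv hs; rewrite /D -[X in nm X]subr0; apply: nm_convex => //;
  by rewrite subr0.
move=> u0 Du0; have [Phi [k [p g]]] := ex _ Du0; have [d d0 hd] := sep _ Du0.
have [k0 /andP[p0 pr] kp A1 h1] := g.
pose q := Num.min p d.
have q0 : 0 < q by rewrite lt_min p0.
have qp : q <= p by rewrite ge_min lexx.
have qd : q <= d by rewrite ge_min lexx orbT.
pose j := Num.min (q / 12) (k * q / p).
have j0 : 0 < j by rewrite !lt_min !divr_gt0 ?mulr_gt0.
have j1 : j <= q / 12 by rewrite ge_min lexx.
have j2 : j * p <= k * q by rewrite -ler_pdivlMr // !ge_min lexx orbT.
have hq : 0 < q <= p by rewrite q0.
have g' := sheet_sign_shrink g j0 hq j1 j2.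
have [B B0 hB] := ccont_bound cD cZ.
have e1 : 0 < Num.min (q / 2) (j / 16) by rewrite lt_min !divr_gt0.
have e2 : 0 < j / 16 / (2 * B) by rewrite !divr_gt0 // mulr_gt0.
have [d1 d10 hd1] := cZ Du0 e1; have [d2 d20 hd2] := cT Du0 e2.
exists (Num.min d (Num.min d1 d2)); first by rewrite !lt_min d0 d10.
move=> u1 Du1; rewrite !lt_min => /and3P[l0 l1 l2].
have := hd1 _ Du1 l1; rewrite lt_min => /andP[z1 z2]; have t1 := hd2 _ Du1 l2.
apply: (unzips_move Du0 Du1 g' z1) => u Du.
  by move=> hu; apply: hd => //; exact: lt_le_trans qd.
have hz : nm (Z u - Z u1) <= 2 * B.
  by have := nmB (Z u) (Z u1); have := hB _ Du; have := hB _ Du1; lra.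
have : nm (T u1 - T u0) * nm (Z u - Z u1) <= j / 16 / (2 * B) * (2 * B).
  by rewrite ler_pM ?nm_ge0 // ltW.
by rewrite divfK ?gt_eqF ?mulr_gt0 //; lra.
Qed.

(** The points at distance [e] or more from the fibre form a compact set, on which [Z - Z u0] is
    bounded below. *)
Lemma fibre_near u0 (e : R) : D u0 -> 0 < e -> exists2 p, 0 < p & forall u, D u ->
  nm (Z u - Z u0) < p -> exists u', [/\ D u', Z u' = Z u0 & nm (u - u') < e].
Proof.
move=> Du0 e0; pose S u := D u /\ forall u', D u' -> Z u' = Z u0 -> e <= nm (u - u').
have cS : ccompact S.
  apply: (ccompact_closed cD) => [u []//|v Dv nS].
  have [u' [Du' Zu' h]] : exists u', [/\ D u', Z u' = Z u0 & nm (v - u') < e].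
    apply: contrapT => no; apply: nS; split=> // u' Du' Zu'; rewrite leNgt.
    by apply/negP => h; apply: no; exists u'.
  exists (e - nm (v - u')); first by rewrite subr_gt0.
  by move=> u [Du /(_ _ Du' Zu') h2]; have := nm_tri v u u'; lra.
have [||m m0 hm] := ccont_min cS (f := fun u => Z u - Z u0).
- by apply: ccontB; [apply: ccont_sub cZ => u []|exact: ccont_cst].
- move=> u [Du h]; rewrite subr_eq0; apply/eqP => e1.
  by have := h _ Du e1; rewrite subrr nm0; lra.
exists m => // u Du hu; apply: contrapT => no.
suff : S u by move=> /hm; rewrite leNgt hu.
split=> // u' Du' Zu'; rewrite leNgt; apply/negP => h; apply: no; by exists u'.
Qed.

(** Over [Z u0] no height lies strictly between [th u0 - 1] and [th u0]. Uniform continuity with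
    tolerance 1/8 leaves a gap from -7/8 to -1/8 over a neighbourhood, and the sheets are cut in its
    middle. *)
Lemma sheet_polynomial u0 : D u0 -> exists E p, [/\ Ap E, 0 < p <= r, p <= rho &
  forall u, D u -> nm (Z u - Z u0) < p ->
    ~~ (th u0 - 7 / 8 < th u < th u0 - 1 / 8) /\
    (th u0 - 1 / 2 < th u -> nm (E u - 1) <= 1 / 10) /\
    (th u <= th u0 - 1 / 2 -> nm (E u) <= 1 / 10)].
Proof.
move=> Du0; have [E0 A0 h0] := fibre_idem Du0.
have e20 : 0 < 1 / 20 :> R by lra.
have e8 : 0 < 1 / 8 :> R by lra.
have [P hP] := A0 _ e20; pose E u := ev2 P (Z u) (W u).
have [d d0 hd] := ccont_unif cD (ccont_ev cZ cW P) e20.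
have [d' d'0 hd'] := ccont_unif cD cth e8.
have dm : 0 < Num.min d d' by rewrite lt_min d0.
have [p p0 hp] := fibre_near Du0 dm.
exists E, (Num.min p (Num.min r rho)); split.
- exact: Ap_ev.
- by rewrite !lt_min p0 r0 rho0 !ge_min lexx !orbT.
- by rewrite !ge_min lexx !orbT.
move=> u Du; rewrite !lt_min => /andP[/(hp _ Du)[u' [Du' Zu']]].
rewrite lt_min => /andP[l1 l2] _.
have hE := hd _ _ Du Du' l1; have := hd' _ _ Du Du' l2; rewrite -rmorphB nm_real => ht.
have hu' := hP _ (conj Du' Zu'); have [v1 v2] := h0 _ Du' Zu'.
have fib := th_fibre Du' Du0 Zu'.
move: ht; rewrite ltr_norml => /andP[t1 t2].
have fib2 : th u0 <= th u' \/ th u' <= th u0 - 1.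
  case: fib => [->|]; first by left.
  by have [h|h] := leP (th u') (th u0); [rewrite ler0_norm|rewrite gtr0_norm]; lra.
split; first by apply/negP => /andP[]; case: fib2; lra.
have close (x : R[i]) : E0 u' = x -> nm (E u - x) <= 1 / 10.
  move=> <-; have := nm_tri (E u') (E u) (E0 u'); rewrite (nmBC (E u')); rewrite -/(E u') in hu'.
  by rewrite /E in hE hu' *; lra.
split=> h.
  by apply: close; apply: v1; case: fib2 => //; lra.
by rewrite -[E u]subr0; apply: close; apply: v2; case: fib2 => //; lra.
Qed.

Lemma disc_inhabited : exists u, D u.
Proof. by exists 0; exact: disc0. Qed.

Lemma unzips_same u0 c c' : (forall u, D u -> (c < th u) = (c' < th u)) -> unzips u0 c -> unzips u0 c'.
Proof.
move=> e [Phi [k [p [[k0 p0 kp A h] i]]]]; exists Phi, k, p; split=> //; split=> // u Du.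
by have [n f] := h _ Du; split=> // /n; rewrite !leNgt -!e.
Qed.

Lemma sheet_sign_below u0 c k : (forall u, D u -> c < th u) -> 0 < k <= r / 12 ->
  sheet_sign u0 c (fun=> k%:C%C) k r.
Proof.
move=> hc /andP[k0 kr]; split=> //; [by rewrite r0 lexx|exact: Ap_cst|].
move=> u Du; split=> _.
  by rewrite (leNgt _ c) hc //; split=> // _; rewrite subrr nm0; lra.
by rewrite nm_real gtr0_norm //; lra.
Qed.

Lemma sheet_sign_above u0 c k : (forall u, D u -> th u <= c) -> 0 < k <= r / 12 ->
  sheet_sign u0 c (fun=> - k%:C%C) k r.
Proof.
move=> hc /andP[k0 kr]; split=> //; [by rewrite r0 lexx|exact: Ap_cst|].
move=> u Du; split=> _.
  by rewrite (ltNge c) hc //; split=> // _; rewrite addNr nm0; lra.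
by rewrite nmN nm_real gtr0_norm //; lra.
Qed.

Lemma sheet_sign_sheet u0 : D u0 -> exists E k p, [/\ Ap E, p <= rho,
  sheet_sign u0 (th u0 - 1 / 2) (fun u => k%:C%C * (2%:R * E u - 1)) k p,
  forall u, D u -> nm (Z u - Z u0) < p ->
    ~~ (th u0 - 7 / 8 < th u < th u0 - 1 / 8) /\
    (th u0 - 1 / 2 < th u -> nm (E u - 1) <= 1 / 10) /\
    (th u <= th u0 - 1 / 2 -> nm (E u) <= 1 / 10) &
  forall u, D u -> k + 2 * k * nm (E u) <= p / 10].
Proof.
move=> Du0; have [E [p [AE /andP[p0 pr] prho h]]] := sheet_polynomial Du0.
have [B B0 hB] := Ap_bound cD cZ cW AE.
have BB : 0 < 10 * (1 + 2 * B) by lra.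
pose k := Num.min (p / 12) (p / (10 * (1 + 2 * B))).
have k0 : 0 < k by rewrite lt_min !divr_gt0.
have k1 : k <= p / 12 by rewrite ge_min lexx.
have k2 : k * (10 * (1 + 2 * B)) <= p by rewrite -ler_pdivlMr // ge_min lexx orbT.
have n2 : nm (2%:R : R[i]) = 2 by rewrite -(rmorph_nat (real_complex R)) nm_real normr_nat.
have far u : D u -> k + 2 * k * nm (E u) <= p / 10.
  by move=> Du; have : k * nm (E u) <= k * B; [rewrite ler_pM2l // hB|lra].
exists E, k, p; split=> //; split=> //.
- by rewrite p0.
- apply: (ApM cD cZ cW); [exact: Ap_cst|apply: ApB; last exact: Ap_cst].
  by apply: (ApM cD cZ cW) => //; exact: Ap_cst.
move=> u Du; split=> [/(h _ Du)[_ [h1 h2]]|_].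
  split=> [/h1|/h2] e.
    have -> : k%:C%C * (2%:R * E u - 1) - k%:C%C = k%:C%C * (2%:R * (E u - 1)) by ring.
    rewrite !nmM n2 nm_real gtr0_norm //.
    by have : k * nm (E u - 1) <= k * (1 / 10); [rewrite ler_pM2l|lra].
  have -> : k%:C%C * (2%:R * E u - 1) + k%:C%C = k%:C%C * (2%:R * E u) by ring.
  rewrite !nmM n2 nm_real gtr0_norm //.
  by have : k * nm (E u) <= k * (1 / 10); [rewrite ler_pM2l|lra].
have := far _ Du; have := nmB (2%:R * E u) 1; rewrite !nmM n2 nm1 nm_real gtr0_norm // => t.
have : k * nm (2%:R * E u - 1) <= k * (2 * nm (E u) + 1) by rewrite ler_pM2l.
by lra.
Qed.

Lemma unzips_below_const c u v : (forall u, D u -> c < th u) -> D u -> D v -> unzips u c -> unzips v c.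
Proof.
move=> hc; apply: (@unzips_const (fun=> c)).
  move=> u0 Du0; exists (fun=> (r / 12)%:C%C), (r / 12), r; apply: sheet_sign_below => //.
  by rewrite divr_gt0 //= lexx.
by move=> u0 Du0; exists 1.
Qed.

Lemma unzips_above_const c u v : (forall u, D u -> th u <= c) -> D u -> D v -> unzips u c -> unzips v c.
Proof.
move=> hc; apply: (@unzips_const (fun=> c)).
  move=> u0 Du0; exists (fun=> - (r / 12)%:C%C), (r / 12), r; apply: sheet_sign_above => //.
  by rewrite divr_gt0 //= lexx.
by move=> u0 Du0; exists 1.
Qed.

(** A change of [th u0] by less than 1/8 keeps the cut [th u0 - 1 / 2] inside the gap of
    [sheet_polynomial], so nearby points divide the sheets alike. *)
Lemma unzips_sheet_const v w : D v -> D w -> unzips v (th v - 1 / 2) -> unzips w (th w - 1 / 2).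
Proof.
apply: (@unzips_const (fun u => th u - 1 / 2)) => u0 Du0.
  have [E [k [p [_ _ g _ _]]]] := sheet_sign_sheet Du0.
  by exists (fun u => k%:C%C * (2%:R * E u - 1)), k, p.
have [E [k [p [_ _ [_ /andP[p0 _] _ _ _] h _]]]] := sheet_sign_sheet Du0.
have e8 : 0 < 1 / 8 :> R by lra.
have [d d0 hd] := cth Du0 e8.
exists (Num.min p d); first by rewrite lt_min p0.
move=> u1 Du1; rewrite lt_min => /andP[_ /(hd _ Du1)]; rewrite -rmorphB nm_real.
rewrite ltr_norml => /andP[t1 t2] u Du; rewrite lt_min => /andP[/(h _ Du)[gap _] _].
have [a|a] := ltP (th u0 - 7 / 8) (th u).
  have b : th u0 - 1 / 8 <= th u by rewrite leNgt; apply/negP => b; rewrite a b in gap.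
  have -> : th u0 - 1 / 2 < th u by lra.
  by symmetry; apply/idP; lra.
have -> : (th u0 - 1 / 2 < th u) = false by apply/negP => b; lra.
by symmetry; apply/negP => b; lra.
Qed.

(* Above a maximum of th the sheets with th > th u0 - 1/2 lie in x <= 0 locally, so
   the curve can be pulled round their end. *)
Lemma unzips_tip u0 c : D u0 -> (forall u, D u -> th u <= th u0) -> (forall u, D u -> th u <= c) ->
  unzips u0 (th u0 - 1 / 2) <-> unzips u0 c.
Proof.
move=> Du0 mx hc; have [E [k [p [AE prho g h far]]]] := sheet_sign_sheet Du0.
have [k0 /andP[p0 pr] kp _ _] := g.
(* On the upper sheets, where [E] is close to 1, the zero would have chart coordinate
   [k * a + 'i * k * (b - 1)]. The broken line [(0, 2)], [(1, 1)], [(0, 0)] for [(a, b)] takes it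
   from one side of the curve to the other through positive abscissae, beyond the end of these
   sheets. *)
pose G (a b : R) u := conjc (T u0) * (Z u - Z u0) + 'i%C * k%:C%C - Complex (k * a) (k * b) * E u.
have AG a b : Ap (G a b).
  apply: ApB; last by apply: (ApM cD cZ cW) => //; exact: Ap_cst.
  apply: ApD; last exact: Ap_cst.
  apply: (ApM cD cZ cW); first exact: Ap_cst.
  by apply: ApB; [exact: Ap_Z|exact: Ap_cst].
have nz a b u : D u -> 0 <= a -> a + `|b - 1| = 1 -> G a b u != 0.
  move=> Du a0 ab; apply/eqP => G0.
  have hb : `|b| <= 1 + `|b - 1|.
    by have := ler_normD 1 (b - 1); rewrite normr1 (_ : 1 + (b - 1) = b) //; ring.
  have nc : nm (Complex (k * a) (k * b)) <= 2 * k.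
    apply: (le_trans (nm_le_ReIm _)) => /=.
    by rewrite !normrM (gtr0_norm k0) (ger0_norm a0) -mulrDr mulrC ler_pM2r //; lra.
  have eG : conjc (T u0) * (Z u - Z u0) = Complex (k * a) (k * b) * E u - 'i%C * k%:C%C.
    by move: G0; rewrite /G => /eqP; rewrite subr_eq0 => /eqP <-; ring.
  have ni : nm ('i%C * k%:C%C) = k by rewrite nmM nm_i mul1r nm_real gtr0_norm.
  have [fr|near] := leP p (nm (Z u - Z u0)).
    have := nmB (Complex (k * a) (k * b) * E u) ('i%C * k%:C%C).
    rewrite -eG nm_xi // ni nmM; have := far _ Du.
    have : nm (Complex (k * a) (k * b)) * nm (E u) <= 2 * k * nm (E u).
      by rewrite ler_wpM2r // nm_ge0.
    by lra.
  have := chart0 Du0 Du (lt_le_trans near pr).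
  have [gap [hin hout]] := h _ Du near.
  have tip : th u0 - 1 / 2 < th u -> Re (conjc (T u0) * (Z u - Z u0)) <= 0.
    move=> hu; rewrite leNgt; apply/negP => x0.
    have hm := mx _ Du; have lt12 : `|th u - th u0| < 1 / 2 by rewrite ltr_norml; lra.
    by have := th_mono Du0 Du (lt_le_trans near prho) lt12 x0; lra.
  have hk (x : R[i]) : nm x <= 1 / 10 -> nm (Complex (k * a) (k * b) * x) <= k / 5.
    move=> hx; rewrite nmM; apply: (le_trans (ler_pM (nm_ge0 _) (nm_ge0 _) nc hx)); lra.
  have kb : k * a + k * `|b - 1| = k by rewrite -mulrDr ab mulr1.
  have kb2 : k * `|b - 1| = `|k * b - k| by rewrite -[in RHS](mulr1 k) -mulrA mul1r -mulrBr normrM gtr0_norm.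
  have [hu|hu] := ltP (th u0 - 1 / 2) (th u).
    have := hk _ (hin hu); have := tip hu; rewrite eG.
    have -> : Complex (k * a) (k * b) * E u - 'i%C * k%:C%C =
       Complex (k * a) (k * b) * (E u - 1) + Complex (k * a) (k * b) - 'i%C * k%:C%C by ring.
    move: (Complex (k * a) (k * b) * (E u - 1)) => x.
    rewrite cReB cImB cReD cImD !(ReIm_i _).1 !(ReIm_i _).2 /= => hx hn.
    have := Re_bound x; have := Im_bound x.
    have e1 : Im x + k * b - k = Im x + (k * b - k) by ring.
    rewrite e1 => h1 h2 h3.
    have := ler_normB (Im x + (k * b - k)) (Im x); rewrite addrAC subrr add0r => h4.
    have h5 : `|Im x| <= nm x by rewrite ler_norml; apply/andP.
    by move: h3; rewrite (ler0_norm hx); lra.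
  have := hk _ (hout hu); rewrite eG.
  move: (Complex (k * a) (k * b) * E u) => x; rewrite cReB cImB !(ReIm_i _).1 !(ReIm_i _).2 /=.
  move=> hx; rewrite oppr0 subr0; have := Re_bound x; have := Im_bound x.
  move=> h1 /andP h2; have h3 : `|Re x| <= nm x by rewrite ler_norml.
  by rewrite ler_norml => /andP[]; lra.
have tip_move a b a' b' : (forall s, 0 <= s <= 1 ->
    0 <= a + s * (a' - a) /\ a + s * (a' - a) + `|b + s * (b' - b) - 1| = 1) ->
    Inv (G a b) -> Inv (G a' b').
  move=> hs; apply: (oka cD cZ cW (AG _ _) (AG _ _)) => u s Du /hs[s1 s2].
  have -> : G a b u + s%:C%C * (G a' b' u - G a b u) =
     G (a + s * (a' - a)) (b + s * (b' - b)) u.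
    rewrite /G; have -> : Complex (k * (a + s * (a' - a))) (k * (b + s * (b' - b))) =
        Complex (k * a) (k * b) + s%:C%C * (Complex (k * a') (k * b') - Complex (k * a) (k * b)).
      by apply/eqP; rewrite eq_complex /=; apply/andP; split; apply/eqP; ring.
    by ring.
  exact: nz.
have gC := @sheet_sign_above u0 c k hc.
have kr : 0 < k <= r / 12 by lra.
have e02 u : D u -> G 0 2 u = sheared u0 (fun u => k%:C%C * (2%:R * E u - 1)) u.
  move=> _; rewrite /G /sheared; have -> : Complex (k * 0) (k * 2) = 2%:R * 'i%C * k%:C%C.
    by apply/eqP; rewrite eq_complex /=; apply/andP; split; apply/eqP; ring.
  by ring.
have e00 u : D u -> G 0 0 u = sheared u0 (fun=> - k%:C%C) u.
  move=> _; rewrite /G /sheared; have -> : Complex (k * 0) (k * 0) = 0.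
    by apply/eqP; rewrite eq_complex /=; apply/andP; split; apply/eqP; ring.
  by ring.
split=> [[Phi [k' [p' [g' i']]]]|[Phi [k' [p' [g' i']]]]].
  exists (fun=> - k%:C%C), k, r; split; first exact: gC.
  have i0 := unzips_all Du0 g' g i'.
  apply: (Inv_eq e00); apply: (@tip_move 1 1).
    by move=> s hs; split; [|rewrite ler0_norm]; lra.
  apply: (@tip_move 0 2); first by move=> s hs; split; [|rewrite ger0_norm]; lra.
  by apply: Inv_eq i0 => u Du; rewrite e02.
exists (fun u => k%:C%C * (2%:R * E u - 1)), k, p; split=> //.
have i0 := unzips_all Du0 g' (gC kr) i'.
apply: (Inv_eq e02); apply: (@tip_move 1 1).
  by move=> s hs; split; [|rewrite ger0_norm]; lra.
apply: (@tip_move 0 0); first by move=> s hs; split; [|rewrite ler0_norm]; lra.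
by apply: Inv_eq i0 => u Du; rewrite e00.
Qed.

(** At a maximum of [Re Z] some pole close to [Z u0] lies to the right of the curve. The sign of
    [Ti] decides on which side of the tangent it is, hence whether all sheets count as lower or as
    upper. *)
Lemma unzips_rightmost M : (forall u, D u -> - M < th u <= M) ->
  exists2 u0, D u0 & unzips u0 M \/ unzips u0 (- M).
Proof.
move=> hM; have [|u0 Du0 mx] := ccont_max cD (f := fun u => Re (Z u)) _ disc_inhabited.
  exact: ccont_re.
exists u0 => //.
pose k := r / 12; have k0 : 0 < k by rewrite divr_gt0.
pose Tr := Re (T u0); pose Ti := Im (T u0).
have TT : Tr ^+ 2 + Ti ^+ 2 = 1 by rewrite -nm_sqr T1 // expr1n.
have Trl : `|Tr| <= 1 by rewrite -(T1 Du0) ler_norml; apply/andP; exact: Re_bound.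
have key (s : R) : `|s| = 1 -> s * Ti <= 0 ->
    Inv (sheared u0 (fun=> Complex (s * k) (- (Tr / 10) * k))).
  move=> hs hT.
  (* The term with [Tr / 10] shifts the pole along the tangent, which keeps it to the right of
     [Z u0] even if the tangent is horizontal; the shift is within the tolerance [k / 5]. *)
  pose zeta := Z u0 + T u0 * ('i%C * Complex (s * k) (- (Tr / 10) * k)).
  have hz : Re (Z u0) < Re zeta.
    rewrite /zeta cReD ltrDl !(cReM (T u0)) !(ReIm_i _).1 !(ReIm_i _).2 /= -/Tr -/Ti.
    have -> : Tr * - (- (Tr / 10) * k) - Ti * (s * k) = k * (Tr ^+ 2 / 10 - s * Ti) by ring.
    rewrite mulr_gt0 //; have := sqr_ge0 Tr.
    have [T0|] := eqVneq Ti 0; first by move: TT; rewrite T0 mulr0; lra.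
    move=> Tn; have hsT : s * Ti != 0 by rewrite mulf_neq0 // -normr_gt0 hs ltr01.
    by have : s * Ti < 0; [rewrite lt_neqAle hsT|lra].
  have i1 : Inv (fun u => Z u - zeta).
    have AZ : Ap (fun u => Z u - zeta) by apply: ApB; [exact: Ap_Z|exact: Ap_cst].
    have N1 : (-1 : R[i]) != 0 by rewrite oppr_eq0 oner_eq0.
    have iN : Inv (fun=> -1) by exact: Inv_cst.
    have AN : Ap (fun=> -1) by exact: Ap_cst.
    (* The segment from -1 to [Z - zeta] stays in the left half plane. *)
    apply: (oka cD cZ cW AN AZ) iN => u s' Du /andP[s0 s1]; apply/eqP => /(congr1 (fun x => Re x)).
    rewrite cReD cReM !cReB /= => e; have := mx _ Du.
    have : 0 <= s' * (Re (Z u0) - Re (Z u)) by rewrite mulr_ge0 // subr_ge0 mx.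
    have [e0|sn] := eqVneq s' 0; first by move: e; rewrite e0 /=; lra.
    have : 0 < s' * (Re zeta - Re (Z u0)) by rewrite mulr_gt0 ?subr_gt0 // lt_neqAle eq_sym sn.
    by move: e; rewrite /=; lra.
  have Tn : conjc (T u0) != 0 by rewrite -nm_gt0 nmJ T1.
  have i2 : Inv (fun=> conjc (T u0)) by exact: Inv_cst.
  apply: Inv_eq (InvM cD cZ cW i2 i1) => u Du.
  rewrite /sheared /zeta; have := conjcMl (T u0); rewrite T1 // expr1n rmorph1 => cT1.
  transitivity (conjc (T u0) * (Z u - Z u0) - (conjc (T u0) * T u0) *
     ('i%C * Complex (s * k) (- (Tr / 10) * k))); first by ring.
  by rewrite cT1 mul1r.
have gd (s : R) c : `|s| = 1 -> (forall u, D u -> c < th u -> s = 1) ->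
    (forall u, D u -> th u <= c -> s = -1) ->
    sheet_sign u0 c (fun=> Complex (s * k) (- (Tr / 10) * k)) k r.
  move=> hs h1 h2.
  have ek : k = r / 12 by [].
  have small : `|- (Tr / 10) * k| <= k / 10.
    rewrite normrM normrN normrM (gtr0_norm k0).
    have : `|Tr| * k <= 1 * k by rewrite ler_pM2r.
    by rewrite (@gtr0_norm _ (10^-1)); lra.
  split=> //; [by rewrite r0 lexx|exact: Ap_cst|].
  move=> u Du; split=> [_|_].
    split=> hc; apply: (le_trans (nm_le_ReIm _)); rewrite ?cReB ?cImB ?cReD ?cImD /=.
      by rewrite (h1 _ Du hc) mul1r subrr normr0 subr0; lra.
    by rewrite (h2 _ Du hc) mulN1r addNr normr0 addr0; lra.
  by apply: (le_trans (nm_le_ReIm _)); rewrite /= normrM hs mul1r (gtr0_norm k0); lra.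
have [hT|hT] := leP Ti 0.
  right; exists (fun=> Complex (1 * k) (- (Tr / 10) * k)), k, r; split.
    by apply: gd; rewrite ?normr1 // => u /hM; lra.
  by apply: key; rewrite ?normr1 ?mul1r.
left; exists (fun=> Complex (-1 * k) (- (Tr / 10) * k)), k, r; split.
  by apply: gd; rewrite ?normrN1 // => u /hM; lra.
by apply: key; rewrite ?normrN1 // mulN1r; lra.
Qed.

(** The cut half a unit below the current sheet links the trivial cuts [M] and [- M]. At the maximum
    of [th] it is exchanged for [M] by [unzips_tip]; at the minimum it already lies below all
    heights, like [- M]. *)
Lemma unzips_both M u : (forall u, D u -> - M < th u <= M) -> D u -> unzips u M /\ unzips u (- M).
Proof.
move=> hM Du.
have hb v : D v -> - M < th v by move=> /hM /andP[].
have ha v : D v -> th v <= M by move=> /hM /andP[].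
have [um Dum mx] := ccont_max cD cth disc_inhabited.
have [|un Dun mn] := ccont_max cD (f := fun u => - th u) _ disc_inhabited.
  by apply: ccont_eq (ccontN cth) => v _; rewrite rmorphN.
have top : unzips um (th um - 1 / 2) <-> unzips um M by exact: unzips_tip.
have bot : unzips un (th un - 1 / 2) <-> unzips un (- M).
  have e v : D v -> (th un - 1 / 2 < th v) = (- M < th v).
    by move=> Dv; rewrite hb //; apply/idP; have := mn _ Dv; lra.
  by split; apply: unzips_same => v Dv; rewrite e.
have [u0 Du0 [v0|v0]] := unzips_rightmost hM.
  have h := unzips_sheet_const Dum Dun (top.2 (unzips_above_const ha Du0 Dum v0)).
  split; first exact: unzips_above_const v0.
  exact: unzips_below_const (bot.1 h).
have h := unzips_sheet_const Dun Dum (bot.2 (unzips_below_const hb Du0 Dun v0)).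
split; last exact: unzips_below_const v0.
exact: unzips_above_const (top.1 h).
Qed.

(** With all sheets upper, or all lower, [Phi] may be constant, and [unzips] speaks of a pole on the
    normal at [Z u0]. *)
Lemma Inv_pole u0 k : D u0 -> 0 < k <= r / 12 ->
  Inv (fun u => conjc (T u0) * (Z u - Z u0) - 'i%C * k%:C%C) /\
  Inv (fun u => conjc (T u0) * (Z u - Z u0) - 'i%C * - k%:C%C).
Proof.
move=> Du0 kr; have [B B0 hB] := ccont_bound cD cth.
have hM u : D u -> - (B + 1) < th u <= B + 1.
  by move=> /hB; rewrite nm_real ler_norml; lra.
have hb u : D u -> - (B + 1) < th u by move=> /hM /andP[].
have ha u : D u -> th u <= B + 1 by move=> /hM /andP[].
have [[P1 [k1 [p1 [g1 i1]]]] [P2 [k2 [p2 [g2 i2]]]]] := unzips_both hM Du0.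
split; first exact: (unzips_all Du0 g2 (sheet_sign_below _ hb kr) i2).
exact: (unzips_all Du0 g1 (sheet_sign_above _ ha kr) i1).
Qed.

(** The pole starts on the normal at the point [Z u0] of the curve closest to [zeta], on a side
    still to be chosen, goes round to the segment from [Z u0] to [zeta], and follows it inside the
    open disc around [zeta] that contains no point of the curve. *)
Lemma Inv_Z_off zeta : (forall u, D u -> Z u != zeta) -> Inv (fun u => Z u - zeta).
Proof.
move=> miss; have cf : ccont D (fun u => (- nm (Z u - zeta))%:C%C).
  have c1 : ccont D (fun u => Z u - zeta) by apply: ccontB cZ _; exact: ccont_cst.
  by apply: ccont_eq (ccontN (ccont_nm c1)) => u _; rewrite rmorphN.
have [u0 Du0 mx] := ccont_max cD cf disc_inhabited.
have near u : D u -> nm (Z u0 - zeta) <= nm (Z u - zeta) by move=> /mx; rewrite lerN2.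
pose xi u := conjc (T u0) * (Z u - Z u0).
pose w := conjc (T u0) * (zeta - Z u0).
have cT1 : conjc (T u0) * T u0 = 1 by rewrite conjcMl T1 // expr1n rmorph1.
have nw : nm w = nm (Z u0 - zeta) by rewrite /w nmM nmJ T1 // mul1r nmBC.
have w0 : 0 < nm w by rewrite nw nm_gt0 subr_eq0 miss.
have far u : D u -> nm w <= nm (xi u - w).
  move=> Du; rewrite nw; have -> : xi u - w = conjc (T u0) * (Z u - zeta) by rewrite /xi /w; ring.
  by rewrite nmM nmJ T1 // mul1r near.
have Axi z : Ap (fun u => xi u - z).
  apply: ApB; last exact: Ap_cst; apply: (ApM cD cZ cW); first exact: Ap_cst.
  by apply: ApB; [exact: Ap_Z|exact: Ap_cst].
have move_pole a b : (forall u s, D u -> 0 <= s <= 1 -> xi u != a + s%:C%C * (b - a)) ->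
    Inv (fun u => xi u - a) -> Inv (fun u => xi u - b).
  move=> h; apply: (oka cD cZ cW (Axi a) (Axi b)) => u s Du hs.
  have -> : xi u - a + s%:C%C * (xi u - b - (xi u - a)) = xi u - (a + s%:C%C * (b - a)) by ring.
  by rewrite subr_eq0 h.
suff iw : Inv (fun u => xi u - w).
  have i2 : Inv (fun=> T u0) by apply: Inv_cst; rewrite -nm_gt0 T1.
  apply: Inv_eq (InvM cD cZ cW i2 iw) => u Du; rewrite /xi /w.
  by rewrite -mulrBr mulrA [T u0 * _]mulrC cT1 mul1r; ring.
(* The first legs are on the scale [k <= r / 12], well inside the chart, and end at [t * w], of
   modulus [k / 2]. *)
clearbody w; pose t := Num.min 1 (r / 24 / nm w).
have t0 : 0 < t by rewrite lt_min ltr01 !divr_gt0.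
have t1 : t <= 1 by rewrite ge_min lexx.
have tw : t * nm w <= r / 24 by rewrite -ler_pdivlMr // ge_min lexx orbT.
pose al := t * Re w; pose be := t * Im w; pose k := 2 * (t * nm w).
have k0 : 0 < k by rewrite !mulr_gt0.
have hal : `|al| <= k / 2.
  have : `|Re w| <= nm w by rewrite ler_norml; apply/andP; exact: Re_bound.
  move=> /(ler_wpM2l (ltW t0)); rewrite -[X in X * `|_|](ger0_norm (ltW t0)) -normrM -/al /k.
  by linarith.
have hbe : `|be| <= k / 2.
  have : `|Im w| <= nm w by rewrite ler_norml; apply/andP; exact: Im_bound.
  move=> /(ler_wpM2l (ltW t0)); rewrite -[X in X * `|_|](ger0_norm (ltW t0)) -normrM -/be /k.
  by linarith.
have etw : t%:C%C * w = Complex al be.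
  by apply/eqP; rewrite eq_complex cReM cImM /= /al /be; apply/andP; split; apply/eqP; ring.
have kr : 0 < k <= r / 12 by rewrite k0 /k; linarith.
clearbody al be k.
(* Every point of this segment is closer to [w] than the curve is. *)
have last_leg : Inv (fun u => xi u - Complex al be) -> Inv (fun u => xi u - w).
  rewrite -etw; apply: move_pole => u s Du /andP[s0 s1]; apply/eqP => e.
  have := far _ Du; rewrite e.
  have -> : t%:C%C * w + s%:C%C * (w - t%:C%C * w) - w = - ((1 - s) * (1 - t))%:C%C * w.
    by rewrite !rmorphM !rmorphB !rmorph1; ring.
  rewrite nmM nmN nm_real ger0_norm; last by rewrite mulr_ge0 // subr_ge0.
  rewrite leNgt gtr_pMl // (_ : _ * _ = 1 - t - s * (1 - t)); last by ring.
  have : 0 <= s * (1 - t) by rewrite mulr_ge0 // subr_ge0.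
  by move=> h /negP; apply; linarith.
have on_chart u : D u -> nm (xi u) < r -> `|Im (xi u)| <= (1 / 10) * `|Re (xi u)|.
  by rewrite nm_xi // => Du; exact: chart0.
have start (s : R) : s = 1 \/ s = -1 -> Inv (fun u => xi u - 'i%C * (s * k)%:C%C).
  have [ip im] := Inv_pole Du0 kr.
  by case=> ->; rewrite ?mul1r ?mulN1r ?rmorphN.
have small x y u : D u -> `|x| <= k / 2 -> `|y| <= k -> xi u = Complex x y ->
    nm (xi u) < r /\ `|y| <= k / 20.
  move=> Du hx hy e; have n : nm (xi u) < r.
    by rewrite e; apply: (le_lt_trans (nm_le_ReIm _)); rewrite /=; linarith.
  by split=> //; have := on_chart _ Du n; rewrite e /=; linarith.
(* The leg runs at height [s * k]; over these abscissae the curve has ordinates of modulus at most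
   [k / 20]. *)
have first_leg (s : R) : s = 1 \/ s = -1 -> Inv (fun u => xi u - Complex al (s * k)).
  move=> hs; apply: move_pole (start _ hs) => u s' Du /andP[s0 s1]; apply/eqP => e.
  have e2 : xi u = Complex (s' * al) (s * k).
    rewrite e; apply/eqP; rewrite eq_complex !cReD !cImD !cReM !cImM !cReB !cImB !cReM !cImM /=.
    by apply/andP; split; apply/eqP; ring.
  have nk : `|s * k| = k by case: hs => ->; rewrite ?mul1r ?mulN1r ?normrN gtr0_norm.
  have [||_] := small _ _ _ Du _ _ e2; rewrite ?nk //; last by linarith.
  rewrite normrM (ger0_norm s0); have : s' * `|al| <= 1 * `|al| by rewrite ler_wpM2r.
  by linarith.
apply: last_leg.
suff [s hs h] : exists2 s : R, s = 1 \/ s = -1 & forall u t', D u -> 0 <= t' <= 1 ->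
    xi u != Complex al (s * k + t' * (be - s * k)).
  apply: move_pole (first_leg _ hs) => u s' Du hs'.
  have -> : Complex al (s * k) + s'%:C%C * (Complex al be - Complex al (s * k)) =
      Complex al (s * k + s' * (be - s * k)).
    apply/eqP; rewrite eq_complex !cReD !cImD !cReM !cImM !cReB !cImB /=.
    by apply/andP; split; apply/eqP; ring.
  exact: h.
have [[u1 [y1 [Du1 n1 e1]]]|no] := pselect (exists u1 y1, [/\ D u1, nm (xi u1) < r &
    xi u1 = Complex al y1]); last first.
  exists 1; first by left.
  move=> u t' Du /andP[t0' t1']; apply/eqP => e; apply: no.
  exists u, (1 * k + t' * (be - 1 * k)); split=> //.
  apply: (small _ _ _ Du hal _ e).1; rewrite mul1r ler_norml.
  move: hbe; rewrite ler_norml => /andP[b1 b2].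
  have : t' * (k - be) <= 1 * (k - be) by rewrite ler_wpM2r //; linarith.
  have : 0 <= t' * (k - be) by rewrite mulr_ge0 //; linarith.
  by move=> *; apply/andP; split; linarith.
(* At most one point of the curve lies over the abscissa al; move away from it. *)
have uniq u y : D u -> nm (xi u) < r -> xi u = Complex al y -> y = y1.
  move=> Du nu e; have := chart Du0 Du1 Du; rewrite -!(nm_xi _ Du0) => /(_ n1 nu).
  have -> : conjc (T u0) * (Z u - Z u1) = xi u - xi u1 by rewrite /xi; ring.
  by rewrite e e1 cReB cImB /= subrr normr0 mulr0 normr_le0 subr_eq0 => /eqP.
have y1b : y1 != be.
  apply/eqP => e; have := far _ Du1; rewrite e1 e -etw.
  have -> : t%:C%C * w - w = - (1 - t)%:C%C * w by rewrite rmorphB rmorph1; ring.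
  rewrite nmM nmN nm_real ger0_norm ?subr_ge0 // leNgt gtr_pMl //; case/negP; linarith.
have sel (s : R) : s = 1 \/ s = -1 -> 0 < s * (be - y1) -> forall u t', D u -> 0 <= t' <= 1 ->
    xi u != Complex al (s * k + t' * (be - s * k)).
  move=> hs hy u t' Du /andP[t0' t1']; apply/eqP => e.
  move: hbe; rewrite ler_norml => /andP[b1 b2].
  have ss : s * s = 1 by case: hs => ->; ring.
  have h1 : 0 <= t' * (k - s * be) by rewrite mulr_ge0 //; case: hs => ->; linarith.
  have h2 : t' * (k - s * be) <= 1 * (k - s * be).
    by rewrite ler_wpM2r //; case: hs => ->; linarith.
  have hy' : `|s * k + t' * (be - s * k)| <= k.
    by rewrite ler_norml; case: hs h1 h2 => ->; linarith.
  have := uniq _ _ Du (small _ _ _ Du hal hy' e).1 e.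
  by case: hs hy h1 h2 => ->; linarith.
have [h|h] := ltP y1 be.
  by exists 1; [left|apply: sel; [left|linarith]].
by exists (-1); [right|apply: sel; [right|rewrite mulN1r oppr_gt0 subr_lt0 lt_neqAle eq_sym y1b]].
Qed.

(** If [zq] is on the curve, [Q] is small near the fibre and 1 at the given point. The factor
    ['i * k / X], with [X] vanishing at distance [k] from [Z u0] beside the curve, has modulus at
    most 10/9 near the fibre, is small away from it, and equals -1 at the given point. *)
Lemma hull_in_image zq wq :
  (forall u0 w0, D u0 -> (forall u, D u -> Z u = Z u0 -> W u != w0) ->
     fibre_Inv u0 w0) ->
  (forall P M, (forall u, D u -> nm (ev2 P (Z u) (W u)) <= M) -> nm (ev2 P zq wq) <= M) ->
  exists u, [/\ D u, Z u = zq & W u = wq].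
Proof.
move=> fib hull.
have evX (c : R[i]) P : exists Q, forall z w, ev2 Q z w = 1 - (z - c) * ev2 P z w.
  by exists (1%:P%:P - ('X%:P - c%:P%:P) * P) => z w; rewrite ev2B ev2M ev2B ev2Z !ev2C.
have evY (c : R[i]) P : exists Q, forall z w, ev2 Q z w = 1 - (w - c) * ev2 P z w.
  by exists (1%:P%:P - ('X - c%:P%:P) * P) => z w; rewrite ev2B ev2M ev2B ev2W !ev2C.
have [[u0 [Du0 Zu0]]|offZ] := pselect (exists u, D u /\ Z u = zq); last first.
  have [|g Ag gE] := @Inv_Z_off zq.
    by move=> u Du; apply/eqP => e; apply: offZ; exists u.
  have [|B B0 hB] := ccont_bound cD (f := fun u => Z u - zq).
    by apply: ccontB cZ _; exact: ccont_cst.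
  have e0 : 0 < 1 / (2 * B) by rewrite divr_gt0 // mulr_gt0.
  have [P hP] := Ag _ e0.
  have [Q QE] := evX zq P; have := hull Q (1 / 2).
  rewrite QE (subrr zq) mul0r subr0 nm1 => h; exfalso.
  suff : (1 : R) <= 1 / 2 by lra.
  apply: h => u Du; rewrite QE -(gE _ Du) -mulrBr nmM.
  apply: (le_trans (ler_pM (nm_ge0 _) (nm_ge0 _) (hB _ Du) _)).
    by exact: hP.
  by rewrite mul1r invfM mulrCA divff ?gt_eqF // mulr1; linarith.
apply: contrapT => offW.
have missW u : D u -> Z u = Z u0 -> W u != wq.
  by move=> Du Zu; apply/eqP => e; apply: offW; exists u; rewrite Zu.
have [g Ag gE] := fib _ _ Du0 missW.
have [|BW BW0 hBW] := ccont_bound cD (f := fun u => W u - wq).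
  by apply: ccontB cW _; exact: ccont_cst.
have e1 : 0 < 1 / (10 * BW) by rewrite divr_gt0 // mulr_gt0.
have [P hP] := Ag _ e1.
have [Q QE] := evY wq P.
have Qq : ev2 Q zq wq = 1 by rewrite QE (subrr wq) mul0r subr0.
have e10 : 0 < 1 / 10 :> R by linarith.
have [d d0 hd] := ccont_unif cD (ccont_ev cZ cW Q) e10.
have [p1 p10 hp1] := fibre_near Du0 d0.
have [C C0 hC] := ccont_bound cD (ccont_ev cZ cW Q).
pose p := Num.min p1 r.
have p0 : 0 < p by rewrite lt_min p10.
have near u : D u -> nm (Z u - Z u0) < p -> nm (ev2 Q (Z u) (W u)) <= 1 / 5.
  move=> Du; rewrite lt_min => /andP[/(hp1 _ Du)[u' [Du' Zu' l]] _].
  have := hd _ _ Du Du' l.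
  have : nm (ev2 Q (Z u') (W u')) <= 1 / 10.
    rewrite QE -(gE _ (conj Du' Zu')) -mulrBr nmM.
    apply: (le_trans (ler_pM (nm_ge0 _) (nm_ge0 _) (hBW _ Du') _)).
      by exact: hP.
    by rewrite mul1r invfM mulrCA divff ?gt_eqF // mulr1; linarith.
  have := nmD (ev2 Q (Z u) (W u) - ev2 Q (Z u') (W u')) (ev2 Q (Z u') (W u')).
  by rewrite subrK; linarith.
(* The third bound lets [k / X] beat the bound [C] of [Q] away from the fibre. *)
pose k := Num.min (r / 12) (Num.min (p / 2) (p / (10 * C))).
have k0 : 0 < k by rewrite !lt_min !divr_gt0 ?mulr_gt0.
have kr : 0 < k <= r / 12 by rewrite k0 ge_min lexx.
have k1 : k <= p / 2 by rewrite !ge_min lexx orbT.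
have k2 : k * (10 * C) <= p by rewrite -ler_pdivlMr ?mulr_gt0 // !ge_min lexx !orbT.
clearbody k.
have [X XE] : exists X, forall z w, ev2 X z w = conjc (T u0) * (z - Z u0) - 'i%C * k%:C%C.
  exists ((conjc (T u0))%:P%:P * ('X%:P - (Z u0)%:P%:P) - ('i%C * k%:C%C)%:P%:P) => z w.
  by rewrite ev2B ev2M ev2B ev2Z !ev2C.
have Xq : ev2 X zq wq = - ('i%C * k%:C%C) by rewrite XE -Zu0 (subrr (Z u0)) mulr0 sub0r.
have nik : nm ('i%C * k%:C%C) = k by rewrite nmM nm_i mul1r nm_real gtr0_norm.
have [g' Ag' gE'] := (Inv_pole Du0 kr).1.
have [B B0 hB] := ccont_bound cD (ccont_ev cZ cW X).
have e2 : 0 < Num.min (1 / (4 * B)) (1 / (4 * k * C)).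
  by rewrite lt_min !divr_gt0 // !mulr_gt0.
have [P' hP'] := Ag' _ e2.
have [P1 P1E] : exists P1, forall z w, ev2 P1 z w = ev2 X z w * ev2 P' z w - 1.
  by exists (X * P' - 1%:P%:P) => z w; rewrite ev2B ev2M ev2C.
have aX u : D u -> nm (ev2 P1 (Z u) (W u)) <= 1 / 4.
  move=> Du; rewrite P1E XE -(gE' _ Du) -mulrBr nmM -(XE _ (W u)).
  have h1 : nm (ev2 P' (Z u) (W u) - g' u) <= 1 / (4 * B).
    by have := hP' _ Du; rewrite (nmBC (g' u)) le_min => /andP[].
  apply: (le_trans (ler_pM (nm_ge0 _) (nm_ge0 _) (hB _ Du) h1)).
  by rewrite mul1r invfM mulrCA divff ?gt_eqF // mulr1; linarith.
have kg u : D u -> k * nm (g' u) * nm (ev2 Q (Z u) (W u)) <= 1 / 4.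
  move=> Du; have := gE' _ Du.
  move=> /(congr1 (@nm R)); rewrite nmM nm1 => hg.
  have g0 := nm_ge0 (g' u); have Q0 := nm_ge0 (ev2 Q (Z u) (W u)).
  have [far|nr] := leP p (nm (Z u - Z u0)).
    have : p / 2 <= nm (conjc (T u0) * (Z u - Z u0) - 'i%C * k%:C%C).
      by have := nm_lowB (conjc (T u0) * (Z u - Z u0)) ('i%C * k%:C%C); rewrite nm_xi // nik; linarith.
    move=> /(ler_wpM2r g0); rewrite hg => h1.
    have h2 : nm (g' u) * nm (ev2 Q (Z u) (W u)) <= nm (g' u) * C by rewrite ler_wpM2l // hC.
    have h3 : k * (nm (g' u) * nm (ev2 Q (Z u) (W u))) <= k * (nm (g' u) * C) by rewrite ler_pM2l.
    have h4 : k * (10 * C) * nm (g' u) <= p * nm (g' u) by rewrite ler_wpM2r.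
    by move: h1 h3 h4; rewrite -!mulrA [C * _]mulrC; linarith.
  have hn := near _ Du nr.
  have low : k * (9 / 10) <= nm (conjc (T u0) * (Z u - Z u0) - 'i%C * k%:C%C).
    have nr' : nm (Z u - Z u0) < r by move: nr; rewrite lt_min => /andP[].
    have := chart0 Du0 Du nr'.
    move: (conjc (T u0) * (Z u - Z u0)) => xi hxi; rewrite leNgt; apply/negP => lt.
    have := Re_bound (xi - 'i%C * k%:C%C); have := Im_bound (xi - 'i%C * k%:C%C).
    rewrite cReB cImB (ReIm_i _).1 (ReIm_i _).2 /= oppr0 subr0 => -[b1 b2] b3.
    have hx : `|Re xi| <= k * (9 / 10) by rewrite ler_norml; linarith.
    by move: hxi; rewrite ler_norml => /andP[]; linarith.
  have h1 := ler_wpM2r g0 low; rewrite hg in h1.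
  have h2 := ler_pM (mulr_ge0 (ltW k0) g0) Q0 (_ : k * nm (g' u) <= 10 / 9) hn.
  by apply: (le_trans (h2 _)); linarith.
have [P2 P2E] : exists P2, forall z w, ev2 P2 z w =
    'i%C * k%:C%C * ev2 P' z w * ev2 Q z w.
  by exists (('i%C * k%:C%C)%:P%:P * P' * Q) => z w; rewrite !ev2M ev2C.
have Y u : D u -> nm (ev2 P2 (Z u) (W u)) <= 1 / 2.
  move=> Du; rewrite P2E !nmM nm_i nm_real gtr0_norm // mul1r.
  have h1 : nm (ev2 P' (Z u) (W u) - g' u) <= 1 / (4 * k * C).
    by have := hP' _ Du; rewrite (nmBC (g' u)) le_min => /andP[].
  have h2 : nm (ev2 P' (Z u) (W u)) <= nm (g' u) + 1 / (4 * k * C).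
    by have := nmD (ev2 P' (Z u) (W u) - g' u) (g' u); rewrite subrK; linarith.
  have h3 := ler_wpM2r (nm_ge0 (ev2 Q (Z u) (W u))) (ler_wpM2l (ltW k0) h2).
  apply: (le_trans h3).
  have h4 : k * (1 / (4 * k * C)) * nm (ev2 Q (Z u) (W u)) <= k * (1 / (4 * k * C)) * C.
    by rewrite ler_wpM2l ?hC // mulr_ge0 ?(ltW k0) // divr_ge0 // !mulr_ge0 // ltW.
  have e : k * (1 / (4 * k * C)) * C = 1 / 4 by field; rewrite !gt_eqF.
  by rewrite mulrDr mulrDl; apply: (le_trans (lerD (kg _ Du) h4)); rewrite e; linarith.
have := hull _ _ aX; have := hull _ _ Y.
rewrite P2E P1E Qq mulr1 Xq mulNr -opprD nmN.
(* [y] is the value of [P2] at the given point and [- (y + 1)] that of [P1]; the bounds 1/2 and 1/4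
   contradict each other. *)
move: ('i%C * k%:C%C * _) => y hy1 hy2; have := nmB (y + 1) y.
have -> : y + 1 - y = 1 by ring.
by rewrite nm1; linarith.
Qed.

End Unzip.

(** * Fibres of Z *)

Section Fibres.
Variables (R : realType) (Z W T : R[i] -> R[i]) (r : R).
Let D (u : R[i]) := nm u <= 1.
Hypotheses (cD : ccompact D) (cZ : ccont D Z) (cW : ccont D W) (cT : ccont D T).
Hypothesis inj : forall u v, D u -> D v -> Z u = Z v -> W u = W v -> u = v.
Hypothesis r0 : 0 < r.
Hypothesis T1 : forall u, D u -> nm (T u) = 1.
Hypothesis chart : forall u0 u v, D u0 -> D u -> D v ->
  nm (Z u - Z u0) < r -> nm (Z v - Z u0) < r ->
  `|Im (conjc (T u0) * (Z v - Z u))| <= (1 / 10) * `|Re (conjc (T u0) * (Z v - Z u))|.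
Hypothesis Tclose : forall u0 u, D u0 -> D u -> nm (Z u - Z u0) < r ->
  nm (T u - T u0) <= 1 / 10.
Hypothesis no_extremum : forall u0 d, 0 < d -> (forall u, nm (u - u0) < d -> D u) ->
  (exists2 u, nm (u - u0) < d & 0 < Re (conjc (T u0) * (Z u - Z u0))) /\
  (exists2 u, nm (u - u0) < d & Re (conjc (T u0) * (Z u - Z u0)) < 0).

Let S u0 u := D u /\ Z u = Z u0.

Lemma ccompact_level (A : R[i] -> Prop) f c : ccompact A -> ccont A f ->
  ccompact (fun u => A u /\ f u = c).
Proof.
move=> cA cf; apply: (ccompact_closed cA) => [u []//|u0 Au0 ne].
have e0 : 0 < nm (f u0 - c).
  by rewrite nm_gt0 subr_eq0; apply/eqP => e; apply: ne.
have [d d0 hd] := cf _ Au0 _ e0; exists d => // u [Au fu]; rewrite leNgt; apply/negP => h.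
by have := hd _ Au h; rewrite fu nmBC ltxx.
Qed.

(** The inverse of a continuous injection of a compact set is uniformly continuous: points at
    distance [e / 2] or more from [u0] have images at a positive distance from [f u0]. *)
Lemma injective_unif A (f : R[i] -> R[i]) (e : R) : ccompact A -> ccont A f ->
  (forall u v, A u -> A v -> f u = f v -> u = v) -> 0 < e ->
  exists2 d, 0 < d & forall u v, A u -> A v -> nm (f u - f v) < d -> nm (u - v) < e.
Proof.
move=> cA cf inj0 e0.
have [||d d0 h] := cA (fun u d => forall v, A v -> nm (f u - f v) < d -> nm (u - v) < e).
- by move=> u d d' le h v Av hv; apply: h => //; exact: lt_le_trans le.
- move=> u0 Au0.
  have cF : ccompact (fun v => A v /\ e / 2 <= nm (v - u0)).
    apply: (ccompact_closed cA) => [u []//|v0 Av0 ne].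
    exists (e / 2 - nm (v0 - u0)).
      by rewrite subr_gt0 ltNge; apply/negP => h; apply: ne.
    by move=> v [Av hv]; have := nm_tri v0 v u0; lra.
  have [||m m0 hm] := ccont_min cF (f := fun v => f v - f u0).
  - by apply: ccontB; [apply: ccont_sub cf => u []|exact: ccont_cst].
  - move=> v [Av hv]; rewrite subr_eq0; apply/eqP => /inj0 ev.
    by move: hv; rewrite ev // subrr nm0; lra.
  have m2 : 0 < m / 2 by rewrite divr_gt0.
  have [d d0 hd] := cf _ Au0 _ m2.
  exists (Num.min (m / 2) (Num.min d (e / 2))); first by rewrite !lt_min m2 d0 divr_gt0.
  move=> u Au; rewrite !lt_min => /and3P[_ l1 l2] v Av; rewrite lt_min => /andP[l3 _].
  have lv : nm (v - u0) < e / 2.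
    rewrite ltNge; apply/negP => hv; have := hm _ (conj Av hv).
    have := hd _ Au l1; have := nm_tri (f u) (f v) (f u0); rewrite (nmBC (f v) (f u)); lra.
  by have := nm_tri u0 u v; rewrite (nmBC u0); lra.
by exists d => // u v Au Av; exact: h.
Qed.

Variables (th : R[i] -> R) (rho : R).
Hypothesis cth : ccont D (fun u => (th u)%:C%C).
Hypothesis th_fibre : forall u v, D u -> D v -> Z u = Z v ->
  th u = th v \/ 1 <= `|th u - th v|.
Hypothesis rho0 : 0 < rho.
Hypothesis th_mono : forall u0 u, D u0 -> D u -> nm (Z u - Z u0) < rho ->
  `|th u - th u0| < 1 / 2 ->
  (0 < Re (conjc (T u0) * (Z u - Z u0)) -> th u0 < th u) /\
  (Re (conjc (T u0) * (Z u - Z u0)) < 0 -> th u < th u0).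

Lemma th_no_extremum u0 d : 0 < d -> (forall u, nm (u - u0) < d -> D u) ->
  ~ (forall u, nm (u - u0) < d -> th u <= th u0) /\
  ~ (forall u, nm (u - u0) < d -> th u0 <= th u).
Proof.
move=> d0 dD; have Du0 : D u0 by apply: dD; rewrite subrr nm0.
have [d1 d10 h1] := cZ Du0 rho0.
have half : 0 < 1 / 2 :> R by lra.
have [d2 d20 h2] := cth Du0 half.
pose m := Num.min d (Num.min d1 d2).
have m0 : 0 < m by rewrite !lt_min d0 d10.
have hm u : nm (u - u0) < m -> [/\ nm (u - u0) < d, D u, nm (Z u - Z u0) < rho &
    `|th u - th u0| < 1 / 2].
  rewrite !lt_min => /and3P[l0 l1 l2]; have Du := dD _ l0; split=> //; first exact: h1.
  by have := h2 _ Du l2; rewrite -rmorphB nm_real.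
have mD u : nm (u - u0) < m -> D u by case/hm.
have [[u hu xu] [v hv xv]] := no_extremum m0 mD.
have [du Du zu tu] := hm _ hu; have [dv Dv zv tv] := hm _ hv.
split=> h.
  by have := h _ du; rewrite leNgt (th_mono Du0 Du zu tu).1.
by have := h _ dv; rewrite leNgt (th_mono Du0 Dv zv tv).2.
Qed.

Lemma ccompact_fibre u0 : ccompact (S u0).
Proof. exact: ccompact_level cZ. Qed.

(** Heights over one point agree or differ by at least 1, so level sets of [th] are open in the
    fibre, and roots chosen independently on each of them form a continuous root. *)
Lemma fibre_HasSqrt u0 w0 : (forall u, D u -> Z u = Z u0 -> W u != w0) ->
  HasSqrt (S u0) (fun u => W u - w0).
Proof.
move=> miss; pose L t u := D u /\ (Z u = Z u0 /\ th u = t).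
have LS t u : L t u -> S u0 u by case=> Du [].
have sq t : HasSqrt (L t) (fun u => W u - w0).
  have cL : ccompact (L t).
    have c1 : ccont (S u0) (fun u => (th u)%:C%C) by apply: ccont_sub cth => u [].
    apply: (ccompact_closed (@ccompact_fibre u0)) => [u [Du []]//|u1 Su1 ne].
    have e0 : 0 < nm ((th u1)%:C%C - t%:C%C).
      rewrite -rmorphB nm_real normr_gt0 subr_eq0; apply/eqP => e; apply: ne.
      by case: Su1 => Du1 Z1; split.
    have [d d0 hd] := c1 _ Su1 _ e0; exists d => // u Lu; rewrite leNgt; apply/negP => h.
    by have := hd _ (LS _ _ Lu) h; case: Lu => _ [_ ->]; rewrite nmBC ltxx.
  have cWL : ccont (L t) W by apply: ccont_sub cW => u [].
  apply: (sqrt_of_gaps cL).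
  - by apply: ccontB cWL _; exact: ccont_cst.
  - by move=> u [Du [Zu _]]; rewrite subr_eq0 miss.
  apply: (no_gaps_of_no_extremum (f := th) (t := t) cD _ cL cth) => [u [Du []]//|].
  exact: th_no_extremum.
have [s hs] := @choice _ _ (fun (t : R) (s : R[i] -> R[i]) =>
    ccont (L t) s /\ forall u, L t u -> s u ^+ 2 = W u - w0)
    (fun t => let: ex_intro2 s h1 h2 := sq t in ex_intro _ s (conj h1 h2)).
have Lth u : S u0 u -> L (th u) u by case.
exists (fun u => s (th u) u) => [u1 Su1 e e0|u Su]; last exact: (hs _).2 (Lth _ Su).
have half : 0 < 1 / 2 :> R by lra.
have [d d0 hd] := cth Su1.1 half; have [d' d'0 hd'] := (hs (th u1)).1 _ (Lth _ Su1) _ e0.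
exists (Num.min d d'); first by rewrite lt_min d0.
move=> u Su; rewrite lt_min => /andP[l1 l2].
have et : th u = th u1.
  have := hd _ Su.1 l1; rewrite -rmorphB nm_real.
  by have [->//|] := th_fibre Su.1 Su1.1 (etrans Su.2 (esym Su1.2)); lra.
by rewrite et; apply: hd' => //; rewrite -et; exact: Lth.
Qed.

Lemma fibre_W_unif u0 (e : R) : 0 < e -> exists2 d, 0 < d &
  forall u v, S u0 u -> S u0 v -> nm (W u - W v) < d -> nm (u - v) < e.
Proof.
apply: injective_unif; [exact: ccompact_fibre|by apply: ccont_sub cW => u []|].
by move=> u v [Du Zu] [Dv Zv]; apply: inj => //; rewrite Zu.
Qed.

Lemma fibre_Inv u0 w0 : (forall u, D u -> Z u = Z u0 -> W u != w0) ->
  Inv Z W (S u0) (fun u => W u - w0).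
Proof.
move=> miss; have [s cs hs] := fibre_HasSqrt miss.
have cS := @ccompact_fibre u0.
apply: (@Inv_of_sqrt _ Z W (S u0) _ _ _ w0 s) => //.
- by apply: ccont_sub cZ => u [].
- by apply: ccont_sub cW => u [].
- by move=> u [Du Zu]; exact: miss.
move=> e e0; have [d d0 hd] := ccont_unif cS cs e0.
have [d' d'0 hd'] := fibre_W_unif u0 d0.
by exists d' => // u v Su Sv l; apply: hd => //; exact: hd'.
Qed.

(** On the fibre [W] has a uniformly continuous inverse, so the height difference of at least 1
    between upper and lower sheets becomes a positive distance between their images under [W]. *)
Lemma fibre_idempotent u0 : D u0 -> exists2 E, Ap Z W (S u0) E &
  forall u, D u -> Z u = Z u0 -> (th u0 <= th u -> E u = 1) /\ (th u < th u0 -> E u = 0).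
Proof.
move=> Du0; have cS := @ccompact_fibre u0.
have [d d0 hd] := ccont_unif cD cth (ltr01 : (0 : R) < 1).
have [d' d'0 hd'] := fibre_W_unif u0 d0.
have [||||E AE hE] := @separating_idempotent _ Z W (S u0) cS _ _
    (fun u => th u0 <= th u) d' _ d'0.
- by apply: ccont_sub cZ => u [].
- by apply: ccont_sub cW => u [].
- by move=> b mb; apply: fibre_Inv => u Du Zu; exact: mb.
- move=> u v [Du Zu] [Dv Zv] Qu /negP; rewrite -ltNge => Qv.
  rewrite leNgt; apply/negP => /(hd' _ _ (conj Du Zu) (conj Dv Zv)) /(hd _ _ Du Dv).
  rewrite -rmorphB nm_real.
  by have [e|] := th_fibre Du Dv (etrans Zu (esym Zv)); [move: Qu Qv; rewrite e|]; lra.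
exists E => // u Du Zu; have [h1 h2] := hE _ (conj Du Zu); split=> // h; apply: h2.
by apply/negP; rewrite -ltNge.
Qed.

End Fibres.

(** What is left of the geometry: the curve is locally a graph of slope at most 1/10 over the
    direction [T], and position along [T] has no extremum at interior points of the disc. *)
Lemma hull_of_disc (R : realType) (Z W T : R[i] -> R[i]) (r : R) zq wq :
  let D u := nm u <= 1 in
  ccompact D -> ccont D Z -> ccont D W -> ccont D T ->
  (forall u v, D u -> D v -> Z u = Z v -> W u = W v -> u = v) ->
  0 < r -> (forall u, D u -> nm (T u) = 1) ->
  (forall u0 u v, D u0 -> D u -> D v -> nm (Z u - Z u0) < r -> nm (Z v - Z u0) < r ->
    `|Im (conjc (T u0) * (Z v - Z u))| <= (1 / 10) * `|Re (conjc (T u0) * (Z v - Z u))|) ->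
  (forall u0 u, D u0 -> D u -> nm (Z u - Z u0) < r -> nm (T u - T u0) <= 1 / 10) ->
  (forall u0 d, 0 < d -> (forall u, nm (u - u0) < d -> D u) ->
    (exists2 u, nm (u - u0) < d & 0 < Re (conjc (T u0) * (Z u - Z u0))) /\
    (exists2 u, nm (u - u0) < d & Re (conjc (T u0) * (Z u - Z u0)) < 0)) ->
  (forall P M, (forall u, D u -> nm (ev2 P (Z u) (W u)) <= M) -> nm (ev2 P zq wq) <= M) ->
  exists u, [/\ D u, Z u = zq & W u = wq].
Proof.
move=> D cD cZ cW cT inj r0 T1 chart Tclose noext hull.
have [th [cth fib [rho rho0 mono]]] := monotone_lift cD cZ r0 T1 chart Tclose.
apply: (hull_in_image (th := th) (rho := rho) cD cZ cW cT r0 rho0 T1 chart cth fib) hull.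
- by move=> u0 u Du0 Du zu tu; exact: (mono _ _ Du0 Du zu tu).1.
- exact: (fibre_idempotent cD cZ cW inj noext cth fib rho0 mono).
by move=> u0 w0 _; exact: (fibre_Inv cD cZ cW inj noext cth fib rho0 mono).
Qed.

(** * Level curves *)

Import numFieldNormedType.Exports.
Local Open Scope classical_set_scope.

Section Coordinates.
Variable R : realType.
Implicit Types (u v z : R[i]) (x y : 'rV[R]_2).

Definition plane u : 'rV[R]_2 := \row_(j < 2) (if (j : nat) == 0%N then Re u else Im u).
Definition planeV x : R[i] := Complex (x o1_0 o2_0) (x o1_0 o2_1).

Lemma planeK u : planeV (plane u) = u.
Proof. by rewrite /planeV !mxE /=; case: u. Qed.

Lemma planeVK x : plane (planeV x) = x.
Proof.
apply/rowP => j; rewrite mxE /=; case: j => -[|[|//]] hj /=.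
  by congr (x _ _); apply: val_inj.
by congr (x _ _); apply: val_inj.
Qed.

Lemma planeD u v : plane (u + v) = plane u + plane v.
Proof. by apply/rowP => j; rewrite !mxE cReD cImD; case: ifP. Qed.

Lemma planeZ (t : R) v : plane (t%:C%C * v) = t *: plane v.
Proof. by apply/rowP => j; rewrite !mxE cReM cImM /=; case: ifP; rewrite mul0r ?subr0 ?addr0. Qed.

Lemma planeB u v : plane (u - v) = plane u - plane v.
Proof. by apply/rowP => j; rewrite !mxE cReB cImB; case: ifP. Qed.

Lemma coord_le m n (M : 'M[R]_(m, n)) i j : `|M i j| <= `|M|.
Proof.
have := le_bigmax 0 (fun ij : 'I_m * 'I_n => `|M ij.1 ij.2|) (i, j).
by rewrite (_ : `|M| = mx_norm M) // mx_normrE.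
Qed.

Lemma norm_plane u : `|plane u| <= nm u.
Proof.
have nE : `|plane u| = mx_norm (plane u) by [].
have [E|/mx_norm_neq0 [[i j] /= E]] := eqVneq (mx_norm (plane u)) 0.
  by rewrite nE E nm_ge0.
rewrite nE E mxE; case: ifP => _; rewrite ler_norml; apply/andP.
  exact: Re_bound.
exact: Im_bound.
Qed.

(** Compactness of a square, read as a covering principle for the filter of small positive radii, is
    [ccompact]; the disc is closed in the square. *)
Lemma ccompact_disc : ccompact (fun u : R[i] => nm u <= 1).
Proof.
pose Sq u := `|Re u| <= 1 /\ `|Im u| <= 1.
have cS : ccompact Sq.
  move=> Q mQ lQ.
  have /compact_near_coveringP cv : compact [set v : 'rV[R]_2 | forall i, `[-1, 1] (v ord0 i)].
    by apply: (@rV_compact R 2 (fun=> `[-1, 1])) => i; exact: segment_compact.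
  have SqP x : (forall i, `[-1, 1] (x ord0 i)) -> Sq (planeV x).
    move=> h; rewrite /Sq /= !ler_norml; have := h o2_0; have := h o2_1.
    rewrite !set_itvE /= (_ : ord0 = o1_0); last exact: val_inj.
    by move=> -> ->.
  have loc x : (forall i, `[-1, 1] (x ord0 i)) ->
      \forall x' \near x & d \near (0 : R)^'+, Sq (planeV x') -> Q (planeV x') d.
    move=> Kx; have [d0 d00 h] := lQ _ (SqP _ Kx).
    have d2 : 0 < d0 / 2 by rewrite divr_gt0.
    exists (ball x (d0 / 2), [set d | d < d0]) => /=.
      by split; [exact: nbhsx_ballx|exact: nbhs_right_lt].
    move=> [x' d] /= [Bx ld] Sx'; apply: (mQ _ d0); first exact: ltW.
    apply: h => //; apply: (le_lt_trans (nm_le_ReIm _)).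
    move: Bx; rewrite -ball_normE /= => Bx.
    have l j : `|x' o1_0 j - x o1_0 j| < d0 / 2.
      by apply: le_lt_trans Bx; rewrite distrC; have := coord_le (x - x') o1_0 j; rewrite !mxE.
    by have := l o2_0; have := l o2_1; linarith.
  have H := cv R ((0 : R)^'+) (fun d x => Sq (planeV x) -> Q (planeV x) d) _ loc.
  have [d [d0 hd]] : exists d : R, 0 < d /\ forall x, (forall i, `[-1, 1] (x ord0 i)) ->
      Sq (planeV x) -> Q (planeV x) d.
    near (0 : R)^'+ => d; exists d; split; first by near: d; exact: nbhs_right_gt.
    by near: d; exact: H.
  exists d => // u Su; rewrite -(planeK u); apply: hd; last by rewrite planeK.
  by move=> i; rewrite mxE set_itvE /= -ler_norml; case: Su; case: ifP.
have nb (u : R[i]) : nm u <= 1 -> Sq u.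
  move=> h; split; apply: le_trans h; rewrite ler_norml; apply/andP.
    exact: Re_bound.
  exact: Im_bound.
apply: (ccompact_closed cS nb) => u0 _ /negP; rewrite -ltNge => h.
exists (nm u0 - 1); first by rewrite subr_gt0.
by move=> u hu; have := nm_lowB u0 u; rewrite (nmBC u0); linarith.
Unshelve. all: by end_near.
Qed.
End Coordinates.

Section Lines.
Variables (R : realType) (V W : normedModType R).

Lemma difference_quotient_line (f : V -> W) a v (t : R) :
  (fun s : R => s^-1 *: (((fun s => f (a + s *: v)) \o shift t) (s *: (1 : R)) - f (a + t *: v))) =
  (fun s : R => s^-1 *: ((f \o shift (a + t *: v)) (s *: v) - f (a + t *: v))).
Proof.
apply/funext => s /=; congr (_ *: (f _ - _)).
by rewrite scalerDl addrCA [s *: (1 : R)]mulr1.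
Qed.

Lemma derivable_line (f : V -> W) a v (t : R) :
  derivable f (a + t *: v) v -> derivable (fun s : R => f (a + s *: v)) t 1.
Proof. by rewrite /derivable difference_quotient_line. Qed.

Lemma derive_line (f : V -> W) a v (t : R) :
  'D_1 (fun s : R => f (a + s *: v)) t = 'D_v f (a + t *: v).
Proof. by rewrite /derive difference_quotient_line. Qed.

End Lines.

(** [smooth] speaks of directional derivatives, the mean value theorem of functions on [R];
    restriction to a line connects them. *)
Lemma line_MVT (R : realType) (V : normedModType R) (f : V -> R) a v (s : R) : (forall x, derivable f x v) ->
  exists2 c, `|c| <= `|s| & f (a + s *: v) - f a = s * 'D_v f (a + c *: v).
Proof.
move=> df; pose phi (t : R) : R := f (a + t *: v).
have dphi (t : R) : is_derive t 1 phi ('D_v f (a + t *: v)).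
  by apply: DeriveDef; [exact: derivable_line|exact: derive_line].
have cphi x y : {within `[x, y], continuous phi}.
  by apply: derivable_within_continuous => t _; case: (dphi t).
have p0 : phi 0 = f a by rewrite /phi scale0r addr0.
have [s0|s0|->] := ltrgtP s 0; last by exists 0 => //; rewrite scale0r addr0 subrr mul0r.
  have [c] := MVT s0 (fun t _ => dphi t) (cphi _ _).
  rewrite in_itv /= p0 => /andP[c1 c2] e; exists c; first by rewrite !ler0_norm; linarith.
  by rewrite -/(phi s); linarith.
have [c] := MVT s0 (fun t _ => dphi t) (cphi _ _).
rewrite in_itv /= p0 => /andP[c1 c2] e; exists c; first by rewrite !ger0_norm; linarith.
by rewrite -/(phi s); linarith.
Qed.

Lemma rotated_unit_lip (R : realType) (x y : R[i]) (a b : R) : nm x = a -> nm y = b ->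
  x != 0 -> y != 0 ->
  nm ('i%C * x / a%:C%C - 'i%C * y / b%:C%C) <= 2 / b * nm (x - y).
Proof.
move=> xa yb; rewrite -(nm_gt0 x) -(nm_gt0 y) xa yb => n1 n0.
have hd : `|b - a| <= nm (x - y).
  rewrite ler_norml; have := nm_lowB y x; have := nm_lowB x y.
  by rewrite (nmBC y) xa yb; linarith.
have ea : a%:C%C != 0 :> R[i] by rewrite -nm_gt0 nm_real normr_gt0 gt_eqF.
have eb : b%:C%C != 0 :> R[i] by rewrite -nm_gt0 nm_real normr_gt0 gt_eqF.
have -> : 'i%C * x / a%:C%C - 'i%C * y / b%:C%C =
    'i%C * (x / a%:C%C * ((b - a) / b)%:C%C + (x - y) * (b^-1)%:C%C).
  rewrite !rmorphM !rmorphB !fmorphV /=; move: a%:C%C b%:C%C ea eb => c d ea eb.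
  by field; rewrite ea eb.
rewrite nmM nm_i mul1r.
apply: (le_trans (nmD _ _)); rewrite !nmM nmV !nm_real (gtr0_norm n1) xa divff ?gt_eqF // mul1r.
rewrite normrM normfV (gtr0_norm n0).
have : `|b - a| / b <= nm (x - y) / b by rewrite ler_pM2r ?invr_gt0.
by linarith.
Qed.

(** * Gradient, unit tangent and charts of the level curve *)

Section LevelSet.
Variables (R : realType) (h : 'rV[R]_2 -> R).
Hypothesis sh : smooth h.
Implicit Types (z p q w : R[i]).

Definition grad z : R[i] :=
  Complex ('D_(plane 1) h (plane z)) ('D_(plane 'i%C) h (plane z)).

Lemma continuous_plane (f : 'rV[R]_2 -> R) z0 (e : R) : continuous f -> 0 < e ->
  exists2 d, 0 < d & forall z, nm (z - z0) < d -> `|f (plane z) - f (plane z0)| < e.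
Proof.
move=> cf e0; have /cvgrPdist_lt /(_ _ e0) := cf (plane z0).
move=> /nbhs_ballP [d /= d0 hd]; exists d => // z hz.
rewrite distrC; apply: hd; rewrite -ball_normE /= -planeB.
by apply: le_lt_trans (norm_plane _) _; rewrite nmBC.
Qed.

Lemma grad_continuous z0 (e : R) : 0 < e ->
  exists2 d, 0 < d & forall z, nm (z - z0) < d -> nm (grad z - grad z0) < e.
Proof.
move=> e0; have e2 : 0 < e / 2 by rewrite divr_gt0.
have [d1 d10 h1] := continuous_plane z0 (sh [:: plane 1]).1 e2.
have [d2 d20 h2] := continuous_plane z0 (sh [:: plane 'i%C]).1 e2.
exists (Num.min d1 d2); first by rewrite lt_min d10.
move=> z; rewrite lt_min => /andP[/h1 l1 /h2 l2].
by apply: (le_lt_trans (nm_le_ReIm _)); rewrite cReB cImB [ltRHS]splitr ltrD.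
Qed.

(** Strict differentiability, with both points free, as needed for pairs of points of the curve. It
    follows from continuity of the partial derivatives along an axis-parallel path from [p] to
    [q]. *)
Lemma first_order z0 (e : R) : 0 < e -> exists2 d, 0 < d & forall p q,
  nm (p - z0) < d -> nm (q - z0) < d ->
  `|h (plane q) - h (plane p) - Re (conjc (grad z0) * (q - p))| <= e * nm (q - p).
Proof.
move=> e0; have e2 : 0 < e / 2 by rewrite divr_gt0.
have [d d0 hd] := grad_continuous z0 e2.
(* The mean value points are up to [4 / 5 * d] away from [p], hence within [d] of [z0]. *)
exists (d / 5) => [|p q hp hq]; first by rewrite divr_gt0.
have hw : nm (q - p) < 2 / 5 * d by have := nm_tri z0 q p; rewrite (nmBC z0 p); linarith.
pose x := Re (q - p); pose y := Im (q - p).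
have hx : `|x| <= nm (q - p) by rewrite ler_norml; apply/andP; exact: Re_bound.
have hy : `|y| <= nm (q - p) by rewrite ler_norml; apply/andP; exact: Im_bound.
have [c1 c1x E1] := line_MVT (plane p) x ((sh [::]).2 (plane 1)).
have [c2 c2y E2] := line_MVT (plane p + x *: plane 1) y ((sh [::]).2 (plane 'i%C)).
have eq : plane p + x *: plane 1 + y *: plane 'i%C = plane q.
  rewrite -!planeZ -!planeD; congr plane; apply/eqP.
  by rewrite eq_complex !cReD !cImD !cReM !cImM /= /x /y cReB cImB; apply/andP; split; apply/eqP; ring.
have g1 : `|'D_(plane 1) h (plane p + c1 *: plane 1) - Re (grad z0)| <= e / 2.
  rewrite -planeZ -planeD mulr1; have : nm (p + c1%:C%C - z0) < d.
    by rewrite addrAC; have := nmD (p - z0) c1%:C%C; rewrite nm_real; linarith.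
  move=> /hd /ltW; apply: le_trans; rewrite ler_norml; apply/andP.
  by have := Re_bound (grad (p + c1%:C%C) - grad z0); rewrite cReB.
have g2 : `|'D_(plane 'i%C) h (plane p + x *: plane 1 + c2 *: plane 'i%C) - Im (grad z0)| <= e / 2.
  rewrite -!planeZ -!planeD mulr1; have : nm (p + x%:C%C + c2%:C%C * 'i%C - z0) < d.
    have -> : p + x%:C%C + c2%:C%C * 'i%C - z0 = (p - z0) + x%:C%C + c2%:C%C * 'i%C by ring.
    have := nmD (p - z0 + x%:C%C) (c2%:C%C * 'i%C); have := nmD (p - z0) x%:C%C.
    by rewrite nmM !nm_real nm_i mulr1; linarith.
  move=> /hd /ltW; apply: le_trans; rewrite ler_norml; apply/andP.
  by have := Im_bound (grad (p + x%:C%C + c2%:C%C * 'i%C) - grad z0); rewrite cImB.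
rewrite /= eq in E1 E2.
move: E1 E2 g1 g2.
move: ('D_(plane 1) h (plane p + c1 *: plane 1)) => a.
move: ('D_(plane 'i%C) h (plane p + x *: plane 1 + c2 *: plane 'i%C)) => b.
move: (grad z0) (h (plane p + x *: plane 1)) => G hm E1 E2 g1 g2.
have -> : h (plane q) - h (plane p) - Re (conjc G * (q - p)) =
    x * (a - Re G) + y * (b - Im G).
  rewrite cReM cReJ cImJ -/x -/y.
  have -> : h (plane q) - h (plane p) = x * a + y * b by rewrite -E1 -E2; ring.
  by ring.
clearbody x y; move: (Re G) (Im G) g1 g2 => A B g1 g2.
apply: (le_trans (ler_normD _ _)); rewrite !normrM.
have l1 : `|x| * `|a - A| <= nm (q - p) * (e / 2) by exact: ler_pM.
have l2 : `|y| * `|b - B| <= nm (q - p) * (e / 2) by exact: ler_pM.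
by apply: (le_trans (lerD l1 l2)); rewrite -mulrDr -splitr mulrC.
Qed.

(** [G_h] is stated with the total differential, [grad] with directional derivatives. If [grad z]
    vanishes, [first_order] identifies the differential as 0. *)
Lemma grad_neq0 z : E_h_star h (plane z) -> grad z != 0.
Proof.
move=> [nG hz]; apply/eqP => g0; apply: nG; split=> // v.
rewrite (@diff_unique R _ _ h (\0 : {linear 'rV[R]_2 -> R}) (plane z)) //.
  by move=> x; apply: cst_continuous.
refine (proj2 (eqaddoP _ _ _ _) _) => _/posnumP[e]; have e2 : 0 < e%:num / 2 by rewrite divr_gt0.
have [d d0 hd] := first_order z e2.
apply/nbhs_ballP; exists (d / 2) => /=; first by rewrite divr_gt0.
move=> x; rewrite -ball_normE /= sub0r normrN => hx.
have hy : nm (planeV x) <= 2 * `|x|.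
  by apply: (le_trans (nm_le_ReIm _)) => /=; have := coord_le x o1_0 o2_0; have := coord_le x o1_0 o2_1; linarith.
have yd : nm (z + planeV x - z) < d by rewrite addrAC subrr add0r; linarith.
have zd : nm (z - z) < d by rewrite subrr nm0.
have := hd _ _ zd yd; rewrite g0 conjc0 mul0r subr0 addrAC subrr add0r.
rewrite planeD planeVK [plane z + x]addrC /= => le1.
have -> : (h \o +%R^~ (plane z) - (cst (h (plane z)) + \0)) x =
    h (x + plane z) - h (plane z).
  by rewrite -[LHS]/(h (x + plane z) - (h (plane z) + 0)) addr0.
apply: (le_trans le1); apply: (le_trans (ler_wpM2l (ltW e2) hy)).
by rewrite mulrA divfK.
Qed.

Definition tangent z : R[i] := 'i%C * grad z / (nm (grad z))%:C%C.

Lemma tangent_unit z : grad z != 0 -> nm (tangent z) = 1.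
Proof.
rewrite -nm_gt0 => g0; rewrite /tangent nmf nmM nm_real gtr0_norm //.
by rewrite nm_i mul1r divff ?gt_eqF.
Qed.

Lemma tangent_lip z z0 : grad z != 0 -> grad z0 != 0 ->
  nm (tangent z - tangent z0) <= 2 / nm (grad z0) * nm (grad z - grad z0).
Proof. exact: rotated_unit_lip. Qed.

Lemma tangent_continuous z0 (e : R) : grad z0 != 0 -> 0 < e ->
  exists2 d, 0 < d & forall z, nm (z - z0) < d -> grad z != 0 /\ nm (tangent z - tangent z0) < e.
Proof.
move=> g0 e0; have n0 : 0 < nm (grad z0) by rewrite nm_gt0.
have m0 : 0 < Num.min (nm (grad z0)) (e * nm (grad z0) / 2).
  by rewrite lt_min n0 divr_gt0 // mulr_gt0.
have [d d0 hd] := grad_continuous z0 m0; exists d => // z /hd; rewrite lt_min => /andP[l1 l2].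
have g1 : grad z != 0.
  by apply: contraTneq l1 => ->; rewrite sub0r nmN ltxx.
split=> //; apply: (le_lt_trans (tangent_lip g1 g0)).
by rewrite -ltr_pdivlMl ?divr_gt0 // invf_div; linarith.
Qed.

(** Between two points of the level set, [first_order] makes [q - p] almost orthogonal to the
    gradient. The errors are [1 / 100] from the expansion and [1 / 40] from the turning of the
    tangent, well within 1/10. *)
Lemma level_chart z0 : grad z0 != 0 -> exists2 d, 0 < d & forall z p q,
  nm (z - z0) < d -> nm (p - z0) < d -> nm (q - z0) < d ->
  h (plane p) = 0 -> h (plane q) = 0 ->
  `|Im (conjc (tangent z) * (q - p))| <= (1 / 10) * `|Re (conjc (tangent z) * (q - p))|.
Proof.
move=> g0; have n0 : 0 < nm (grad z0) by rewrite nm_gt0.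
pose e := nm (grad z0) / 100; have e0 : 0 < e by rewrite divr_gt0.
have e40 : 0 < 1 / 40 :> R by linarith.
have [d1 d10 h1] := first_order z0 e0.
have [d2 d20 h2] := tangent_continuous g0 e40.
exists (Num.min d1 d2); first by rewrite lt_min d10.
move=> z p q; rewrite !lt_min => /andP[_ z2] /andP[p1 _] /andP[q1 _] hp hq.
have [g1 tz] := h2 _ z2; have := h1 _ _ p1 q1; rewrite hp hq subrr sub0r normrN.
set w := q - p => lw.
have t1 : `|Im (conjc (tangent z0) * w)| <= nm w / 100.
  have -> : Im (conjc (tangent z0) * w) = - Re (conjc (grad z0) * w) / nm (grad z0).
    have -> : conjc (tangent z0) = (- (nm (grad z0))^-1)%:C%C * ('i%C * conjc (grad z0)).
      rewrite /tangent -fmorphV; move: (nm (grad z0))^-1 => n; case: (grad z0) => a b.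
      by apply/eqP; rewrite eq_complex /=; apply/andP; split; apply/eqP; ring.
    rewrite -mulrA -mulrA; move: (conjc (grad z0) * w) => x.
    by rewrite cImM cReM cImM /=; ring.
  rewrite normrM normrN normfV (gtr0_norm n0) ler_pdivrMr //; move: lw; rewrite /e; linarith.
have t2 : `|Im (conjc (tangent z) * w)| <= nm w / 100 + nm w / 40.
  have -> : conjc (tangent z) * w = conjc (tangent z0) * w + conjc (tangent z - tangent z0) * w.
    by rewrite rmorphB mulrBl addrC subrK.
  rewrite cImD; apply: (le_trans (ler_normD _ _)); apply: lerD => //.
  have : nm (conjc (tangent z - tangent z0) * w) <= nm w / 40.
    rewrite nmM nmJ; have : nm (tangent z - tangent z0) * nm w <= 1 / 40 * nm w.
      by rewrite ler_wpM2r ?nm_ge0 // ltW.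
    by linarith.
  by apply: le_trans; rewrite ler_norml; apply/andP; exact: Im_bound.
have := nm_le_ReIm (conjc (tangent z) * w); rewrite nmM nmJ tangent_unit // mul1r.
move: t2; move: (conjc (tangent z) * w) (nm w) => x n.
by have := normr_ge0 (Re x); linarith.
Qed.

End LevelSet.

(** * Totally real discs *)

Section ComplexCoordinates.
Variable R : realType.
Implicit Types (p q : 'rV[R]_4).

Lemma zcD p q : zc (p + q) = zc p + zc q.
Proof. by apply/eqP; rewrite eq_complex cReD cImD /= !mxE !eqxx. Qed.
Lemma wcD p q : wc (p + q) = wc p + wc q.
Proof. by apply/eqP; rewrite eq_complex cReD cImD /= !mxE !eqxx. Qed.
Lemma zcZ (t : R) p : zc (t *: p) = t%:C%C * zc p.
Proof. by apply/eqP; rewrite eq_complex cReM cImM /= !mxE !mul0r subr0 addr0 !eqxx. Qed.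
Lemma wcZ (t : R) p : wc (t *: p) = t%:C%C * wc p.
Proof. by apply/eqP; rewrite eq_complex cReM cImM /= !mxE !mul0r subr0 addr0 !eqxx. Qed.
Lemma zcB p q : zc (p - q) = zc p - zc q.
Proof. by rewrite -scaleN1r zcD zcZ rmorphN rmorph1 mulN1r. Qed.
Lemma wcB p q : wc (p - q) = wc p - wc q.
Proof. by rewrite -scaleN1r wcD wcZ rmorphN rmorph1 mulN1r. Qed.
Lemma zcJ p : zc (Jc p) = 'i%C * zc p.
Proof. by apply/eqP; rewrite eq_complex cReM cImM /= !mxE /= !mul0r !mul1r sub0r add0r !eqxx. Qed.
Lemma wcJ p : wc (Jc p) = 'i%C * wc p.
Proof. by apply/eqP; rewrite eq_complex cReM cImM /= !mxE /= !mul0r !mul1r sub0r add0r !eqxx. Qed.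

Lemma zc_wc_inj p q : zc p = zc q -> wc p = wc q -> p = q.
Proof.
move=> [e0 e1] [e2 e3]; apply/rowP => j; have -> : (0 : 'I_1) = o1_0 by exact: val_inj.
case: j => -[|[|[|[|//]]]] hj.
- by have -> : Ordinal hj = o4_0 by exact: val_inj.
- by have -> : Ordinal hj = o4_1 by exact: val_inj.
- by have -> : Ordinal hj = o4_2 by exact: val_inj.
- by have -> : Ordinal hj = o4_3 by exact: val_inj.
Qed.

Lemma nm_zc p : nm (zc p) <= 2 * `|p|.
Proof.
apply: (le_trans (nm_le_ReIm _)) => /=.
by have := coord_le p o1_0 o4_0; have := coord_le p o1_0 o4_1; lra.
Qed.

Lemma nm_wc p : nm (wc p) <= 2 * `|p|.
Proof.
apply: (le_trans (nm_le_ReIm _)) => /=.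
by have := coord_le p o1_0 o4_2; have := coord_le p o1_0 o4_3; lra.
Qed.

Lemma pr_z_plane p : pr_z p = plane (zc p).
Proof.
apply/rowP => j; rewrite !mxE /=; case: j => -[|[|//]] hj /=.
  by congr (p _ _); apply: val_inj.
by congr (p _ _); apply: val_inj.
Qed.

Lemma disc_plane (u : R[i]) : @closed_unit_disc R (plane u) <-> nm u <= 1.
Proof.
rewrite /closed_unit_disc /= !mxE /= -nm_sqr; split=> h.
  by rewrite -(@ler_pXn2r _ 2) ?nnegrE ?nm_ge0 // expr1n.
by rewrite -[leRHS](expr1n _ 2) ler_pXn2r ?nnegrE ?nm_ge0.
Qed.

Lemma hpoly_ev2 (P : {poly {poly R[i]}}) : exists n a, forall q,
  hpoly_eval n a q = ev2 P (zc q) (wc q).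
Proof.
pose n := maxn (size P) (\max_(k < size P) size (P`_k)%R).
exists n, (fun j k => (P`_k)`_j) => q.
have sP : (size P <= n)%N by rewrite leq_maxl.
have sk (k : nat) : (size (P`_k)%R <= n)%N.
  have [lt|ge] := ltnP k (size P); last by rewrite nth_default ?size_poly0.
  by rewrite leq_max (leq_bigmax (Ordinal lt)) orbT.
rewrite /ev2 (horner_coef_wide _ sP) horner_sum /hpoly_eval exchange_big /=.
apply: eq_bigr => k _; rewrite hornerM -rmorphXn hornerC (horner_coef_wide _ (sk k)) mulr_suml.
by apply: eq_bigr.
Qed.

(** An independent pair is a real basis of the plane; the coefficients of ['i * al] come from
    Cramer's rule with determinant [a * d - b * c]. *)
Lemma real_basis (al be : R[i]) :
  (forall s t : R, s%:C%C * al + t%:C%C * be = 0 -> s = 0 /\ t = 0) ->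
  exists s t : R, s%:C%C * al + t%:C%C * be = 'i%C * al.
Proof.
case: al be => a b [c d] indep.
have mk (s t x y : R) : s * a + t * c = x -> s * b + t * d = y ->
    s%:C%C * Complex a b + t%:C%C * Complex c d = Complex x y.
  by move=> <- <-; apply/eqP; rewrite eq_complex /=; apply/andP; split; apply/eqP; ring.
have [det0|det] := eqVneq (a * d - b * c) 0; last first.
  exists ((- b * d - a * c) / (a * d - b * c)), ((a ^+ 2 + b ^+ 2) / (a * d - b * c)).
  have -> : 'i%C * Complex a b = Complex (- b) a.
    by apply/eqP; rewrite eq_complex /=; apply/andP; split; apply/eqP; ring.
  by apply: mk; field.
have [c0 a0] : c = 0 /\ - a = 0 by apply: indep; apply: mk; [ring|move: det0; lra].
have [d0 b0] : d = 0 /\ - b = 0 by apply: indep; apply: mk; [move: det0; lra|ring].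
have [/eqP] : (1 : R) = 0 /\ (0 : R) = 0; last by rewrite oner_eq0.
by apply: indep; apply: mk; lra.
Qed.

End ComplexCoordinates.

(** * The differential of the parametrization at interior points *)

Section TotallyRealDisc.
Variables (R : realType) (K N : set 'rV[R]_4).
Variables (f : 'rV[R]_4 -> 'rV[R]_2) (g : 'rV[R]_2 -> 'rV[R]_4).
Hypotheses (trN : totally_real N) (KN : K `<=` N).
Hypothesis gK : forall y, @closed_unit_disc R y -> K (g y).
Hypothesis gf : forall y, @closed_unit_disc R y -> f (g y) = y.
Hypotheses (C1f : C1_map_on K f) (C1g : C1_map_on (@closed_unit_disc R) g).
Let D (u : R[i]) := nm u <= 1.

Lemma disc_ccont u0 (e : R) : D u0 -> 0 < e -> exists2 d, 0 < d & forall u, D u ->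
  nm (u - u0) < d -> `|g (plane u) - g (plane u0)| < e.
Proof.
move=> Du0 e0; have [U [G [oU Ua C1 eG]]] := C1g ((disc_plane u0).2 Du0).
have /differentiable_continuous/cvgrPdist_lt/(_ _ e0) cG := (C1 _ Ua).1.
have : \forall x \near plane u0, `|G (plane u0) - G x| < e /\ U x.
  by apply: filterI; [exact: cG|exact: open_nbhs_nbhs].
move=> /nbhs_ballP [d /= d0 hd].
exists d => // u Du hu.
have : ball (plane u0) d (plane u).
  rewrite -ball_normE /= -planeB.
  by apply: le_lt_trans (norm_plane _) _; rewrite nmBC.
move=> /hd [/= l Uu]; rewrite -(eG _ Uu ((disc_plane u).2 Du)).
by rewrite -(eG _ Ua ((disc_plane u0).2 Du0)) distrC.
Qed.

Section InteriorPoint.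
Variables (u0 : R[i]) (d : R).
Hypotheses (d0 : 0 < d) (interior : forall u, nm (u - u0) < d -> D u).
Let a := plane u0.
Variables (U : set 'rV[R]_2) (G : 'rV[R]_2 -> 'rV[R]_4).
Hypotheses (oU : open U) (Ua : U a) (C1G : C1_on U G)
  (eG : forall x, U x -> @closed_unit_disc R x -> G x = g x).

Lemma interior_near : \forall x \near a, U x /\ @closed_unit_disc R x.
Proof.
apply: filterI; first exact: open_nbhs_nbhs.
apply/nbhs_ballP; exists (d / 2) => /=; first by rewrite divr_gt0.
move=> x; rewrite -ball_normE /= => hx; rewrite -(planeVK x); apply/disc_plane/interior.
apply: (le_lt_trans (nm_le_ReIm _)); rewrite cReB cImB /=.
have := coord_le (a - x) o1_0 o2_0; have := coord_le (a - x) o1_0 o2_1.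
by rewrite !mxE /= ![`|_ - x _ _|]distrC; lra.
Qed.

Lemma dG : differentiable G a. Proof. exact: (C1G Ua).1. Qed.

Lemma Ga : G a = g a.
Proof. by apply: eG => //; case: (nbhs_singleton interior_near). Qed.

Lemma Ka : K (g a).
Proof. by apply: gK; case: (nbhs_singleton interior_near). Qed.

(** Near [a] the extension [F] of the inverse map composed with [G] is the identity, so by the chain
    rule ['d G a] has a left inverse. *)
Lemma differential_inj v : 'd G a v = 0 -> v = 0.
Proof.
have [U' [F [oU' Ua' C1 eF]]] := C1f Ka => dv.
have dF : differentiable F (G a) by rewrite Ga; exact: (C1 _ Ua').1.
have near_id : \forall x \near a, (F \o G) x = x.
  have cG : \forall x \near a, U' (G x).
    by apply: (differentiable_continuous dG); rewrite Ga; exact: open_nbhs_nbhs.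
  near=> x; have [Ux Dx] : U x /\ @closed_unit_disc R x by near: x; exact: interior_near.
  have U'x : U' (G x) by near: x.
  by move: U'x; rewrite /= eG // => U'x; rewrite eF ?gf //; exact: gK.
have : 'D_v (F \o G) a = 0.
  by rewrite (deriveE v (differentiable_comp dG dF)) (diff_comp dG dF) /= dv linear0.
by rewrite (near_eq_derive _ near_id) derive_id.
Unshelve. all: by end_near.
Qed.

Lemma tangent_differential v : tangent_space N (g a) ('d G a v).
Proof.
exists (fun t => G (a + t *: v)).
have aE : a = a + (0 : R) *: v by rewrite scale0r addr0.
have dv : derivable G a v by apply: diff_derivable; exact: dG.
split.
- by rewrite -aE Ga.
- have cl : (fun t : R => a + t *: v) @ 0 --> a.
    rewrite [X in _ --> X]aE; apply: cvgD; first exact: cvg_cst.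
    exact: scalel_continuous.
  near=> t; have [Ux Dx] : U (a + t *: v) /\ @closed_unit_disc R (a + t *: v).
    by near: t; exact: (cl _ interior_near).
  by rewrite eG //; apply/KN/gK.
- by apply: derivable_line; rewrite -aE.
- by rewrite (derive_line G a v 0) -aE deriveE //; exact: dG.
Unshelve. all: by end_near.
Qed.

Lemma first_order_Z v (e : R) : 0 < e -> exists2 t0, 0 < t0 & forall t : R, 0 < `|t| < t0 ->
  nm (zc (g (plane (u0 + t%:C%C * v))) - zc (g (plane u0)) - t%:C%C * zc ('d G a (plane v)))
    <= e * `|t|.
Proof.
move=> e0; have e2 : 0 < e / 2 by rewrite divr_gt0.
have cv : (fun t : R => t^-1 *: (G (t *: plane v + a) - G a)) @ 0^' --> 'd G a (plane v).
  rewrite -(deriveE (plane v) dG); have dv := diff_derivable (v := plane v) dG; exact: dv.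
have : \forall t \near (0 : R)^', `|'d G a (plane v) - t^-1 *: (G (t *: plane v + a) - G a)| < e / 2.
  by move/cvgrPdist_lt: cv; apply.
move=> /nbhs_ballP [t1 t1_0 h1].
have : \forall x \near a, U x /\ @closed_unit_disc R x by exact: interior_near.
move=> /nbhs_ballP [t2 t2_0 h2]; have [t10 t20] : 0 < t1 /\ 0 < t2 by [].
pose B := nm v + 1; have B0 : 0 < B by rewrite /B; have := nm_ge0 v; lra.
exists (Num.min t1 (t2 / B)); first by rewrite lt_min t10 divr_gt0.
move=> t /andP[tn]; rewrite lt_min ltr_pdivlMr // => /andP[l1 l2].
have hl : `|'d G a (plane v) - t^-1 *: (G (t *: plane v + a) - G a)| < e / 2.
  by apply: h1 => /=; rewrite -?normr_gt0 // /ball /= sub0r normrN.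
have ea : plane (u0 + t%:C%C * v) = t *: plane v + a by rewrite planeD planeZ addrC.
have [|Ux Dx] := h2 (plane (u0 + t%:C%C * v)).
  rewrite -ball_normE /= ea opprD addrCA subrr addr0 normrN -planeZ.
  apply: (le_lt_trans (norm_plane _)); rewrite nmM nm_real.
  by apply: le_lt_trans l2; rewrite ler_wpM2l // /B lerDl.
have t0 : t != 0 by rewrite -normr_gt0.
rewrite -(eG Ux Dx) -Ga ea -zcZ -!zcB.
have -> : G (t *: plane v + a) - G a - t *: 'd G a (plane v) =
    - t *: ('d G a (plane v) - t^-1 *: (G (t *: plane v + a) - G a)).
  by rewrite scaleNr scalerBr scalerA divff // scale1r opprB.
rewrite zcZ nmM nm_real normrN mulrC.
have := nm_zc ('d G a (plane v) - t^-1 *: (G (t *: plane v + a) - G a)).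
by move=> h; rewrite ler_pM2r //; lra.
Qed.

(** Otherwise the image of the injective differential, of real dimension 2, would be the complex
    line [{0} x C]. It contains [Jc] of its own vectors, against total reality. *)
Lemma some_transverse : exists v, zc ('d G a (plane v)) != 0.
Proof.
apply: contrapT => no.
have z0 v : zc ('d G a (plane v)) = 0.
  by apply/eqP; apply/negPn/negP => nz; apply: no; exists v.
pose L v := wc ('d G a (plane v)).
have LD v w : L (v + w) = L v + L w by rewrite /L planeD linearD wcD.
have LZ (t : R) v : L (t%:C%C * v) = t%:C%C * L v by rewrite /L planeZ linearZ wcZ.
have Linj v : L v = 0 -> v = 0.
  move=> Lv; have e : 'd G a (plane v) = 0.
    by apply: zc_wc_inj; rewrite ?z0 -/(L v) ?Lv; apply/eqP; rewrite eq_complex /= !mxE !eqxx.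
  by rewrite -(planeK v) (differential_inj e) -[0]/(0 : 'rV[R]_2) /planeV !mxE.
have Lst (s t : R) : L (Complex s t) = s%:C%C * L 1 + t%:C%C * L 'i%C.
  rewrite -!LZ -LD; congr L; apply/eqP; rewrite eq_complex !cReD !cImD !cReM !cImM /=.
  by apply/andP; split; apply/eqP; ring.
have [s [t st]] : exists s t : R, s%:C%C * L 1 + t%:C%C * L 'i%C = 'i%C * L 1.
  apply: real_basis => s t; rewrite -Lst => /Linj e.
  by split; [exact: (congr1 (fun x => Re x) e)|exact: (congr1 (fun x => Im x) e)].
pose v := Complex s t; have vE : L v = 'i%C * L 1 by rewrite /v Lst.
have eJ : 'd G a (plane v) = Jc ('d G a (plane 1)).
  by apply: zc_wc_inj; rewrite ?zcJ ?wcJ ?z0 ?mulr0.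
have J0 : Jc ('d G a (plane 1)) = 0.
  apply: (trN (KN Ka)); first by rewrite -eJ; exact: tangent_differential.
  by exists ('d G a (plane 1)); split=> //; exact: tangent_differential.
have : L 1 = 0.
  have : wc (Jc ('d G a (plane 1))) = 0.
    by rewrite J0; apply/eqP; rewrite eq_complex /= !mxE !eqxx.
  rewrite wcJ -/(L 1) => /eqP; rewrite mulf_eq0 => /orP[/eqP i0|/eqP //].
  by move: i0 => /(congr1 (fun x => Im x)) /= /eqP; rewrite oner_eq0.
by move=> /Linj /eqP; rewrite oner_eq0.
Qed.

End InteriorPoint.
End TotallyRealDisc.

(** At [t] and [- t] the sign condition bounds the real part of the linear term from both sides by
    the error, and the slope bound carries this over to the imaginary part. *)
Lemma stationary (R : realType) (dZ : R -> R[i]) (zeta tau : R[i]) (t1 : R) :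
  nm tau = 1 -> 0 < t1 ->
  (forall e : R, 0 < e -> exists2 t0, 0 < t0 & forall t : R, 0 < `|t| < t0 ->
     nm (dZ t - t%:C%C * zeta) <= e * `|t|) ->
  (forall t, 0 < `|t| < t1 -> Re (conjc tau * dZ t) <= 0) ->
  (forall t, 0 < `|t| < t1 ->
     `|Im (conjc tau * dZ t)| <= (1 / 10) * `|Re (conjc tau * dZ t)|) ->
  zeta = 0.
Proof.
move=> tau1 t10 fo neg ch; apply/eqP/negPn/negP; rewrite -nm_gt0 => m0.
have e0 : 0 < nm zeta / 10 by rewrite divr_gt0.
have [t0 t00 h0] := fo _ e0.
pose t := Num.min t0 t1 / 2; have tp : 0 < t by rewrite divr_gt0 // lt_min t00.
have tt0 : t < t0.
  have : Num.min t0 t1 <= t0 by rewrite ge_min lexx.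
  by rewrite /t; linarith.
have tt1 : t < t1.
  have : Num.min t0 t1 <= t1 by rewrite ge_min lexx orbT.
  by rewrite /t; linarith.
clearbody t.
have E (s : R) : `|s| = t ->
   [/\ `|Re (conjc tau * dZ s) - s * Re (conjc tau * zeta)| <= nm zeta / 10 * t,
       `|Im (conjc tau * dZ s) - s * Im (conjc tau * zeta)| <= nm zeta / 10 * t,
       Re (conjc tau * dZ s) <= 0 &
       `|Im (conjc tau * dZ s)| <= (1 / 10) * `|Re (conjc tau * dZ s)|].
  move=> st; have b0 : 0 < `|s| < t0 by rewrite st tp.
  have b1 : 0 < `|s| < t1 by rewrite st tp.
  have h : nm (conjc tau * (dZ s - s%:C%C * zeta)) <= nm zeta / 10 * t.
    by rewrite nmM nmJ tau1 mul1r -st; exact: h0.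
  have ex : conjc tau * (dZ s - s%:C%C * zeta) =
      conjc tau * dZ s - s%:C%C * (conjc tau * zeta) by ring.
  split; [| |exact: (neg _ b1)|exact: (ch _ b1)]; apply: le_trans h; rewrite ler_norml; apply/andP.
    by have := Re_bound (conjc tau * (dZ s - s%:C%C * zeta));
       rewrite ex cReB (cReM s%:C%C) /= mul0r subr0.
  by have := Im_bound (conjc tau * (dZ s - s%:C%C * zeta));
     rewrite ex cImB (cImM s%:C%C) /= mul0r addr0.
have [a1 a2 a3 a4] := E t (gtr0_norm tp).
have [|b1 _ b3 _] := E (- t); first by rewrite normrN gtr0_norm.
have := nm_le_ReIm (conjc tau * zeta); rewrite nmM nmJ tau1 mul1r.
move: a1 a2 a3 a4 b1 b3; rewrite mulNr.
move: (Re (conjc tau * dZ t)) (Im (conjc tau * dZ t)) (Re (conjc tau * dZ (- t))) => x y x'.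
move: (Re (conjc tau * zeta)) (Im (conjc tau * zeta)) (nm zeta) m0 e0 => p q m m0 e0.
move=> a1 a2 a3 a4 b1 b3 mpq.
have [A1 A2] : - (m / 10 * t) <= x - t * p /\ x - t * p <= m / 10 * t.
  by move: a1; rewrite ler_norml => /andP.
have [B1 B2] : - (m / 10 * t) <= x' - - (t * p) /\ x' - - (t * p) <= m / 10 * t.
  by move: b1; rewrite ler_norml => /andP.
have tn (s : R) : t * `|s| = `|t * s| by rewrite normrM gtr0_norm.
have P1 : t * `|p| <= m / 10 * t.
  by rewrite tn ler_norml; linarith.
have Q1 : t * `|q| <= m / 10 * t + 1 / 10 * (m / 10 * t + m / 10 * t).
  rewrite tn; have : `|t * q| <= `|y - t * q| + `|y|.
    by have := ler_normB y (y - t * q); rewrite opprB addrC subrK addrC.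
  have : `|x| <= m / 10 * t + m / 10 * t.
    by move: P1; rewrite (ler0_norm a3) tn ler_norml; linarith.
  by linarith.
have : t * m <= t * (`|p| + `|q|) by rewrite ler_pM2l.
have : 0 < t * m by rewrite mulr_gt0.
by linarith.
Qed.

(** * The parametrized disc over the level curve *)

Section Disc.
Variables (R : realType) (h : 'rV[R]_2 -> R) (K N : set 'rV[R]_4).
Hypothesis sh : smooth h.
Variables (f : 'rV[R]_4 -> 'rV[R]_2) (g : 'rV[R]_2 -> 'rV[R]_4).
Hypotheses (trN : totally_real N) (KN : K `<=` N) (KE : K `<=` E_h_star_times_C h).
Hypothesis gK : forall y, @closed_unit_disc R y -> K (g y).
Hypothesis gf : forall y, @closed_unit_disc R y -> f (g y) = y.
Hypothesis fK : forall p, K p -> @closed_unit_disc R (f p).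
Hypothesis fg : forall p, K p -> g (f p) = p.
Hypotheses (C1f : C1_map_on K f) (C1g : C1_map_on (@closed_unit_disc R) g).
Let D (u : R[i]) := nm u <= 1.

Let Z u := zc (g (plane u)).
Let W u := wc (g (plane u)).
Let T u := tangent h (Z u).

Lemma ccont_Z : ccont D Z.
Proof.
move=> u0 Du0 e e0; have e2 : 0 < e / 2 by rewrite divr_gt0.
have [d d0 hd] := disc_ccont C1g Du0 e2; exists d => // u Du hu.
by rewrite /Z -zcB; have := nm_zc (g (plane u) - g (plane u0)); have := hd _ Du hu; lra.
Qed.

Lemma ccont_W : ccont D W.
Proof.
move=> u0 Du0 e e0; have e2 : 0 < e / 2 by rewrite divr_gt0.
have [d d0 hd] := disc_ccont C1g Du0 e2; exists d => // u Du hu.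
by rewrite /W -wcB; have := nm_wc (g (plane u) - g (plane u0)); have := hd _ Du hu; lra.
Qed.

Lemma disc_in_level u : D u -> E_h_star h (plane (Z u)).
Proof. by move=> /disc_plane/gK/KE; rewrite /E_h_star_times_C /= pr_z_plane. Qed.

Lemma disc_grad u : D u -> grad h (Z u) != 0.
Proof. by move=> /disc_in_level /(grad_neq0 sh). Qed.

Lemma disc_level u : D u -> h (plane (Z u)) = 0.
Proof. by move=> /disc_in_level []. Qed.

Lemma uniform_chart : exists2 r, 0 < r &
  (forall u0 u v, D u0 -> D u -> D v -> nm (Z u - Z u0) < r -> nm (Z v - Z u0) < r ->
    `|Im (conjc (T u0) * (Z v - Z u))| <= (1 / 10) * `|Re (conjc (T u0) * (Z v - Z u))|) /\
  (forall u0 u, D u0 -> D u -> nm (Z u - Z u0) < r -> nm (T u - T u0) <= 1 / 10).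
Proof.
have [||r r0 hr] := @ccompact_disc R (fun u0 r =>
  (forall u v, D u -> D v -> nm (Z u - Z u0) < r -> nm (Z v - Z u0) < r ->
    `|Im (conjc (T u0) * (Z v - Z u))| <= (1 / 10) * `|Re (conjc (T u0) * (Z v - Z u))|) /\
  (forall u, D u -> nm (Z u - Z u0) < r -> nm (T u - T u0) <= 1 / 10)).
- move=> u d d' le [h1 h2]; split=> [v w Dv Dw hv hw|v Dv hv].
    by apply: h1 => //; exact: lt_le_trans le.
  by apply: h2 => //; exact: lt_le_trans le.
- move=> u0 Du0; have g0 := disc_grad Du0.
  have e20 : 0 < 1 / 20 :> R by lra.
  have [d1 d10 h1] := level_chart sh g0; have [d2 d20 h2] := tangent_continuous sh g0 e20.
  pose m := Num.min d1 d2; have m0 : 0 < m / 2 by rewrite divr_gt0 // lt_min d10.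
  have m1 : m <= d1 by rewrite ge_min lexx.
  have m2 : m <= d2 by rewrite ge_min lexx orbT.
  have [d d0 hd] := ccont_Z Du0 m0.
  exists (Num.min d (m / 2)); first by rewrite lt_min d0.
  move=> u Du; rewrite lt_min => /andP[l1 _]; have hu := hd _ Du l1.
  have hv v : nm (Z v - Z u) < Num.min d (m / 2) -> nm (Z v - Z u0) < m.
    by rewrite lt_min => /andP[_ l2]; have := nm_tri (Z u) (Z v) (Z u0); lra.
  split=> [v w Dv Dw /hv lv /hv lw|v Dv /hv lv].
    by apply: h1; rewrite ?disc_level //; lra.
  have [_ t1] := h2 (Z v) ltac:(lra); have [_ t2] := h2 (Z u) ltac:(lra).
  rewrite /T; move: t1 t2.
  move: (tangent h (Z u)) (tangent h (Z v)) (tangent h (Z u0)) => x y z t1 t2.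
  by have := nm_tri z y x; rewrite (nmBC z x); lra.
by exists r => //; split=> [u0 u v Du0|u0 u Du0]; [exact: (hr _ Du0).1|exact: (hr _ Du0).2].
Qed.

(** On a line through [u0] along which the differential of [Z] does not vanish, [stationary]
    excludes that the position stays on one side. *)
Lemma disc_no_extremum r u0 d : 0 < r ->
  (forall u, D u -> nm (Z u - Z u0) < r ->
    `|Im (conjc (T u0) * (Z u - Z u0))| <= (1 / 10) * `|Re (conjc (T u0) * (Z u - Z u0))|) ->
  0 < d -> (forall u, nm (u - u0) < d -> D u) ->
  (exists2 u, nm (u - u0) < d & 0 < Re (conjc (T u0) * (Z u - Z u0))) /\
  (exists2 u, nm (u - u0) < d & Re (conjc (T u0) * (Z u - Z u0)) < 0).
Proof.
move=> r0 chart d0 int; have Du0 : D u0 by apply: int; rewrite subrr nm0.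
have [U [G [oU Ua C1 eG]]] := C1g ((disc_plane u0).2 Du0).
have [v nz] := some_transverse trN KN gK gf C1f d0 int oU Ua C1 eG.
have fo := first_order_Z d0 int oU Ua C1 eG v.
have [d' d'0 hd'] := ccont_Z Du0 r0.
pose B := nm v + 1; have B0 : 0 < B by rewrite /B; have := nm_ge0 v; lra.
pose t1 := Num.min d d' / B; have t10 : 0 < t1 by rewrite divr_gt0 // lt_min d0.
have tU (t : R) : 0 < `|t| < t1 -> nm (u0 + t%:C%C * v - u0) < d /\ nm (Z (u0 + t%:C%C * v) - Z u0) < r.
  rewrite ltr_pdivlMr // => /andP[_]; rewrite lt_min => /andP[l1 l2].
  have le : nm (u0 + t%:C%C * v - u0) <= `|t| * B.
    by rewrite addrAC subrr add0r nmM nm_real ler_wpM2l // /B lerDl.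
  have ld := le_lt_trans le l1; split=> //.
  by apply: hd'; [exact: int|exact: le_lt_trans l2].
have T1 := tangent_unit (disc_grad Du0).
split; apply: contrapT => no; move/eqP: nz; apply.
  apply: (@stationary _ (fun t => Z (u0 + t%:C%C * v) - Z u0) _ _ _ T1 t10 fo) => t /tU [l1 l2].
    by rewrite leNgt; apply/negP => pos; apply: no; exists (u0 + t%:C%C * v).
  by apply: chart => //; exact: int.
apply/eqP; rewrite -oppr_eq0; apply/eqP.
apply: (@stationary _ (fun t => - (Z (u0 + t%:C%C * v) - Z u0)) _ _ _ T1 t10) => [e e0|t /tU [l1 l2]|t /tU [l1 l2]].
- have [t0 t00 ht] := fo _ e0; exists t0 => // t /ht.
  by rewrite mulrN -opprD nmN.
- rewrite mulrN cReN oppr_le0 leNgt; apply/negP => pos; apply: no.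
  by exists (u0 + t%:C%C * v).
by rewrite mulrN cReN cImN !normrN; apply: chart => //; exact: int.
Qed.

Lemma disc_hull q : poly_hull K q -> K q.
Proof.
move=> hq; have [r r0 [chart Tclose]] := uniform_chart.
have [||||||||u [Du eZ eW]] := @hull_of_disc R Z W T r (zc q) (wc q) (@ccompact_disc R) ccont_Z ccont_W.
- move=> u0 Du0 e e0.
  have [d d0 hd] := tangent_continuous sh (disc_grad Du0) e0.
  have [d' d'0 hd'] := ccont_Z Du0 d0; exists d' => // u Du /(hd' _ Du) l.
  exact: (hd _ l).2.
- move=> u v Du Dv eZ eW; have := zc_wc_inj eZ eW => /(congr1 f).
  rewrite (gf ((disc_plane u).2 Du)) (gf ((disc_plane v).2 Dv)).
  by move=> /(congr1 (@planeV R)); rewrite !planeK.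
- exact: r0.
- by move=> u Du; apply: tangent_unit; exact: disc_grad.
- exact: chart.
- exact: Tclose.
- move=> u0 d d0 int; have Du0 : D u0 by apply: int; rewrite subrr nm0.
  apply: (disc_no_extremum r0 _ d0 int) => u Du l.
  by apply: chart; rewrite ?subrr ?nm0.
- move=> P M hP; have [n [a E]] := hpoly_ev2 P; rewrite -E; apply: hq => p Kp.
  rewrite E -(fg Kp) -(planeVK (f p)); apply: hP.
  by apply/disc_plane; rewrite planeVK; exact: fK.
have -> : q = g (plane u) by apply: zc_wc_inj.
by apply/gK/disc_plane.
Qed.

End Disc.

Theorem theorem4p1 (R : realType) (h : 'rV[R]_2 -> R) :
  smooth h ->
  forall K : set 'rV[R]_4,
    totally_real_disc K -> K `<=` E_h_star_times_C h ->
    polynomially_convex K.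
Proof.
move=> sh K [_ [N [_ trN KN [f [g [[fK gK fg gf] [C1f C1g]]]]]]] KE.
apply/seteqP; split=> q; last by move=> Kq n a M; apply.
exact: (disc_hull sh trN KN KE gK gf fK fg C1f C1g).
Qed.
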